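(* Let $a,b>0$ be constants with $a+b<\tfrac12$. There exists $\varepsilon_0>0$ such that for every fixed $0<\varepsilon<\varepsilon_0$ the following holds. Consider data $m,n,s,t,J,K,H$ with $m,n\to\infty$, where all $s_j=s$ and all $t_k=t$, and $H$ has no edges outside $\{u_1,\dots,u_J\}\times\{v_1,\dots,v_K\}$, such that uniformly $x_j,y_k=O(n^{1/2+\varepsilon})$; $X=O(n^{1+2\varepsilon})$; $J,K=O(n^{1/2+\varepsilon})$; $n=o(m^{1+\varepsilon})$, $m=o(n^{1+\varepsilon})$; and $\frac{(1-2\lambda)^2}{8A}\bigl(1+\frac{5m}{6n}+\frac{5n}{6m}\bigr)\le a\log n$. Let $G$ be uniformly random in $\mathcal{B}(\boldsymbol{s},\boldsymbol{t})$. Then the probability that the subgraph of $G$ induced by $\{u_1,\dots,u_J\}\cup\{v_1,\dots,v_K\}$ equals $H_{J,K}$ is \[ \lambda^X(1-\lambda)^{JK-X}\exp\Bigl(\Bigl(\frac{JK}{2}+\frac{(1-2\lambda)\omega_1}{4A}\Bigr)\Bigl(\frac1m+\frac1n\Bigr)-\frac{\omega_1^2}{4Amn}-\frac{(n+K)\omega_2}{4An^2}-\frac{(m+J)\omega_2'}{4Am^2}-\frac{1-2\lambda}{24A^2}\Bigl(\frac{\omega_3}{n^2}+\frac{\omega_3'}{m^2}\Bigr)+O(n^{-b})\Bigr). \]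
   Context: $\mathcal{B}(\boldsymbol{s},\boldsymbol{t})$ is the set of simple bipartite graphs on $\{u_1,\dots,u_m\}\cup\{v_1,\dots,v_n\}$ (edges only between $u$'s and $v$'s) with $\deg u_j=s_j$, $\deg v_k=t_k$; here $\boldsymbol{s}=(s,\dots,s)$ and $\boldsymbol{t}=(t,\dots,t)$ are constant positive integer vectors with $ms=nt$. $\lambda=s/n=t/m$, $A=\tfrac12\lambda(1-\lambda)$. $H$ is a fixed bipartite graph on the same vertex set with degrees $x_j$ of $u_j$ and $y_k$ of $v_k$, $X$ its number of edges, and $H_{J,K}$ its subgraph induced by $\{u_1,\dots,u_J\}\cup\{v_1,\dots,v_K\}$. For $\ell=1,2,3$, $\omega_\ell=\sum_{j=1}^J(x_j-\lambda K)^\ell$ and $\omega'_\ell=\sum_{k=1}^K(y_k-\lambda J)^\ell$. Asymptotic notation refers to $m,n\to\infty$. *)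

(* Defs.v *)
From HB Require Import structures.
From mathcomp Require Import all_boot all_order all_algebra.
From mathcomp Require Import reals sequences exp.
Set Implicit Arguments. Unset Strict Implicit. Unset Printing Implicit Defensive.
Import Order.TTheory GRing.Theory Num.Theory.
Local Open Scope ring_scope.

(* A bipartite graph on {u_0..u_(m-1)} ∪ {v_0..v_(n-1)} is its edge set,
   a subset of 'I_m * 'I_n (edge (j,k) joins u_j and v_k). *)
Definition bgraph (m n : nat) := {set 'I_m * 'I_n}.

Definition degu m n (G : bgraph m n) (j : 'I_m) : nat := #|[set k | (j, k) \in G]|.
Definition degv m n (G : bgraph m n) (k : 'I_n) : nat := #|[set j | (j, k) \in G]|.

Definition Bst (m n s t : nat) : {set bgraph m n} :=
  [set G : bgraph m n | [forall j, degu G j == s] && [forall k, degv G k == t]].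

Definition induced m n (J K : nat) (G : bgraph m n) : bgraph m n :=
  [set e in G | (e.1 < J)%N && (e.2 < K)%N].

Definition prob_induced (R : realType) m n s t J K (H : bgraph m n) : R :=
  (#|[set G in Bst m n s t | induced J K G == induced J K H]|%:R)
  / (#|Bst m n s t|%:R).

Definition lam (R : realType) (n s : nat) : R := s%:R / n%:R.
Definition Acoef (R : realType) (n s : nat) : R :=
  (lam R n s) * (1 - lam R n s) / 2.

Definition omega (R : realType) m n s J K (H : bgraph m n) (l : nat) : R :=
  \sum_(j : 'I_m | (j < J)%N) ((degu H j)%:R - lam R n s * K%:R) ^+ l.
Definition omega' (R : realType) m n s J K (H : bgraph m n) (l : nat) : R :=
  \sum_(k : 'I_n | (k < K)%N) ((degv H k)%:R - lam R n s * J%:R) ^+ l.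

Definition main_exponent (R : realType) m n s J K (H : bgraph m n) : R :=
  let l := lam R n s in let A := Acoef R n s in
  let mr : R := m%:R in let nr : R := n%:R in
  let Jr : R := J%:R in let Kr : R := K%:R in
  let w1 := omega R s J K H 1 in let w2 := omega R s J K H 2 in
  let w3 := omega R s J K H 3 in
  let w2' := omega' R s J K H 2 in let w3' := omega' R s J K H 3 in
  (Jr * Kr / 2 + (1 - 2 * l) * w1 / (4 * A)) * (1 / mr + 1 / nr)
  - w1 ^+ 2 / (4 * A * mr * nr)
  - (nr + Kr) * w2 / (4 * A * nr ^+ 2)
  - (mr + Jr) * w2' / (4 * A * mr ^+ 2)
  - (1 - 2 * l) / (24 * A ^+ 2) * (w3 / nr ^+ 2 + w3' / mr ^+ 2).

(* Main.v *)
(* Let N(H) be the number of graphs with the given degrees that induce H on the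
   block. The proof is by switchings and avoids complex integrals. For z, w
   outside the block, switching the rows j, z on the columns k, w gives

     N(H + jk) P_{H+jk}(jw, zk absent, zw present)
       = N(H) P_H(jw, zk present, zw absent).

   Put g(i,w) = 1[iw in G] - lambda. Both probabilities are combinations of
   moments of g over at most three entries. Those of entries in distinct rows
   and columns follow from exchangeability of the rows and columns outside the
   block. For the others, counting the switches at an entry (j,w) in two ways
   expresses E[f(G) g(j,w)] through quantities such as
   sum_i g(i,w) sum_v g(j,v) g(i,v), which are small because the matrix g has
   operator norm n^{1/2+o(1)}.

   The operator norm is bounded through the discrepancy of G, which is large
   with probability exp(-n^{1+c}) for independent edges of density lambda. This
   survives conditioning on the degrees and on the block: constant column sums
   are the most likely ones, so that the degrees are as prescribed with
   probability at least (n+1)^-m (m+1)^-n, and the sizes N(H) for different H are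
   compared by switchings.

   With Q the exponent in the theorem, the result is
   N(H + jk) / N(H) = lambda/(1-lambda) exp(Q(H+jk) - Q(H) + n^{-3/2+o(1)}),
   which is multiplied over the n^{1+o(1)} edges of H. The constant is found by
   normalisation: Q has mean n^{-1/2+o(1)} both under the true distribution and
   under independent edges. *)
Require Import Defs.
From HB Require Import structures.
From mathcomp Require Import topology normedtype.
From mathcomp Require Import all_boot all_order all_algebra perm.
From mathcomp Require Import boolp reals sequences exp.
From mathcomp Require Import ring lra zify.
Set Implicit Arguments. Unset Strict Implicit. Unset Printing Implicit Defensive.
Import Order.TTheory GRing.Theory Num.Theory.
Import numFieldNormedType.Exports.
Local Open Scope ring_scope.

(** * Taylor bounds *)

(** The block holds n^{1+o(1)} entries and the final error must stay below n^{-b} for any b < 1/2,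
    so each one-edge ratio is needed with error n^{-3/2+o(1)}, a factor n^{-1/2} beyond its last
    explicit term. The obstacle is that rows inside the block carry different prescribed patterns
    and are not exchangeable with one another: symmetry says nothing about two block rows meeting in
    an outer column. This forces the double count of switches and, through its error terms, the
    operator norm.

    All estimates before the last part are inequalities at fixed [m], [n] with errors
    [L ^+ c * h ^ k]; in the end [h] is the square root of [min m n] and [L = n^(3 eps)]. The
    hypothesis on [(1 - 2 lambda)^2 / (8 A)] enters as [1 / (lambda (1 - lambda)) <= L], so that
    dividing by the density costs only powers of [L]. The discrepancy threshold [7 L^2 h] lies a
    power of [L] above [h] because the rarity of bad graphs must outweigh the factor [(4 m n)^(J K)]
    lost in passing from all graphs to a single class. *)

Section ExpBounds.
Context {R : realType}.
Implicit Types x u : R.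

Lemma fact_ge_pow2 k : (2 ^ k <= k.+1`!)%N.
Proof. by elim: k => // k IH; rewrite factS expnS leq_mul. Qed.

(** The terms of degree 3 and more are dominated by a geometric series, since [(N + 3)!] is at least
    [2^(N + 2)]. The factor [1 - 2^-N] carries the partial sums through the induction before the
    limit is taken. *)
Lemma expR_taylor2 x : `|x| <= 1 ->
  `|expR x - (1 + x + x ^+ 2 / 2)| <= `|x| ^+ 3 / 2.
Proof.
move=> x1.
have part N : `|series (exp_coeff x) (N + 3)%N - (1 + x + x ^+ 2 / 2)|
    <= `|x| ^+ 3 / 2 * (1 - 2^-1 ^+ N).
  elim: N => [|N IH].
    rewrite add0n /series /= !big_nat_recr//= big_geq// /exp_coeff/=.
    rewrite expr0 expr1 !fact0 !factS !fact0 /=.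
    by rewrite [X in `|X|](_ : _ = 0) ?normr0 ?expr0 ?subrr ?mulr0//; field.
  have -> : series (exp_coeff x) (N.+1 + 3)%N - (1 + x + x ^+ 2 / 2) =
    (series (exp_coeff x) (N + 3)%N - (1 + x + x ^+ 2 / 2)) + exp_coeff x (N + 3)%N.
    by rewrite addSn seriesSr addrAC.
  apply: le_trans (ler_normD _ _) _.
  apply: le_trans (lerD IH (_ : _ <= `|x| ^+ 3 / 2 * 2^-1 ^+ N.+1)) _; last first.
    rewrite -mulrDr (exprS 2^-1); apply: ler_wpM2l; first by rewrite divr_ge0 ?exprn_ge0.
    lra.
  rewrite /exp_coeff /= normrM normfV normrX normr_nat exprD.
  rewrite (mulrC (`|x| ^+ N)) -2!(mulrA (`|x| ^+ 3)).
  apply: ler_wpM2l; first by rewrite exprn_ge0.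
  apply: (@le_trans _ _ ((N + 3)`!%:R^-1)).
    by apply: ler_piMl; rewrite ?invr_ge0 ?exprn_ile1.
  rewrite -exprS exprVn lef_pV2 ?posrE ?ltr0n ?fact_gt0 ?exprn_gt0//.
  by rewrite -natrX ler_nat (_ : N + 3 = N.+2.+1)%N ?fact_ge_pow2//; lia.
have part' N : (3 <= N)%N -> `|series (exp_coeff x) N - (1 + x + x ^+ 2 / 2)| <= `|x| ^+ 3 / 2.
  move=> N3; rewrite -(subnK N3); apply: le_trans (part _) _.
  rewrite -[leRHS]mulr1; apply: ler_wpM2l; first by rewrite divr_ge0 ?exprn_ge0.
  by rewrite lerBlDr lerDl; apply: exprn_ge0; rewrite invr_ge0.
rewrite ler_distl; apply/andP; split.
  apply: limr_ge; first exact: is_cvg_series_exp_coeff.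
  near=> N; have /part' : (3 <= N)%N by near: N; exact: nbhs_infty_ge.
  by rewrite ler_distl => /andP[].
apply: limr_le; first exact: is_cvg_series_exp_coeff.
near=> N; have /part' : (3 <= N)%N by near: N; exact: nbhs_infty_ge.
by rewrite ler_distl => /andP[].
Unshelve. all: by end_near. Qed.

Lemma expR_le_quadratic x : `|x| <= 1 -> expR x <= 1 + x + x ^+ 2.
Proof.
move=> x1; have := expR_taylor2 x1; rewrite ler_distl => /andP[_ h].
apply: le_trans h _.
have : `|x| ^+ 3 <= x ^+ 2.
  by rewrite exprSr -[leRHS]mulr1 -(real_normK (num_real x)) ler_wpM2l ?exprn_ge0.
lra.
Qed.

(** The logarithm is reached through the exponential: for [y = u - u^2 / 2] the difference of
    [expR y] and [1 + u] is of order [|u|^3], and [ln x <= x - 1], applied to their quotient and to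
    its inverse, carries this over to the logarithms. *)
Lemma ln1D_taylor2 u : `|u| <= 1 / 4 -> `|ln (1 + u) - (u - u ^+ 2 / 2)| <= 3 * `|u| ^+ 3.
Proof.
move=> u4; have := u4; rewrite ler_norml => /andP[ul ur].
set a := `|u| in u4 *; have a0 : 0 <= a by rewrite /a.
have a2 : a ^+ 2 = u ^+ 2 by rewrite /a real_normK ?num_real.
set y := u - u ^+ 2 / 2.
have y1 : `|y| <= 9 / 8 * a.
  apply: le_trans (ler_normB _ _) _; rewrite normrM normrX -/a.
  rewrite (_ : `|2^-1| = 2^-1 :> R); last by rewrite ger0_norm//; lra.
  nra.
have y1' : `|y| <= 1 by apply: le_trans y1 _; lra.
have := expR_taylor2 y1'.
set r := expR y - _ => hr.
have hr' : `|r| <= 729 / 1024 * a ^+ 3.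
  apply: le_trans hr _.
  have : `|y| ^+ 3 <= (9 / 8 * a) ^+ 3 by apply: lerXn2r; rewrite ?nnegrE//; lra.
  lra.
have ey : expR y = 1 + u + (r - u ^+ 3 / 2 + u ^+ 4 / 8).
  by rewrite /r /y; field.
set rho := r - _ + _ in ey.
have hrho : `|rho| <= 5 / 4 * a ^+ 3.
  apply: le_trans (ler_normD _ _) _; apply: le_trans (lerD (ler_normB _ _) (lexx _)) _.
  rewrite (normrM (u ^+ 3)) (normrM (u ^+ 4)) !normrX -/a !normfV !normr_nat.
  have : a ^+ 4 <= 1 / 4 * a ^+ 3 by rewrite exprS ler_wpM2r ?exprn_ge0.
  have : 0 <= a ^+ 3 by rewrite exprn_ge0.
  lra.
have u1 : 0 < 1 + u by lra.
have ey0 := expR_gt0 y.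
have eyl : 1 / 2 <= expR y by apply: le_trans (expR_ge1Dx y); rewrite /y; nra.
have e1 : ln (1 + u) - y = ln ((1 + u) / expR y) by rewrite ln_div ?posrE// expRK.
have bound (p q : R) : 0 < p -> 0 < q -> 1 / 2 <= q -> `|p - q| <= 5 / 4 * a ^+ 3 ->
    ln (p / q) <= 3 * a ^+ 3.
  move=> p0 q0 q1 pq.
  have -> : p / q = 1 + (p - q) / q by field; rewrite gt_eqF.
  apply: le_trans (le_ln1Dx _) _.
    by rewrite (_ : (p - q) / q = p / q - 1) ?ltrBrDr ?addNr ?divr_gt0//; field; rewrite gt_eqF.
  rewrite ler_pdivrMr//.
  have : p - q <= 5 / 4 * a ^+ 3 by apply: le_trans pq; exact: ler_norm.
  have : 0 <= a ^+ 3 by rewrite exprn_ge0.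
  nra.
rewrite ler_norml; apply/andP; split; last first.
  rewrite e1; apply: bound => //; by rewrite ey opprD addrA subrr sub0r normrN.
rewrite lerNl opprB.
have -> : y - ln (1 + u) = ln (expR y / (1 + u)) by rewrite ln_div ?posrE// expRK.
apply: bound => //; first lra.
by rewrite ey addrC addKr.
Qed.

End ExpBounds.

(** * Operator norms from bounds on subset sums *)

Section Norm2.
Context {R : realType} {I : finType}.
Implicit Types (u v c : I -> R) (S : {set I}).

Definition norm2 u : R := Num.sqrt (\sum_i u i ^+ 2).

Lemma sumsq_ge0 u : 0 <= \sum_i u i ^+ 2.
Proof. by apply: sumr_ge0 => i _; exact: sqr_ge0. Qed.

Lemma norm2_ge0 u : 0 <= norm2 u.
Proof. exact: sqrtr_ge0. Qed.

Lemma sqr_norm2 u : norm2 u ^+ 2 = \sum_i u i ^+ 2.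
Proof. by rewrite sqr_sqrtr ?sumsq_ge0. Qed.

Lemma le_norm2 u v : (forall i, `|u i| <= `|v i|) -> norm2 u <= norm2 v.
Proof.
move=> uv; apply: ler_wsqrtr; apply: ler_sum => i _.
rewrite -(real_normK (num_real (u i))) -(real_normK (num_real (v i))).
by apply: lerXn2r; rewrite ?nnegrE.
Qed.

Lemma norm2Z (a : R) u : norm2 (fun i => a * u i) = `|a| * norm2 u.
Proof.
rewrite /norm2; under eq_bigr do rewrite exprMn.
by rewrite -mulr_sumr sqrtrM ?sqr_ge0// sqrtr_sqr.
Qed.

Lemma coord_le_norm2 u i : `|u i| <= norm2 u.
Proof.
rewrite -sqrtr_sqr; apply: ler_wsqrtr; rewrite (bigD1 i)//= lerDl.
by apply: sumr_ge0 => j _; exact: sqr_ge0.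
Qed.

Lemma norm2_set S : norm2 (fun i => (i \in S)%:R) = Num.sqrt #|S|%:R.
Proof.
rewrite /norm2 -sum1_card natr_sum [in RHS]big_mkcond /=.
by congr Num.sqrt; apply: eq_bigr => i _; case: ifP => /=; rewrite ?expr1n ?expr0n.
Qed.

Lemma cauchy_schwarz u v : `|\sum_i u i * v i| <= norm2 u * norm2 v.
Proof.
rewrite -(@ler_pXn2r _ 2) ?nnegrE ?mulr_ge0 ?norm2_ge0// real_normK ?num_real//.
rewrite exprMn !sqr_norm2.
set a := \sum_i u i ^+ 2; set b := \sum_i v i ^+ 2; set p := \sum_i u i * v i.
have h t : 0 <= a * t ^+ 2 - p * t *+ 2 + b.
  have -> : a * t ^+ 2 - p * t *+ 2 + b = \sum_i (t * u i - v i) ^+ 2.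
    rewrite (eq_bigr (fun i => t ^+ 2 * u i ^+ 2 - 2 * t * (u i * v i) + v i ^+ 2)); last by move=> i _; ring.
    by rewrite big_split sumrB /= -!mulr_sumr -/a -/b -/p; ring.
  exact: sumsq_ge0.
have a0 : 0 <= a by exact: sumsq_ge0.
have [a1|a1] := eqVneq a 0; last first.
  (* The nonnegative quadratic attains its minimum at this point. *)
  have := h (p / a).
  have -> : a * (p / a) ^+ 2 - p * (p / a) *+ 2 + b = (a * b - p ^+ 2) / a by field.
  by rewrite pmulr_lge0 ?invr_gt0 ?lt_def ?a1 ?a0// subr_ge0.
suff -> : p = 0 by rewrite expr0n mulr_ge0 ?sumsq_ge0.
apply: big1 => i _; move: a1 => /eqP; rewrite psumr_eq0; last by move=> *; exact: sqr_ge0.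
by move=> /allP /(_ i (mem_index_enum _)); rewrite /= sqrf_eq0 => /eqP ->; rewrite mul0r.
Qed.

Lemma sum_abs_le u : \sum_i `|u i| <= Num.sqrt #|I|%:R * norm2 u.
Proof.
have := cauchy_schwarz (fun i => (i \in [set: I])%:R) (fun i => `|u i|).
rewrite norm2_set cardsT ger0_norm; last by apply: sumr_ge0 => i _; rewrite mulr_ge0.
under eq_bigr do rewrite inE mul1r.
have -> // : norm2 (fun i => `|u i|) = norm2 u.
by rewrite /norm2; congr Num.sqrt; apply: eq_bigr => i _; rewrite real_normK ?num_real.
Qed.

(* A bound on all subset sums extends to all real weights, by expanding the
   weights in base 2: each digit set is supported where the weight is large,
   so its contribution is at most [D * norm2 u]. *)
Lemma binary_digits c (D : R) l u : 0 <= D ->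
  (forall S, `|\sum_(i in S) c i| <= D * Num.sqrt #|S|%:R) ->
  (forall i, 0 <= u i <= 1) ->
  `|\sum_i u i * c i| <= l%:R * D * norm2 u + 2^-1 ^+ l * \sum_i `|c i|.
Proof.
move=> D0 hc; elim: l u => [|l IH] u hu.
  rewrite !mul0r add0r expr0 mul1r; apply: le_trans (ler_norm_sum _ _ _) _.
  apply: ler_sum => i _; have /andP[u0 u1] := hu i.
  by rewrite normrM ger0_norm// ler_piMl.
pose S := [set i | 1 / 2 <= u i].
pose u' i := 2 * u i - (i \in S)%:R.
have hu' i : 0 <= u' i <= 1.
  have /andP[u0 u1] := hu i; rewrite /u' inE; case: (leP (1 / 2) (u i)) => h /=; apply/andP; split; lra.
have -> : \sum_i u i * c i = 2^-1 * (\sum_(i in S) c i + \sum_i u' i * c i).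
  rewrite [X in X + _]big_mkcond -big_split /= mulr_sumr; apply: eq_bigr => i _.
  by rewrite /u'; case: ifP => _ /=; field.
have sS : 2^-1 * Num.sqrt #|S|%:R <= norm2 u.
  rewrite -norm2_set -[X in X * _]ger0_norm ?invr_ge0// -norm2Z.
  apply: le_norm2 => i; rewrite inE; have /andP[u0 u1] := hu i.
  by rewrite normrM normfV !normr_nat ger0_norm//; case: (leP (1 / 2) (u i)) => h /=; lra.
have su' : 2^-1 * norm2 u' <= norm2 u.
  rewrite -[X in X * _]ger0_norm ?invr_ge0// -norm2Z.
  apply: le_norm2 => i; have /andP[u0 u1] := hu i; have /andP[u0' u1'] := hu' i.
  rewrite normrM normfV normr_nat !ger0_norm//.
  by rewrite /u' in u0' *; case: (i \in S) u0' => /= u0'; lra.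
rewrite normrM ger0_norm ?invr_ge0//.
apply: (@le_trans _ _ (2^-1 * (D * Num.sqrt #|S|%:R + (l%:R * D * norm2 u' + 2^-1 ^+ l * \sum_i `|c i|)))).
  by rewrite ler_wpM2l ?invr_ge0//; apply: le_trans (ler_normD _ _) _; exact: lerD (hc S) (IH _ hu').
rewrite exprS -natr1.
have h1 := ler_wpM2l D0 sS.
have h2 : l%:R * D * (2^-1 * norm2 u') <= l%:R * D * norm2 u by apply: ler_wpM2l => //; rewrite mulr_ge0.
set a := \sum_i `|c i|; set q := 2^-1 ^+ l.
have -> : 2^-1 * (D * Num.sqrt #|S|%:R + (l%:R * D * norm2 u' + q * a)) =
  D * (2^-1 * Num.sqrt #|S|%:R) + l%:R * D * (2^-1 * norm2 u') + 2^-1 * q * a by ring.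
by rewrite lerD2r; apply: le_trans (lerD h1 h2) _; lra.
Qed.

(** Scaling to norm 1 puts the weights in [[-1, 1]]; the positive and the negative part then satisfy
    the hypotheses of [binary_digits] separately, whence the factor 2. *)
Lemma subset_sums_linear c (D : R) l u : 0 <= D ->
  (forall S, `|\sum_(i in S) c i| <= D * Num.sqrt #|S|%:R) ->
  `|\sum_i u i * c i| <= 2 * (l%:R * D + 2^-1 ^+ l * \sum_i `|c i|) * norm2 u.
Proof.
move=> D0 hc.
have [u0|u0] := eqVneq (norm2 u) 0.
  rewrite big1 ?normr0 ?u0 ?mulr0// => i _.
  have := coord_le_norm2 u i; rewrite u0 normr_le0 => /eqP ->; exact: mul0r.
have up : 0 < norm2 u by rewrite lt_def u0 norm2_ge0.
pose v i := u i / norm2 u.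
have hv i : `|v i| <= 1.
  by rewrite /v normrM normfV (gtr0_norm up) ler_pdivrMr// mul1r coord_le_norm2.
pose p i := (`|v i| + v i) / 2; pose q i := (`|v i| - v i) / 2.
have hp i : 0 <= p i <= 1.
  have := hv i; have := ler_norm (v i); have := ler_norm (- v i); rewrite /p normrN.
  by move=> *; apply/andP; split; lra.
have hq i : 0 <= q i <= 1.
  have := hv i; have := ler_norm (v i); have := ler_norm (- v i); rewrite /q normrN.
  by move=> *; apply/andP; split; lra.
have nv : norm2 v = 1.
  rewrite (_ : v = fun i => (norm2 u)^-1 * u i); last first.
    by apply: funext => i; rewrite /v mulrC.
  by rewrite norm2Z normfV gtr0_norm// mulVf.
have np : norm2 p <= 1.
  rewrite -nv; apply: le_norm2 => i; have /andP[p0 p1] := hp i; rewrite ger0_norm//.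
  by rewrite /p; have := ler_norm (v i); lra.
have nq : norm2 q <= 1.
  rewrite -nv; apply: le_norm2 => i; have /andP[p0 p1] := hq i; rewrite ger0_norm//.
  by rewrite /q; have := ler_norm (- v i); rewrite normrN; lra.
have -> : \sum_i u i * c i = norm2 u * (\sum_i p i * c i - \sum_i q i * c i).
  rewrite -sumrB mulr_sumr; apply: eq_bigr => i _.
  by rewrite /p /q /v; field.
rewrite normrM (gtr0_norm up) mulrC; apply: ler_wpM2r; first exact: norm2_ge0.
apply: le_trans (ler_normB _ _) _.
have lD : 0 <= l%:R * D by rewrite mulr_ge0.
have hb w : norm2 w <= 1 -> (forall i, 0 <= w i <= 1) ->
    `|\sum_i w i * c i| <= l%:R * D + 2^-1 ^+ l * \sum_i `|c i|.
  move=> nw hw; apply: le_trans (binary_digits l D0 hc hw) _.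
  by rewrite lerD2r ler_piMr.
by have := hb _ np hp; have := hb _ nq hq; lra.
Qed.

End Norm2.

Section OperatorNorm.
Context {R : realType} {I W : finType}.
Variables (g : I -> W -> R) (D : R) (l : nat).
Hypothesis g1 : forall i w, `|g i w| <= 1.
Hypothesis D0 : 0 <= D.
Hypothesis disc : forall (S : {set I}) (T : {set W}),
  `|\sum_(i in S) \sum_(w in T) g i w| <= D * Num.sqrt #|S|%:R * Num.sqrt #|T|%:R.
Hypothesis sizes : (#|I| * #|W| <= 2 ^ l)%N.

(** [subset_sums_linear] is used twice, on the columns for a fixed row set and then on the rows, so
    passing from discrepancy to operator norm costs a factor of order [l^2]. The hypothesis [sizes]
    keeps both truncation tails bounded. *)
Lemma operator_norm u v :
  `|\sum_i u i * \sum_w g i w * v w| <=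
  2 * (l%:R * (2 * (l%:R * D + 1)) + 1) * norm2 u * norm2 v.
Proof.
have sq k : (Num.sqrt k%:R : R) <= k%:R.
  case: k => [|k]; first by rewrite sqrtr0.
  have k1 : (1 : R) <= k.+1%:R by rewrite ler1n.
  rewrite -[leRHS]ger0_norm// -sqrtr_sqr; apply: ler_wsqrtr.
  by rewrite expr2 ler_peMl.
have q1 : 2^-1 ^+ l * (#|I|%:R * #|W|%:R) <= 1 :> R.
  rewrite exprVn mulrC ler_pdivrMr ?exprn_gt0// mul1r -natrM -natrX ler_nat//.
have q0 : 0 <= 2^-1 ^+ l :> R by apply: exprn_ge0; rewrite invr_ge0.
have step1 (S : {set I}) : `|\sum_(i in S) \sum_w g i w * v w| <=
    (2 * (l%:R * D + 1) * norm2 v) * Num.sqrt #|S|%:R.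
  have -> : \sum_(i in S) \sum_w g i w * v w = \sum_w v w * \sum_(i in S) g i w.
    by rewrite exchange_big /=; apply: eq_bigr => w _; rewrite mulr_sumr; apply: eq_bigr => i _; rewrite mulrC.
  have hc (T : {set W}) : `|\sum_(w in T) \sum_(i in S) g i w| <= D * Num.sqrt #|S|%:R * Num.sqrt #|T|%:R.
    by rewrite exchange_big /=; exact: disc.
  apply: le_trans (subset_sums_linear l v (mulr_ge0 D0 (sqrtr_ge0 _)) hc) _.
  rewrite [leRHS]mulrAC; apply: ler_wpM2r; first exact: norm2_ge0.
  rewrite -mulrA; apply: ler_wpM2l => //.
  rewrite mulrDl mul1r mulrA lerD2l.
  have : \sum_w `|\sum_(i in S) g i w| <= #|W|%:R * #|S|%:R.
    apply: (@le_trans _ _ (\sum_(w : W) #|S|%:R)).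
      apply: ler_sum => w _; apply: le_trans (ler_norm_sum _ _ _) _.
      rewrite -sum1_card natr_sum; apply: ler_sum => i _; exact: g1.
    by rewrite sumr_const mulr_natl.
  move=> h; apply: le_trans (ler_wpM2l q0 h) _.
  rewrite -[X in _ * (_ * X)](sqr_sqrtr (ler0n R _)) expr2 !mulrA.
  apply: ler_piMl; first exact: sqrtr_ge0.
  apply: le_trans q1; rewrite -mulrA; apply: ler_wpM2l => //; rewrite mulrC.
  apply: ler_wpM2r => //; apply: le_trans (sq _) _; rewrite ler_nat; exact: max_card.
have v0 := norm2_ge0 v.
have D2 : 0 <= 2 * (l%:R * D + 1) by rewrite mulr_ge0// addr_ge0// mulr_ge0.
apply: le_trans (subset_sums_linear l u (mulr_ge0 D2 v0) step1) _.
rewrite [leRHS]mulrAC; apply: ler_wpM2r; first exact: norm2_ge0.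
rewrite -[leRHS]mulrA; apply: ler_wpM2l => //.
have : \sum_i `|\sum_w g i w * v w| <= #|I|%:R * (#|W|%:R * norm2 v).
  apply: (@le_trans _ _ (\sum_(i : I) (#|W|%:R * norm2 v))).
    apply: ler_sum => i _; apply: le_trans (ler_norm_sum _ _ _) _.
    apply: (@le_trans _ _ (\sum_w `|v w|)).
      by apply: ler_sum => w _; rewrite normrM ler_piMl.
    apply: le_trans (sum_abs_le _) _; exact: ler_wpM2r.
  by rewrite sumr_const [leRHS]mulr_natl.
move=> /(ler_wpM2l q0) h.
have h' : 2^-1 ^+ l * (#|I|%:R * (#|W|%:R * norm2 v)) <= norm2 v by rewrite !mulrA ler_piMl// -mulrA.
lra.
Qed.

End OperatorNorm.

(** * Averages over graph classes and switchings *)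

Section Average.
Context {R : realType} {T : finType}.
Implicit Types (A : {set T}) (f : T -> R).

(** Over an empty class the quotient is 0 by the convention for division; linearity and monotonicity
    thus hold for every class, and only the average of a constant asks for nonemptiness. *)
Definition avg A f : R := (\sum_(G in A) f G) / #|A|%:R.

Lemma eq_avg A f f' : (forall G, G \in A -> f G = f' G) -> avg A f = avg A f'.
Proof. by move=> ff'; congr (_ / _); apply: eq_bigr => G GA; exact: ff'. Qed.

Lemma avgD A f f' : avg A (fun G => f G + f' G) = avg A f + avg A f'.
Proof. by rewrite /avg big_split mulrDl. Qed.

Lemma avgZ A (a : R) f : avg A (fun G => a * f G) = a * avg A f.
Proof. by rewrite /avg -mulr_sumr mulrA. Qed.

Lemma avgN A f : avg A (fun G => - f G) = - avg A f.
Proof. by rewrite /avg sumrN mulNr. Qed.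

Lemma avgB A f f' : avg A (fun G => f G - f' G) = avg A f - avg A f'.
Proof. by rewrite avgD avgN. Qed.

Lemma avg_const A (a : R) : A != set0 -> avg A (fun=> a) = a.
Proof.
by move=> A0; rewrite /avg sumr_const -(mulr_natr a) mulfK// pnatr_eq0 -lt0n card_gt0.
Qed.

Lemma avg_sum A (I : finType) (P : pred I) (F : I -> T -> R) :
  avg A (fun G => \sum_(i | P i) F i G) = \sum_(i | P i) avg A (F i).
Proof. by rewrite /avg exchange_big mulr_suml. Qed.

Lemma ler_avg A f f' : (forall G, G \in A -> f G <= f' G) -> avg A f <= avg A f'.
Proof. by move=> ff'; rewrite ler_wpM2r ?invr_ge0// ler_sum. Qed.

Lemma avg_ge0 A f : (forall G, G \in A -> 0 <= f G) -> 0 <= avg A f.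
Proof. by move=> f0; rewrite divr_ge0// sumr_ge0. Qed.

Lemma ler_norm_avg A f : `|avg A f| <= avg A (fun G => `|f G|).
Proof.
by rewrite normrM [in X in _ * X]ger0_norm ?invr_ge0// ler_wpM2r ?invr_ge0// ler_norm_sum.
Qed.

Lemma avg_cauchy_schwarz A f f' :
  `|avg A (fun G => f G * f' G)| <=
  Num.sqrt (avg A (fun G => f G ^+ 2)) * Num.sqrt (avg A (fun G => f' G ^+ 2)).
Proof.
have nA : forall F, Num.sqrt (avg A (fun G => F G ^+ 2)) =
    norm2 (fun G => (G \in A)%:R * F G) * Num.sqrt #|A|%:R^-1.
  move=> F; rewrite /avg sqrtrM ?sumr_ge0// => [|G _]; last exact: sqr_ge0.
  congr (Num.sqrt _ * _); rewrite big_mkcond; apply: eq_bigr => G _.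
  by case: ifP => _; rewrite ?mul1r ?mul0r ?expr0n.
rewrite !nA mulrACA -expr2 sqr_sqrtr ?invr_ge0//.
rewrite normrM [in X in _ * X]ger0_norm ?invr_ge0// ler_wpM2r ?invr_ge0//.
apply: le_trans (cauchy_schwarz _ _); rewrite big_mkcond le_eqVlt; apply/orP; left; apply/eqP.
by congr `|_|; apply: eq_bigr => G _; case: ifP => _; rewrite ?mul1r ?mul0r.
Qed.

End Average.

Section Classes.
Context {m n : nat}.
Implicit Types (G H : bgraph m n) (i j z : 'I_m) (k w : 'I_n).

Lemma degu_sum G i : degu G i = (\sum_w ((i, w) \in G))%N.
Proof. by rewrite /degu -sum1_card big_mkcond; apply: eq_bigr => w _; rewrite inE; case: ifP. Qed.

Lemma degv_sum G w : degv G w = (\sum_i ((i, w) \in G))%N.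
Proof. by rewrite /degv -sum1_card big_mkcond; apply: eq_bigr => i _; rewrite inE; case: ifP. Qed.

Lemma in_BstP (s t : nat) G :
  reflect ((forall i, degu G i = s) /\ (forall w, degv G w = t)) (G \in Bst m n s t).
Proof.
rewrite inE; apply: (iffP andP) => [[/forallP h1 /forallP h2]|[h1 h2]]; split.
- by move=> i; apply/eqP.
- by move=> i; apply/eqP.
- by apply/forallP => i; apply/eqP.
- by apply/forallP => i; apply/eqP.
Qed.

Definition block (J K : nat) : {set 'I_m * 'I_n} :=
  [set e : 'I_m * 'I_n | (e.1 < J)%N && (e.2 < K)%N].

Definition extensions (s t J K : nat) H : {set bgraph m n} :=
  [set G in Bst m n s t | induced J K G == H].

Lemma extensionsP (s t J K : nat) H G : H \subset block J K ->
  reflect (G \in Bst m n s t /\ forall e, e \in block J K -> (e \in G) = (e \in H))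
          (G \in extensions s t J K H).
Proof.
move=> HB; rewrite [G \in extensions _ _ _ _ _]inE; apply: (iffP andP) => -[GB]; split => //.
  by move=> e; rewrite inE => he; rewrite -(eqP b) inE he andbT.
apply/eqP/setP => e; rewrite inE; have [he|he] := boolP (e \in block J K).
  by rewrite b//; move: he; rewrite inE => ->; rewrite andbT.
rewrite inE in he; rewrite (negbTE he) andbF; apply/esym/negbTE/negP => eH.
by move/subsetP : HB => /(_ _ eH); rewrite inE (negbTE he).
Qed.

(** Restricting the swap to the rows of [A] covers three moves at once: exchange of two columns
    ([predT]), switching in two rows ([pred2]), and shifting an edge within one row ([pred1]). Being
    involutive, it acts on graphs by preimage. *)
Definition col_swap (A : pred 'I_m) w w' (e : 'I_m * 'I_n) :=
  (e.1, if A e.1 then tperm w w' e.2 else e.2).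

Definition row_swap z z' (e : 'I_m * 'I_n) := (tperm z z' e.1, e.2).

Lemma col_swapK A w w' : involutive (col_swap A w w').
Proof. by move=> [i k]; rewrite /col_swap /=; case: (A i); rewrite ?tpermK. Qed.

Lemma row_swapK z z' : involutive (row_swap z z').
Proof. by move=> [i k]; rewrite /row_swap /= tpermK. Qed.

Lemma degu_col_swap A w w' G i : degu (col_swap A w w' @^-1: G) i = degu G i.
Proof.
rewrite !degu_sum; under eq_bigr do rewrite inE /col_swap /=.
by case: (A i) => //; rewrite [RHS](reindex_inj (@perm_inj _ (tperm w w'))).
Qed.

Lemma col_swap_Bst (s t : nat) A w w' G :
  (\sum_(i | A i) ((i, w) \in G) = \sum_(i | A i) ((i, w') \in G))%N ->
  G \in Bst m n s t -> col_swap A w w' @^-1: G \in Bst m n s t.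
Proof.
move=> hA /in_BstP[hu hv]; apply/in_BstP; split=> [i|k]; first by rewrite degu_col_swap.
rewrite -(hv k) !degv_sum [LHS](bigID A) [RHS](bigID A) /=; congr addn.
  under eq_bigr => i Ai do rewrite inE /col_swap /= Ai.
  by case: tpermP => [->|->|].
by apply: eq_bigr => i /negbTE Ai; rewrite inE /col_swap /= Ai.
Qed.

Definition switch i j w w' : 'I_m * 'I_n -> 'I_m * 'I_n := col_swap (pred2 i j) w w'.

Lemma switch_Bst (s t : nat) i j w w' G :
  (i, w) \in G -> (i, w') \notin G -> (j, w) \notin G -> (j, w') \in G ->
  G \in Bst m n s t -> switch i j w w' @^-1: G \in Bst m n s t.
Proof.
move=> h1 h2 h3 h4; apply: col_swap_Bst.
have ij : i != j by apply: contraNneq h3 => <-.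
have e v : (\sum_(i0 | pred2 i j i0) ((i0, v) \in G) = ((i, v) \in G) + ((j, v) \in G))%N.
  rewrite (bigD1 i) /= ?eqxx//; congr addn; rewrite (bigD1 j) /= ?eqxx ?orbT 1?eq_sym//.
  by rewrite big1 ?addn0// => i0 /andP[/andP[/orP[/eqP->|/eqP->]]]; rewrite ?eqxx ?andbF.
by rewrite !e h1 (negbTE h2) (negbTE h3) h4.
Qed.

Lemma in_switch i j w w' G : i != j ->
  [/\ ((i, w) \in switch i j w w' @^-1: G) = ((i, w') \in G),
      ((i, w') \in switch i j w w' @^-1: G) = ((i, w) \in G),
      ((j, w) \in switch i j w w' @^-1: G) = ((j, w') \in G) &
      ((j, w') \in switch i j w w' @^-1: G) = ((j, w) \in G)].
Proof.
by move=> ij; split; rewrite inE /switch /col_swap /= !eqxx ?orbT ?tpermL ?tpermR.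
Qed.

End Classes.

Section Centred.
Context {R : realType} {m n : nat}.
Variables (s t J K : nat).
Implicit Types (G H : bgraph m n) (i j z : 'I_m) (k w : 'I_n).

Definition deviation G i w : R := ((i, w) \in G)%:R - lam R n s.

Local Notation lambda := (lam R n s).
Local Notation Ext := (extensions s t J K).

Lemma ind_dev G i w : ((i, w) \in G)%:R = lambda + deviation G i w.
Proof. by rewrite /deviation addrC subrK. Qed.

Lemma row_sum_dev G i : (0 < n)%N -> G \in Bst m n s t -> \sum_w deviation G i w = 0.
Proof.
move=> n0 /in_BstP[/(_ i) + _]; rewrite degu_sum => h.
rewrite sumrB -natr_sum h sumr_const card_ord /lam -(mulr_natr (s%:R / n%:R)) mulfVK ?subrr//.
by rewrite pnatr_eq0 -lt0n.
Qed.

Lemma col_sum_dev G w : (0 < n)%N -> (m * s = n * t)%N -> G \in Bst m n s t ->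
  \sum_i deviation G i w = 0.
Proof.
move=> n0 mn /in_BstP[_ /(_ w)]; rewrite degv_sum => h.
rewrite sumrB -natr_sum h sumr_const card_ord /lam -(mulr_natr (s%:R / n%:R)) mulrAC -natrM mulnC mn.
by rewrite natrM mulrC mulKf ?subrr// pnatr_eq0 -lt0n.
Qed.

Lemma dev_ext G H i w : H \subset block J K -> G \in Ext H -> (i < J)%N -> (w < K)%N ->
  deviation G i w = deviation H i w.
Proof.
by move=> HB /(extensionsP _ _ _ HB)[_ h] iJ wK; rewrite /deviation h// inE /= iJ.
Qed.

(** Edge indicators are idempotent, so a moment with a repeated entry reduces to moments of lower
    degree. *)
Lemma dev_sqr G i w :
  deviation G i w ^+ 2 = lambda * (1 - lambda) + (1 - 2 * lambda) * deviation G i w.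
Proof. by rewrite /deviation; case: ((i, w) \in G) => /=; ring. Qed.

Lemma dev_le1 G i w : (0 < n)%N -> (s <= n)%N -> `|deviation G i w| <= 1.
Proof.
move=> n0 sn; rewrite ler_norml /deviation /lam.
have h0 : 0 <= s%:R / n%:R :> R by rewrite divr_ge0.
have h1 : s%:R / n%:R <= 1 :> R by rewrite ler_pdivrMr ?ltr0n// mul1r ler_nat.
by case: (_ \in G) => /=; apply/andP; split; lra.
Qed.

Lemma sum_ext_pull (phi : 'I_m * 'I_n -> 'I_m * 'I_n) H (f : bgraph m n -> R) :
  involutive phi -> (forall G, G \in Ext H -> phi @^-1: G \in Ext H) ->
  avg (Ext H) (fun G => f (phi @^-1: G)) = avg (Ext H) f.
Proof.
move=> phiK hphi; congr (_ / _).
have pK : involutive (fun G : bgraph m n => phi @^-1: G).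
  by move=> G; apply/setP => e; rewrite !inE phiK.
rewrite [RHS](reindex_inj (inv_inj pK)); apply: eq_bigl => G.
by apply/idP/idP => [/hphi//|/hphi]; rewrite pK.
Qed.

(** Swapping two outer columns preserves all degrees, because all columns have the same degree, and
    leaves the block untouched. Taking [f] on whole matrices allows any moment to be substituted. *)
Lemma avg_col_exchange H w w' (f : ('I_m -> 'I_n -> R) -> R) :
  H \subset block J K -> (K <= w)%N -> (K <= w')%N ->
  avg (Ext H) (fun G => f (fun i v => deviation G i (tperm w w' v))) =
  avg (Ext H) (fun G => f (deviation G)).
Proof.
move=> HB wK w'K; rewrite -(@sum_ext_pull (col_swap predT w w') H (fun G => f (deviation G))).
- apply: eq_avg => G _; congr f; apply/funext => i; apply/funext => v.
  by rewrite /deviation inE.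
- exact: col_swapK.
move=> G /(extensionsP _ _ _ HB)[GB hG]; apply/(extensionsP _ _ _ HB); split.
  apply: col_swap_Bst => //; have [_ hv] := in_BstP _ _ _ GB.
  by rewrite -!degv_sum !hv.
move=> [i v] eB; rewrite inE /col_swap /= -hG//; move: eB; rewrite inE /= => /andP[_ vK].
by rewrite tpermD// neq_ltn; apply/orP; right; exact: leq_trans vK _.
Qed.

Lemma avg_row_exchange H z z' (f : ('I_m -> 'I_n -> R) -> R) :
  H \subset block J K -> (J <= z)%N -> (J <= z')%N ->
  avg (Ext H) (fun G => f (fun i v => deviation G (tperm z z' i) v)) =
  avg (Ext H) (fun G => f (deviation G)).
Proof.
move=> HB zJ z'J; rewrite -(@sum_ext_pull (row_swap z z') H (fun G => f (deviation G))).
- apply: eq_avg => G _; congr f; apply/funext => i; apply/funext => v.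
  by rewrite /deviation inE.
- exact: row_swapK.
move=> G /(extensionsP _ _ _ HB)[GB hG]; apply/(extensionsP _ _ _ HB); split.
  have [hu hv] := in_BstP _ _ _ GB; apply/in_BstP; split => [i|w].
    rewrite -(hu (tperm z z' i)) !degu_sum; apply: eq_bigr => w _; by rewrite inE.
  rewrite -(hv w) !degv_sum [RHS](reindex_inj (@perm_inj _ (tperm z z'))).
  by apply: eq_bigr => i _; rewrite inE.
move=> [i v] eB; rewrite inE /row_swap /= -hG//; move: eB; rewrite inE /= => /andP[iJ _].
by rewrite tpermD// neq_ltn; apply/orP; right; exact: leq_trans iJ _.
Qed.

(* [dpat] is the pattern (1 0; 0 1), and [apat] the pattern (0 1; 1 0), in rows
   [j], [i] and columns [w], [w']; a switch exchanges the two. *)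
Definition dpat G j i w w' :=
  [&& (j, w) \in G, (j, w') \notin G, (i, w) \notin G & (i, w') \in G].
Definition apat G j i w w' :=
  [&& (j, w) \notin G, (j, w') \in G, (i, w) \in G & (i, w') \notin G].

Lemma dpat_switch G j i w w' : dpat G j i w w' ->
  apat (switch j i w w' @^-1: G) j i w w'.
Proof.
move=> /and4P[h1 h2 h3 h4].
have ij : j != i by apply: contraNneq h3 => <-.
by have [e1 e2 e3 e4] := in_switch w w' G ij; rewrite /apat e1 e2 e3 e4 h1 h2 h3 h4.
Qed.

Lemma apat_switch G j i w w' : apat G j i w w' ->
  dpat (switch j i w w' @^-1: G) j i w w'.
Proof.
move=> /and4P[h1 h2 h3 h4].
have ij : j != i by apply: contraNneq h1 => ->.
by have [e1 e2 e3 e4] := in_switch w w' G ij; rewrite /dpat e1 e2 e3 e4 h1 h2 h3 h4.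
Qed.

Lemma switchK j i w w' : involutive (fun G : bgraph m n => switch j i w w' @^-1: G).
Proof. by move=> G; apply/setP => e; rewrite !inE /switch col_swapK. Qed.

Lemma dpat_Bst G j i w w' : dpat G j i w w' -> G \in Bst m n s t ->
  switch j i w w' @^-1: G \in Bst m n s t.
Proof. by move=> /and4P[]; exact: switch_Bst. Qed.

Lemma apat_Bst G j i w w' : apat G j i w w' -> G \in Bst m n s t ->
  switch j i w w' @^-1: G \in Bst m n s t.
Proof.
move=> /and4P[h1 h2 h3 h4]; have ij : j != i by apply: contraNneq h1 => ->.
have -> : switch j i w w' @^-1: G = switch i j w w' @^-1: G.
  by apply/setP => e; rewrite !inE /switch /col_swap /= orbC.
exact: switch_Bst.
Qed.

(** Two classes are allowed because the switch is used both inside one class, for the moments, and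
    between the classes of [H] and of [H] with one more edge. *)
Lemma switch_sum (A A' : {set bgraph m n}) j i w w' (f : bgraph m n -> R) :
  (forall G, G \in A -> dpat G j i w w' -> switch j i w w' @^-1: G \in A') ->
  (forall G, G \in A' -> apat G j i w w' -> switch j i w w' @^-1: G \in A) ->
  \sum_(G in A | dpat G j i w w') f G =
  \sum_(G in A' | apat G j i w w') f (switch j i w w' @^-1: G).
Proof.
move=> hA hA'; rewrite (reindex_inj (inv_inj (switchK j i w w'))) /=.
apply: eq_bigl => G; apply/andP/andP => -[h1 h2].
  move: (hA _ h1 h2) (dpat_switch h2); rewrite (switchK j i w w' G) => h3 h4; by split.
by split; [exact: hA'|exact: apat_switch].
Qed.

Lemma ext_switch H G j i w w' : H \subset block J K -> (K <= w)%N -> (K <= w')%N ->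
  G \in Ext H -> switch j i w w' @^-1: G \in Bst m n s t ->
  switch j i w w' @^-1: G \in Ext H.
Proof.
move=> HB wK w'K /(extensionsP _ _ _ HB)[GB hG] GB'; apply/(extensionsP _ _ _ HB); split=> //.
move=> [i' v] eB; rewrite inE /switch /col_swap /= -hG//.
case: ifP => // _; rewrite tpermD//; move: eB; rewrite inE /= => /andP[_ vK].
  by rewrite neq_ltn; apply/orP; right; exact: leq_trans vK _.
by rewrite neq_ltn; apply/orP; right; exact: leq_trans vK _.
Qed.

Lemma ext_switch_avg H j i w w' (f : bgraph m n -> R) :
  H \subset block J K -> (K <= w)%N -> (K <= w')%N ->
  avg (Ext H) (fun G => (dpat G j i w w')%:R * f G) =
  avg (Ext H) (fun G => (apat G j i w w')%:R * f (switch j i w w' @^-1: G)).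
Proof.
move=> HB wK w'K; congr (_ / _).
have h (p : pred (bgraph m n)) f' :
    \sum_(G in Ext H) (p G)%:R * f' G = \sum_(G in Ext H | p G) f' G :> R.
  by rewrite big_mkcondr; apply: eq_bigr => G _; case: (p G); rewrite ?mul1r ?mul0r.
have EB G : G \in Ext H -> G \in Bst m n s t by case/(extensionsP _ _ _ HB).
rewrite !h; apply: switch_sum => G GA hG; apply: ext_switch => //.
  by apply: dpat_Bst => //; exact: EB.
by apply: apat_Bst => //; exact: EB.
Qed.

(** Within the block the switch on rows [j], [z] and columns [k], [w] moves only the entry [(j, k)].
    The class already fixes that entry, so only three of the four entries of each pattern are
    listed. *)
Lemma ext_switch_edge H j z k w (jB : (j < J)%N) (kB : (k < K)%N) :
  H \subset block J K -> (j, k) \notin H -> (J <= z)%N -> (K <= w)%N ->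
  #|[set G in Ext H | [&& (j, w) \in G, (z, k) \in G & (z, w) \notin G]]| =
  #|[set G in Ext ((j, k) |: H) | [&& (j, w) \notin G, (z, k) \notin G & (z, w) \in G]]|.
Proof.
move=> HB jkH zJ wK.
have HB' : (j, k) |: H \subset block J K by rewrite subUset HB andbT sub1set inE /= jB.
have jz : j != z by rewrite neq_ltn; apply/orP; left; exact: leq_trans jB _.
have kw : k != w by rewrite neq_ltn; apply/orP; left; exact: leq_trans kB _.
have jkB : (j, k) \in block J K by rewrite inE /= jB.
have hsw e : e \in block J K -> e != (j, k) -> switch j z k w e = e.
  move: e => [i v]; rewrite inE /= => /andP[iJ vK]; rewrite xpair_eqE /switch /col_swap /=.
  have -> : (i == z) = false by apply/negbTE; rewrite neq_ltn; apply/orP; left; exact: leq_trans iJ _.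
  rewrite orbF; case: eqP => //= _ vk; rewrite tpermD// 1?eq_sym//.
  by rewrite neq_ltn; apply/orP; left; exact: leq_trans vK _.
have E H1 G : H1 \subset block J K -> G \in Ext H1 -> ((j, k) \in G) = ((j, k) \in H1).
  by move=> hH1 /(extensionsP _ _ _ hH1)[_ ->].
have hs (A : {set bgraph m n}) (p : pred (bgraph m n)) :
    #|[set G in A | p G]| = (\sum_(G in A | p G) 1)%N.
  by rewrite -sum1_card; apply: eq_bigl => G; rewrite inE.
have key : \sum_(G in Ext ((j, k) |: H) | dpat G j z k w) 1 =
           \sum_(G in Ext H | apat G j z k w) 1 :> R.
  apply: (@switch_sum _ _ j z k w (fun=> 1)) => G GA hG; have [_ h2 _ _] := in_switch k w G jz;
    have [h1 _ _ _] := in_switch k w G jz.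
    have [GB hG'] := extensionsP _ _ _ HB' GA.
    apply/(extensionsP _ _ _ HB); split; first exact: dpat_Bst.
    move=> e eB; have [->|ejk] := eqVneq e (j, k).
      by rewrite h1 (negbTE jkH); case/and4P : hG => _ /negbTE.
    by rewrite inE hsw// hG'// !inE (negbTE ejk).
  have [GB hG'] := extensionsP _ _ _ HB GA.
  apply/(extensionsP _ _ _ HB'); split; first exact: apat_Bst.
  move=> e eB; rewrite !inE; have [->|ejk] /= := eqVneq e (j, k).
    by move: h1; rewrite inE => ->; case/and4P : hG => _ ->.
  by rewrite hsw// hG'.
rewrite !hs; apply/eqP; rewrite -(eqr_nat R) !natr_sum; apply/eqP.
transitivity (\sum_(G in Ext H | apat G j z k w) 1 : R).
  apply: eq_bigl => G; case: (boolP (G \in Ext H)) => //= GA.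
  by rewrite /apat (E _ _ HB GA) jkH.
rewrite -key; apply: eq_bigl => G; case: (boolP (G \in Ext _)) => //= GA.
by rewrite /dpat (E _ _ HB' GA) !inE eqxx.
Qed.

End Centred.

(** * Lower bound for the number of graphs *)

Section BinomialMode.
Context {R : realType}.
Variables (n s : nat).
Hypotheses (s0 : (0 < s)%N) (sn : (s < n)%N).
Local Notation lambda := (lam R n s).

Lemma lam_gt0 : 0 < lambda.
Proof. by rewrite divr_gt0 ?ltr0n//; lia. Qed.

Lemma lam_lt1 : lambda < 1.
Proof. by rewrite ltr_pdivrMr ?ltr0n ?mul1r ?ltr_nat//; lia. Qed.

Definition bin_weight i : R := 'C(n, i)%:R * lambda ^+ i * (1 - lambda) ^+ (n - i).

Lemma bin_weight_ge0 i : 0 <= bin_weight i.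
Proof. by rewrite !mulr_ge0 ?exprn_ge0 ?subr_ge0 ?(ltW lam_gt0) ?(ltW lam_lt1). Qed.

Lemma bin_weightS i : (i < n)%N ->
  bin_weight i.+1 * ((i.+1)%:R * (n - s)%:R) = bin_weight i * ((n - i)%:R * s%:R).
Proof.
move=> i_n; have n0 : (n%:R : R) != 0 by rewrite pnatr_eq0; lia.
have l0 := lam_gt0; have l1 := lam_lt1.
have e1 : 'C(n, i.+1)%:R * (i.+1)%:R = 'C(n, i)%:R * (n - i)%:R :> R.
  by rewrite -!natrM mulnC mul_bin_left mulnC.
have e2 : (1 - lambda) * n%:R = (n - s)%:R by rewrite natrB ?(ltnW sn)// mulrBl mul1r divfK.
have e3 : lambda * n%:R = s%:R by rewrite divfK.
rewrite /bin_weight -e2 -e3 exprS -[in RHS]subnSK// exprS.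
transitivity ('C(n, i.+1)%:R * (i.+1)%:R * lambda * lambda ^+ i * (1 - lambda) ^+ (n - i.+1) * ((1 - lambda) * n%:R)).
  ring.
by rewrite e1 subnSK//; ring.
Qed.

(** By [bin_weightS] consecutive weights have ratio [(n - i) s / ((i + 1) (n - s))], at least 1 for
    [i < s] and at most 1 for [i >= s]: the weights rise up to [s] and fall after it. *)
Lemma bin_weight_max i : (i <= n)%N -> bin_weight i <= bin_weight s.
Proof.
have step k : (k < n)%N -> (k < s)%N -> bin_weight k <= bin_weight k.+1.
  move=> kn ks; have e := bin_weightS kn.
  rewrite -(@ler_pM2r _ ((n - k)%:R * s%:R)); last by rewrite -natrM ltr0n muln_gt0; lia.
  rewrite -e; apply: ler_wpM2l; first exact: bin_weight_ge0.
  by rewrite -!natrM ler_nat; nia.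
have step' k : (k < n)%N -> (s <= k)%N -> bin_weight k.+1 <= bin_weight k.
  move=> kn ks; have e := bin_weightS kn.
  rewrite -(@ler_pM2r _ ((k.+1)%:R * (n - s)%:R)); last by rewrite -natrM ltr0n muln_gt0; lia.
  rewrite e; apply: ler_wpM2l; first exact: bin_weight_ge0.
  by rewrite -!natrM ler_nat; nia.
move=> i_n; have [si|is_] := leqP s i.
  elim: i si i_n => [|i IH] si i_n; first by have -> : s = 0%N by lia.
  have [->//|si'] := eqVneq i.+1 s.
  by apply: le_trans (IH _ _); [apply: step'; lia|lia|lia].
have [d ->] : exists d, i = (s - d)%N by exists (s - i)%N; lia.
elim: d => [|d IH]; first by rewrite subn0.
have [sd|sd] := leqP s d; first by rewrite (_ : s - d.+1 = s - d)%N; [exact: IH|lia].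
by apply: le_trans IH; rewrite (_ : s - d = (s - d.+1).+1)%N; [apply: step; lia|lia].
Qed.

Lemma bin_weight_mode : 1 <= n.+1%:R * bin_weight s.
Proof.
have e : \sum_(i < n.+1) bin_weight i = 1.
  transitivity (((1 - lambda) + lambda) ^+ n); last by rewrite subrK expr1n.
  rewrite exprDn; apply: eq_bigr => i _; rewrite /bin_weight -mulr_natl; ring.
rewrite -[leLHS]e; apply: (@le_trans _ _ (\sum_(i < n.+1) bin_weight s)).
  by apply: ler_sum => i _; apply: bin_weight_max; rewrite -ltnS.
by rewrite sumr_const card_ord mulr_natl.
Qed.

End BinomialMode.

Section ColumnSums.
Context {m n : nat}.
Variables (s : nat).
Implicit Types (G : bgraph m n) (c : 'I_n -> nat).

Definition margins c : {set bgraph m n} :=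
  [set G : bgraph m n | [forall i, degu G i == s] && [forall w, degv G w == c w]].

Lemma marginsP c G : reflect ((forall i, degu G i = s) /\ (forall w, degv G w = c w))
  (G \in margins c).
Proof.
rewrite inE; apply: (iffP andP) => [[/forallP h1 /forallP h2]|[h1 h2]]; split.
- by move=> i; apply/eqP.
- by move=> i; apply/eqP.
- by apply/forallP => i; apply/eqP.
- by apply/forallP => i; apply/eqP.
Qed.

Definition move1 c a b w := if w == a then (c a).-1 else if w == b then (c b).+1 else c w.

(* Moving an edge of one row from column [a] to column [b] keeps the codegree
   [q] of the two columns, and there are [c a - q] such moves out of a graph
   but only [c b + 1 - q] into one. *)
Lemma margins_move c a b : (c b + 1 < c a)%N -> (#|margins c| <= #|margins (move1 c a b)|)%N.
Proof.
move=> cab; have ab : a != b by apply: contraTneq cab => ->; lia.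
pose q G := #|[set i | ((i, a) \in G) && ((i, b) \in G)]|.
pose mv i G := col_swap (pred1 i) a b @^-1: G : bgraph m n.
have mvE i G i' w : ((i', w) \in mv i G) = ((i', if i' == i then tperm a b w else w) \in G).
  by rewrite inE.
have mvK i : involutive (mv i).
  by move=> G; apply/setP => e; rewrite !inE col_swapK.
pose d i G := ((i, a) \in G) && ((i, b) \notin G).
pose u i G := ((i, a) \notin G) && ((i, b) \in G).
have dmv i G : d i G = u i (mv i G).
  by rewrite /d /u !mvE eqxx tpermL tpermR andbC.
have qmv i G : u i G || d i G -> q (mv i G) = q G.
  move=> h; apply: eq_card => i'; rewrite !inE /col_swap /=; case: eqP => // ->.
  by rewrite tpermL tpermR andbC.
have sumd G : (\sum_i d i G = degv G a - q G)%N.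
  rewrite /q -sum1_card degv_sum [X in _ = (_ - X)%N]big_mkcond -sumnB; last first.
    by move=> i _; rewrite inE; do 2!case: (_ \in G).
  by apply: eq_bigr => i _; rewrite /d inE; do 2!case: (_ \in G).
have sumu G : (\sum_i u i G = degv G b - q G)%N.
  rewrite /q -sum1_card degv_sum [X in _ = (_ - X)%N]big_mkcond -sumnB; last first.
    by move=> i _; rewrite inE; do 2!case: (_ \in G).
  by apply: eq_bigr => i _; rewrite /u inE; do 2!case: (_ \in G).
have qb G : (q G <= degv G b)%N.
  by apply: subset_leq_card; apply/subsetP => i; rewrite !inE => /andP[].
have mrow i G i' : degu (mv i G) i' = degu G i' by exact: degu_col_swap.
have mcol i G w : (degv (mv i G) w + ((i, w) \in G) = degv G w + ((i, tperm a b w) \in G))%N.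
  rewrite !degv_sum (bigD1 i)//= [in RHS](bigD1 i)//= mvE eqxx.
  rewrite (eq_bigr (fun i' => nat_of_bool ((i', w) \in G))); first by rewrite addnC -[RHS]addnA; congr (_ + _)%N; rewrite addnC.
  by move=> i' /negbTE h; rewrite mvE h.
have into i G : G \in margins c -> d i G -> mv i G \in margins (move1 c a b).
  move=> /marginsP[h1 h2] /andP[hd1 /negbTE hd2]; apply/marginsP; split=> [i'|w]; first by rewrite mrow.
  have := mcol i G w; rewrite !h2 /move1; case: (tpermP a b w) => [->|->|/eqP/negbTE wa /eqP/negbTE wb].
  - by rewrite eqxx hd1 hd2 /=; lia.
  - by rewrite eq_sym (negbTE ab) eqxx hd1 hd2 /=; lia.
  - by rewrite wa wb /=; lia.
have out i G : G \in margins (move1 c a b) -> u i G -> mv i G \in margins c.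
  move=> /marginsP[h1 h2] /andP[/negbTE hd1 hd2]; apply/marginsP; split=> [i'|w]; first by rewrite mrow.
  have := mcol i G w; rewrite !h2 /move1; case: (tpermP a b w) => [->|->|/eqP/negbTE wa /eqP/negbTE wb].
  - by rewrite eqxx hd1 hd2 /=; lia.
  - by rewrite eq_sym (negbTE ab) eqxx hd1 hd2 /=; lia.
  - by rewrite wa wb /=; lia.
(* Each move is weighted by the reciprocal of the number of moves out of its source. A graph of
   [margins c] then counts exactly 1, while a target graph collects [(c b + 1 - q) / (c a - q)],
   which is at most 1. *)
pose F k : rat := ((c a - k)%:R)^-1.
have key : \sum_(G in margins c) \sum_i (d i G)%:R * F (q G) =
           \sum_(G in margins (move1 c a b)) \sum_i (u i G)%:R * F (q G) :> rat.
  rewrite exchange_big [RHS]exchange_big /=; apply: eq_bigr => i _.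
  rewrite big_mkcond [LHS](reindex_inj (inv_inj (mvK i))) [RHS]big_mkcond /=; apply: eq_bigr => G _.
  rewrite dmv mvK; case: (boolP (u i G)) => hu; last by rewrite !mul0r !if_same.
  rewrite qmv ?hu//; have [hG|hG] := boolP (G \in margins (move1 c a b)).
    by rewrite out.
  by case: ifP => // hG'; have := into i _ hG'; rewrite dmv mvK => /(_ hu); rewrite (negbTE hG).
have L : \sum_(G in margins c) \sum_i (d i G)%:R * F (q G) = #|margins c|%:R.
  rewrite -sum1_card natr_sum; apply: eq_bigr => G /marginsP[_ h2].
  rewrite -mulr_suml -natr_sum sumd h2 divff// pnatr_eq0.
  by have := qb G; rewrite h2; lia.
rewrite -(ler_nat rat) -L key -sum1_card natr_sum; apply: ler_sum => G /marginsP[_ h2].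
rewrite -mulr_suml -natr_sum sumu h2 /move1 eq_sym (negbTE ab) eqxx.
have := qb G; rewrite h2 /move1 eq_sym (negbTE ab) eqxx => hq.
by rewrite /F ler_pdivrMr ?mul1r ?ler_nat ?ltr0n; lia.
Qed.

(** Balancing: the column sums total [n t], so a column above [t] is accompanied by one below.
    Moving a unit between them loses no graphs by [margins_move] and lowers the total excess over
    [t], which truncated subtraction measures. *)
Lemma margins_le (t : nat) c : (m * s = n * t)%N -> (#|margins c| <= #|Bst m n s t|)%N.
Proof.
move=> mn; have [e le_e] := ubnP (\sum_w (c w - t))%N.
elim: e c le_e => // e IH c le_e.
have [->|[G hG]] := set_0Vmem (margins c); first by rewrite cards0.
have sumc : (\sum_w c w = n * t)%N.
  move: hG => /marginsP[h1 h2]; rewrite -mn.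
  transitivity (\sum_w degv G w)%N; first by apply: eq_bigr => w _; rewrite h2.
  under eq_bigr do rewrite degv_sum.
  rewrite exchange_big /=; under eq_bigr do rewrite -degu_sum h1.
  by rewrite sum_nat_const card_ord.
have sumt : (\sum_(w < n) t = n * t)%N by rewrite sum_nat_const card_ord.
have [/existsP[a ha]|/existsPn hle] := boolP [exists a, (t < c a)%N]; last first.
  have hc w : c w = t.
    apply/eqP; apply: contraT => hw; have hw' : (c w < t)%N by have := hle w; lia.
    have : (\sum_w c w < \sum_(w < n) t)%N.
      rewrite (bigD1 w)//= [X in (_ < X)%N](bigD1 w)//= -addSn leq_add//.
      by apply: leq_sum => v _; have := hle v; lia.
    by rewrite sumc sumt ltnn.
  apply: subset_leq_card; apply/subsetP => G' /marginsP[h1 h2]; apply/in_BstP; split=> // w.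
  by rewrite h2.
have [/existsP[b hb]|/existsPn hge] := boolP [exists b, (c b < t)%N]; last first.
  have : (\sum_(w < n) t < \sum_w c w)%N.
    rewrite (bigD1 a)//= [X in (_ < X)%N](bigD1 a)//= -addSn leq_add//.
    by apply: leq_sum => v _; have := hge v; lia.
  by rewrite sumc sumt ltnn.
apply: leq_trans (margins_move (a := a) (b := b) _) _; first lia.
apply: IH; rewrite -ltnS; apply: leq_trans le_e; rewrite ltnS.
have ab : b != a by apply: contraTneq hb => ->; lia.
rewrite (bigD1 a)//= [X in (_ < X)%N](bigD1 a)//= -addSn; apply: leq_add.
  by rewrite /move1 eqxx; lia.
apply: leq_sum => w /negbTE wa; rewrite /move1 wa; case: eqP => [->|_]; lia.
Qed.

(** The left side counts the graphs with row degrees [s] and free columns. They split into at most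
    [(m + 1)^n] classes by column sums, none larger than the balanced one. *)
Lemma Bst_lower (t : nat) : (m * s = n * t)%N ->
  ('C(n, s) ^ m <= m.+1 ^ n * #|Bst m n s t|)%N.
Proof.
move=> mn.
pose rows : {set bgraph m n} := [set G : bgraph m n | [forall i, degu G i == s]].
have h1 : ('C(n, s) ^ m <= #|rows|)%N.
  pose SS := [set A : {set 'I_n} | #|A| == s].
  have -> : ('C(n, s) ^ m)%N = #|[set f : {ffun 'I_m -> {set 'I_n}} | f \in ffun_on SS]|.
    by rewrite cardsE card_ffun_on card_draws !card_ord.
  pose F (f : {ffun 'I_m -> {set 'I_n}}) : bgraph m n := [set e | e.2 \in f e.1].
  have Finj : injective F.
    move=> f f' /setP h; apply/ffunP => i; apply/setP => w.
    by have := h (i, w); rewrite !inE.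
  rewrite -(card_imset _ Finj); apply: subset_leq_card; apply/subsetP => G /imsetP[f].
  rewrite inE => /ffun_onP hf ->; rewrite inE; apply/forallP => i.
  have := hf i; rewrite inE /degu => /eqP <-; apply/eqP; apply: eq_card => w.
  by rewrite !inE.
apply: leq_trans h1 _.
pose cv (G : bgraph m n) : {ffun 'I_n -> 'I_m.+1} := [ffun w => inord (degv G w)].
have cvE G w : cv G w = degv G w :> nat.
  by rewrite ffunE inordK// ltnS; apply: leq_trans (max_card _) _; rewrite card_ord.
rewrite -sum1_card (partition_big cv predT)//=.
apply: (@leq_trans (\sum_(c : {ffun 'I_n -> 'I_m.+1}) #|Bst m n s t|)); last first.
  by rewrite sum_nat_const card_ffun !card_ord.
apply: leq_sum => c _; apply: leq_trans (margins_le (fun w => c w) mn).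
rewrite sum1_card; apply: subset_leq_card; apply/subsetP => G hG.
apply/marginsP; case/andP: hG; rewrite inE => /forallP h1 /eqP h2; split=> [i|w].
  exact/eqP.
by rewrite -h2 cvE.
Qed.

End ColumnSums.

(** * Discrepancy *)

Section Discrepancy.
Context {R : realType} {m n : nat}.
Variables (s t : nat).
Hypotheses (s0 : (0 < s)%N) (sn : (s < n)%N) (mn : (m * s = n * t)%N).
Implicit Types (G : bgraph m n) (S : {set 'I_m}) (T : {set 'I_n}).
Local Notation lambda := (lam R n s).
Local Notation dev := (@deviation R m n s).

Let l0 : 0 < lambda. Proof. exact: lam_gt0. Qed.
Let l1 : lambda < 1. Proof. exact: lam_lt1. Qed.

Definition discrepancy D G := [forall S : {set 'I_m}, [forall T : {set 'I_n},
  `|\sum_(i in S) \sum_(w in T) dev G i w| <= D * Num.sqrt #|S|%:R * Num.sqrt #|T|%:R]].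

Definition bernoulli G : R := \prod_e (if e \in G then lambda else 1 - lambda).

Lemma bernoulli_ge0 G : 0 <= bernoulli G.
Proof. by apply: prodr_ge0 => e _; case: ifP => _; rewrite ?subr_ge0 ltW. Qed.

Lemma bernoulli_Bst G : G \in Bst m n s t ->
  bernoulli G = (lambda ^+ s * (1 - lambda) ^+ (n - s)) ^+ m.
Proof.
move=> /in_BstP[hu _]; rewrite /bernoulli.
transitivity (\prod_i \prod_w (if (i, w) \in G then lambda else 1 - lambda)).
  by rewrite pair_bigA /=; apply: eq_bigr => -[].
transitivity (\prod_(i < m) (lambda ^+ s * (1 - lambda) ^+ (n - s))); last first.
  by rewrite prodr_const card_ord.
apply: eq_bigr => i _; rewrite -(hu i) /degu.
set A := [set w | (i, w) \in G].
have -> : (n - #|A|)%N = #|~: A| by have := cardsC A; rewrite card_ord; lia.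
rewrite -!prodr_const (bigID (mem A)) /=; congr (_ * _).
  by apply: eq_big => // w; rewrite inE => ->.
apply: eq_big => [w|w]; first by rewrite in_setC.
by rewrite inE => /negbTE ->.
Qed.

(** The rows cost [(n + 1)^m] through [bin_weight_mode], the columns [(m + 1)^n] through
    [Bst_lower]. *)
Lemma Bst_bernoulli : 1 <= n.+1%:R ^+ m * m.+1%:R ^+ n * #|Bst m n s t|%:R *
  (lambda ^+ s * (1 - lambda) ^+ (n - s)) ^+ m :> R.
Proof.
have h : 1 <= n.+1%:R * bin_weight n s s :> R by exact: bin_weight_mode.
have h1 : 1 <= (n.+1%:R * bin_weight n s s) ^+ m :> R by apply: exprn_ege1.
apply: le_trans h1 _; rewrite exprMn -!(mulrA (n.+1%:R ^+ m)); apply: ler_wpM2l; first exact: exprn_ge0.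
rewrite /bin_weight -mulrA exprMn; apply: ler_wpM2r.
  by rewrite exprn_ge0// mulr_ge0// exprn_ge0// ?subr_ge0 ltW.
by rewrite -!natrX -natrM ler_nat; exact: Bst_lower.
Qed.

(** The expectation factors over the entries; each entry is centred, so the linear term cancels and
    a factor is at most [1 + h^2 lambda (1 - lambda)]. *)
Lemma bernoulli_mgf (X : {set 'I_m * 'I_n}) (h : R) : `|h| <= 1 ->
  \sum_G bernoulli G * expR (h * \sum_(e in X) dev G e.1 e.2) <= expR (h ^+ 2 * #|X|%:R).
Proof.
have l0' := l0; have l1' := l1.
move=> h1.
pose F1 e := lambda * (if e \in X then expR (h * (1 - lambda)) else 1).
pose F0 e := (1 - lambda) * (if e \in X then expR (h * - lambda) else 1).
have -> : \sum_G bernoulli G * expR (h * \sum_(e in X) dev G e.1 e.2) =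
    \sum_(G in {set 'I_m * 'I_n}) \prod_e (if e \in G then F1 e else F0 e).
  apply: eq_big => // G _; rewrite mulr_sumr expR_sum [in X in _ * X]big_mkcond -big_split.
  apply: eq_bigr => -[i w] _; rewrite /F1 /F0 /deviation /=.
  by case: ifP => hG; case: ifP => _; rewrite ?mulr1 ?sub0r.
rewrite -bigA_distr.
apply: (@le_trans _ _ (\prod_e (if e \in X then expR (h ^+ 2) else 1))); last first.
  by rewrite -big_mkcond prodr_const -expRM_natr.
apply: ler_prod => e _; rewrite /F1 /F0 /=; case: ifP => _; last by apply/andP; split; lra.
apply/andP; split.
  by rewrite addr_ge0// mulr_ge0 ?expR_ge0// ?subr_ge0 ltW.
have b1 : `|h * (1 - lambda)| <= 1.
  by rewrite normrM; apply: mulr_ile1 => //; rewrite ler_norml; apply/andP; split; lra.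
have b2 : `|h * - lambda| <= 1.
  by rewrite normrM; apply: mulr_ile1 => //; rewrite ler_norml; apply/andP; split; lra.
have := expR_le_quadratic b1; have := expR_le_quadratic b2; have := expR_ge1Dx (h ^+ 2).
move: (expR _) (expR _) (expR _) => a b c h3 h4 h5.
apply: le_trans h3.
have h6 := ler_wpM2l (ltW l0) h5.
have l2 : 0 <= 1 - lambda by lra.
have h7 := ler_wpM2l l2 h4.
apply: le_trans (lerD h6 h7) _.
have -> : lambda * (1 + h * (1 - lambda) + (h * (1 - lambda)) ^+ 2) +
  (1 - lambda) * (1 + h * - lambda + (h * - lambda) ^+ 2) = 1 + h ^+ 2 * (lambda * (1 - lambda)) by ring.
by rewrite lerD2l ler_piMr ?sqr_ge0// mulr_ile1//; lra.
Qed.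

Lemma discrepancy_tail S T (D : R) : 0 <= D ->
  #|[set G in Bst m n s t | D * Num.sqrt #|S|%:R * Num.sqrt #|T|%:R <
        `|\sum_(i in S) \sum_(w in T) dev G i w|]|%:R *
  (lambda ^+ s * (1 - lambda) ^+ (n - s)) ^+ m <= 2 * expR (- (D ^+ 2 / 4)).
Proof.
move=> D0; set X := setX S T; set A := [set G in _ | _].
have sumE G : \sum_(i in S) \sum_(w in T) dev G i w = \sum_(e in X) dev G e.1 e.2.
  by rewrite pair_big /=; apply: eq_big => // -[i w]; rewrite inE.
have cX : (#|X|%:R : R) = #|S|%:R * #|T|%:R by rewrite cardsX natrM.
set a := Num.sqrt (#|S|%:R : R); set b := Num.sqrt (#|T|%:R : R).
have a0 : 0 <= a by exact: sqrtr_ge0.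
have b0 : 0 <= b by exact: sqrtr_ge0.
have abX : (a * b) ^+ 2 = #|X|%:R by rewrite exprMn !sqr_sqrtr.
have triv G : `|\sum_(e in X) dev G e.1 e.2| <= (a * b) ^+ 2.
  rewrite abX -sum1_card natr_sum; apply: le_trans (ler_norm_sum _ _ _) _.
  by apply: ler_sum => e _; apply: dev_le1; lia.
have rhs0 : 0 <= 2 * expR (- (D ^+ 2 / 4)) by rewrite mulr_ge0// expR_ge0.
(* For such [D] the trivial bound [|S| |T|] on the sum already makes the event empty. Otherwise the
   parameter [h] below is at most 1, as the moment bound requires. *)
have [hD|hD] := leP (2 * (a * b)) D.
  have -> : A = set0.
    apply/setP => G; rewrite !inE sumE; apply/negbTE; rewrite negb_and -leNgt; apply/orP; right.
    apply: le_trans (triv G) _; rewrite expr2 -[leRHS]mulrA; apply: ler_wpM2r; first exact: mulr_ge0.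
    have : 0 <= a * b by exact: mulr_ge0.
    lra.
  by rewrite cards0 mul0r.
have ab0 : 0 < a * b by lra.
(* This choice minimises [h^2 (a b)^2 - h D a b], with minimum [- D^2 / 4]. *)
pose h := D / (2 * (a * b)).
have h0 : 0 <= h by rewrite divr_ge0//; lra.
have h1 : h <= 1 by rewrite ler_pdivrMr ?mul1r; lra.
rewrite -(@ler_pM2r _ (expR (h * (D * (a * b))))) ?expR_gt0//.
rewrite -[leRHS]mulrA -expRD.
have -> : - (D ^+ 2 / 4) + h * (D * (a * b)) = h ^+ 2 * #|X|%:R.
  by rewrite -abX /h; move: ab0; move: (a * b) => c c0; field; rewrite gt_eqF.
have nh : `|h| <= 1 by rewrite ger0_norm.
have nh' : `|- h| <= 1 by rewrite normrN.
have hY : \sum_G bernoulli G * (expR (h * \sum_(e in X) dev G e.1 e.2) +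
    expR (- h * \sum_(e in X) dev G e.1 e.2)) <= 2 * expR (h ^+ 2 * #|X|%:R).
  under eq_bigr do rewrite mulrDr.
  rewrite big_split /=; have := bernoulli_mgf X nh; have := bernoulli_mgf X nh'.
  by rewrite sqrrN; lra.
apply: le_trans hY.
rewrite -sum1_card natr_sum !mulr_suml.
rewrite big_mkcond; apply: ler_sum => G _.
case: ifP => [|_]; last by rewrite mulr_ge0 ?bernoulli_ge0// addr_ge0 ?expR_ge0.
rewrite inE => /andP[GB hG]; rewrite mul1r -(bernoulli_Bst GB).
apply: ler_wpM2l; first exact: bernoulli_ge0.
rewrite sumE in hG; rewrite -mulrA -/a -/b in hG; set x := \sum_(e in X) _ in hG *.
have [x0|x0] := leP 0 x.
  rewrite ger0_norm// in hG; apply: (@le_trans _ _ (expR (h * x))).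
    by rewrite ler_expR ler_wpM2l// ltW.
  by rewrite lerDl expR_ge0.
rewrite ltr0_norm// in hG; apply: (@le_trans _ _ (expR (- h * x))).
  by rewrite ler_expR mulNr -mulrN ler_wpM2l// ltW.
by rewrite lerDr expR_ge0.
Qed.

(** Union bound over the [2^(m + n)] pairs of row and column sets; the common weight of the graphs
    in [Bst] is then removed with [Bst_bernoulli]. *)
Lemma discrepancy_rare (D : R) : 0 <= D ->
  #|[set G in Bst m n s t | ~~ discrepancy D G]|%:R <=
  2 ^+ (m + n).+1 * expR (- (D ^+ 2 / 4)) * (n.+1%:R ^+ m * m.+1%:R ^+ n) * #|Bst m n s t|%:R.
Proof.
move=> D0; set r := (lambda ^+ s * (1 - lambda) ^+ (n - s)) ^+ m.
pose A S T := [set G in Bst m n s t | D * Num.sqrt #|S|%:R * Num.sqrt #|T|%:R <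
        `|\sum_(i in S) \sum_(w in T) dev G i w|].
have r0 : 0 < r by rewrite exprn_gt0// mulr_gt0// exprn_gt0// subr_gt0.
have h1 : #|[set G in Bst m n s t | ~~ discrepancy D G]|%:R <= \sum_S \sum_T #|A S T|%:R :> R.
  under [leRHS]eq_bigr do rewrite -natr_sum.
  rewrite -natr_sum ler_nat pair_bigA /=.
  apply: (@leq_trans #|\bigcup_(p : {set 'I_m} * {set 'I_n}) A p.1 p.2|).
    apply: subset_leq_card; apply/subsetP => G; rewrite inE => /andP[GB].
    rewrite negb_forall => /existsP[S]; rewrite negb_forall => /existsP[T]; rewrite -ltNge => h.
    by apply/bigcupP; exists (S, T) => //; rewrite inE GB.
  elim/big_rec2 : _ => [|p y Z _ h]; first by rewrite cards0.
  by apply: leq_trans (leq_card_setU _ _) _; rewrite leq_add2l.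
have h2 : #|[set G in Bst m n s t | ~~ discrepancy D G]|%:R * r <=
    2 ^+ (m + n).+1 * expR (- (D ^+ 2 / 4)).
  apply: le_trans (ler_wpM2r (ltW r0) h1) _; rewrite mulr_suml.
  under eq_bigr do rewrite mulr_suml.
  apply: (@le_trans _ _ (\sum_(S : {set 'I_m}) \sum_(T : {set 'I_n}) 2 * expR (- (D ^+ 2 / 4)))).
    by apply: ler_sum => S _; apply: ler_sum => T _; exact: discrepancy_tail.
  have cS k : #|{: {set 'I_k}}| = (2 ^ k)%N.
    by rewrite -cardsT -powersetT card_powerset cardsT card_ord.
  rewrite !sumr_const -mulrnA !cS -expnD addnC -(mulr_natr (2 * _)) natrX (exprS 2).
  by rewrite mulrAC.
have h3 := Bst_bernoulli; rewrite -/r in h3.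
set E := expR _ in h2 *; set B := (#|Bst m n s t|%:R : R) in h3 *; set x := (#|_|%:R : R) in h2 *.
have x0 : 0 <= x by exact: ler0n.
rewrite -[leLHS]mulr1; apply: le_trans (ler_wpM2l x0 h3) _.
set q := n.+1%:R ^+ m * m.+1%:R ^+ n in h3 *.
have -> : x * (q * B * r) = q * B * (x * r) by ring.
have -> : 2 ^+ (m + n).+1 * E * q * B = q * B * (2 ^+ (m + n).+1 * E) by ring.
by apply: ler_wpM2l => //; rewrite !mulr_ge0// exprn_ge0.
Qed.

End Discrepancy.

Lemma card_ord_lt (n K : nat) : (K <= n)%N -> #|[set w : 'I_n | (w < K)%N]| = K.
Proof.
move=> Kn; rewrite -sum1_card (eq_bigl (fun w : 'I_n => (w < K)%N)); last by move=> w; rewrite inE.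
by rewrite -(big_ord_widen n (fun=> 1%N) Kn) sum1_card card_ord.
Qed.

Lemma card_ge_sub (n K : nat) (P : pred 'I_n) : (K <= n)%N ->
  (#|[set w | P w]| - K <= #|[set w : 'I_n | (K <= w)%N && P w]|)%N.
Proof.
move=> Kn; rewrite leq_subLR -[X in (_ <= X + _)%N](card_ord_lt Kn) -leq_subLR.
rewrite leq_subLR; apply: leq_trans (leq_card_setU _ _); apply: subset_leq_card.
by apply/subsetP => w; rewrite !inE => ->; rewrite andbT ltnNge orNb.
Qed.

(** * Lower bound for the number of extensions *)

Section Chain.
Context {R : realType} {m n : nat}.
Variables (s t J K : nat) (D : R).
Hypotheses (D0 : 0 <= D) (Jm : (J <= m)%N) (Kn : (K <= n)%N).
Hypothesis hup : D ^+ 2 < (1 - lam R n s) ^+ 2 * ((s - K)%:R * (t - J)%:R).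
Hypothesis hdown : D ^+ 2 < lam R n s ^+ 2 * ((n - s - K)%:R * (m - t - J)%:R).
Implicit Types (G H : bgraph m n).
Local Notation Ext := (@extensions m n s t J K).
Local Notation dev := (@deviation R m n s).
Local Notation Bad := [set G in Bst m n s t | ~~ discrepancy s D G].

(** On a rectangle of constant deviation the sum grows with the area but the discrepancy bound only
    with its square root, so such a rectangle must be small. *)
Lemma discrepancy_const G (S : {set 'I_m}) (T : {set 'I_n}) (c : R) :
  discrepancy s D G -> (forall i w, i \in S -> w \in T -> dev G i w = c) ->
  c ^+ 2 * (#|S|%:R * #|T|%:R) <= D ^+ 2.
Proof.
have D0' := D0.
move=> /forallP/(_ S)/forallP/(_ T) h hc.
have e : \sum_(i in S) \sum_(w in T) dev G i w = c * (#|S|%:R * #|T|%:R).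
  transitivity (\sum_(i in S) \sum_(w in T) c).
    by apply: eq_bigr => i iS; apply: eq_bigr => w wT; exact: hc.
  by rewrite !sumr_const -mulrnA -natrM mulr_natr mulnC.
rewrite e in h; set a := Num.sqrt #|S|%:R in h; set b := Num.sqrt #|T|%:R in h.
have a2 : a ^+ 2 = #|S|%:R by rewrite sqr_sqrtr.
have b2 : b ^+ 2 = #|T|%:R by rewrite sqr_sqrtr.
rewrite -a2 -b2 in h *; have a0 : 0 <= a by exact: sqrtr_ge0.
have b0 : 0 <= b by exact: sqrtr_ge0.
have [ab|ab] := eqVneq (a * b) 0; first by rewrite -exprMn ab expr0n mulr0 sqr_ge0.
have abp : 0 < a * b by rewrite lt_def ab mulr_ge0.
have -> : c ^+ 2 * (a ^+ 2 * b ^+ 2) = (c * (a * b)) ^+ 2 by ring.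
rewrite -[leLHS]real_normK ?num_real//; apply: lerXn2r; rewrite ?nnegrE//.
rewrite -(ler_pM2r abp) [leRHS]mulrA; apply: le_trans h.
have -> : c * (a ^+ 2 * b ^+ 2) = c * (a * b) * (a * b) by ring.
by rewrite [leRHS]normrM (gtr0_norm abp).
Qed.

(** Every graph outside [Bad] admits some switch [(z, w)]. For each of the at most [m n] choices,
    the graphs admitting it are as many as their images, all of which lie in the other class. *)
Lemma count_switches H (p p' : 'I_m -> 'I_n -> pred (bgraph m n)) (H' : bgraph m n) :
  (forall (z : 'I_m) (w : 'I_n), (J <= z)%N -> (K <= w)%N ->
     #|[set G in Ext H | p z w G]| = #|[set G in Ext H' | p' z w G]|) ->
  (forall G, G \in Ext H -> discrepancy s D G ->
     exists (z : 'I_m) (w : 'I_n), [/\ (J <= z)%N, (K <= w)%N & p z w G]) ->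
  (#|Ext H| <= m * n * #|Ext H'| + #|Bad|)%N.
Proof.
move=> hpp' hp.
rewrite -(cardsID Bad (Ext H)) addnC leq_add//; last by apply: subset_leq_card; exact: subsetIr.
apply: (@leq_trans (\sum_(z < m) \sum_(w < n) #|Ext H'|)); last first.
  by rewrite !sum_nat_const !card_ord mulnA.
apply: (@leq_trans (\sum_(z : 'I_m) \sum_(w : 'I_n | (J <= z)%N && (K <= w)%N) #|[set G in Ext H | p z w G]|)); last first.
  apply: leq_sum => z _; rewrite big_mkcond; apply: leq_sum => w _.
  case: ifP => // /andP[zJ wK]; rewrite hpp'//.
  by apply: subset_leq_card; apply/subsetP => G; rewrite inE => /andP[].
under eq_bigr do under eq_bigr do rewrite -sum1_card.
rewrite -sum1_card.
have -> : (\sum_(z : 'I_m) \sum_(w : 'I_n | (J <= z) && (K <= w)) \sum_(G in [set G in Ext H | p z w G]) 1 =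
  \sum_(G in Ext H) \sum_(z : 'I_m) \sum_(w : 'I_n) [&& J <= z, K <= w & p z w G])%N.
  rewrite [RHS]exchange_big /=; apply: eq_bigr => z _.
  rewrite [RHS]exchange_big /= big_mkcond; apply: eq_bigr => w _.
  case: ifP => [/andP[-> ->]|h]; last first.
    by rewrite big1 // => G _; move: h; case: (J <= z)%N => //= ->.
  rewrite big_mkcond [RHS]big_mkcond; apply: eq_bigr => G _; rewrite [G \in [set _ in _ | _]]inE.
  by case: (G \in Ext H) => //=; case: (p z w G).
rewrite big_mkcond [X in (_ <= X)%N]big_mkcond; apply: leq_sum => G _.
case: ifP => // /setDP[GH GB]; rewrite GH.
have gd : discrepancy s D G.
  by apply: contraR GB => h; rewrite inE h andbT; move: GH; rewrite inE => /andP[].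
have [z [w [zJ wK pzw]]] := hp _ GH gd.
by rewrite (bigD1 z)//= (bigD1 w)//= zJ wK pzw.
Qed.

Lemma switch_exists G (S : {set 'I_m}) (T : {set 'I_n}) (c : R) (a b : nat) (p : 'I_m -> 'I_n -> bool) :
  discrepancy s D G -> (b <= #|T|)%N -> (a <= #|S|)%N -> D ^+ 2 < c ^+ 2 * (b%:R * a%:R) ->
  (forall z w, z \in S -> w \in T -> ~~ [&& (J <= z)%N, (K <= w)%N & p z w] -> dev G z w = c) ->
  exists (z : 'I_m) (w : 'I_n), [/\ (J <= z)%N, (K <= w)%N & p z w].
Proof.
move=> gd cT cS hD hc; apply/not_existsP => hno; move: hD; apply/negP; rewrite -leNgt.
apply: (@le_trans _ _ (c ^+ 2 * (#|S|%:R * #|T|%:R))).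
  by rewrite ler_wpM2l ?sqr_ge0// mulrC -!natrM ler_nat leq_mul.
apply: discrepancy_const gd _ => z w zS wT; apply: hc => //.
by apply/negP => /and3P h; apply: (hno z); exists w.
Qed.

(** If no switch were available, every outer neighbour of column [k] would be joined to every outer
    neighbour of row [j]. The deviation would be [1 - lambda] on at least [(t - J) (s - K)] entries,
    against [hup]. *)
Lemma chain_up H (e : 'I_m * 'I_n) : H \subset block J K -> e \in block J K -> e \notin H ->
  (#|Ext H| <= m * n * #|Ext (e |: H)| + #|Bad|)%N.
Proof.
move: e => [j k] HB; rewrite inE /= => /andP[jJ kK] jkH.
apply: (@count_switches H (fun z w G => [&& (j, w) \in G, (z, k) \in G & (z, w) \notin G])
  (fun z w G => [&& (j, w) \notin G, (z, k) \notin G & (z, w) \in G])).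
  by move=> z w zJ wK; exact: (@ext_switch_edge R).
move=> G /(extensionsP _ _ _ HB)[/in_BstP[hu hv] _] gd.
pose S := [set z : 'I_m | (J <= z)%N && ((z, k) \in G)].
pose T := [set w : 'I_n | (K <= w)%N && ((j, w) \in G)].
have cS : (t - J <= #|S|)%N by rewrite -(hv k); exact: card_ge_sub.
have cT : (s - K <= #|T|)%N by rewrite -(hu j); exact: card_ge_sub.
apply: (switch_exists gd cT cS hup) => z w; rewrite !inE => /andP[-> zk] /andP[-> jw].
by rewrite zk jw /= negbK /deviation => ->.
Qed.

(** Mirror image of [chain_up]: without a switch there are no edges between the outer
    non-neighbours, and the deviation is constantly [- lambda] on them. *)
Lemma chain_down H (e : 'I_m * 'I_n) : H \subset block J K -> e \in block J K -> e \notin H ->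
  (#|Ext (e |: H)| <= m * n * #|Ext H| + #|Bad|)%N.
Proof.
move: e => [j k] HB; rewrite inE /= => /andP[jJ kK] jkH.
have HB' : (j, k) |: H \subset block J K by rewrite subUset HB andbT sub1set inE /= jJ.
apply: (@count_switches _ (fun z w G => [&& (j, w) \notin G, (z, k) \notin G & (z, w) \in G])
  (fun z w G => [&& (j, w) \in G, (z, k) \in G & (z, w) \notin G])).
  by move=> z w zJ wK; apply/esym; exact: (@ext_switch_edge R).
move=> G /(extensionsP _ _ _ HB')[/in_BstP[hu hv] _] gd.
pose S := [set z : 'I_m | (J <= z)%N && ((z, k) \notin G)].
pose T := [set w : 'I_n | (K <= w)%N && ((j, w) \notin G)].
have cS : (m - t - J <= #|S|)%N.
  apply: leq_trans (card_ge_sub _ Jm).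
  have := cardsC [set z : 'I_m | (z, k) \in G]; rewrite card_ord.
  rewrite (_ : ~: _ = [set z : 'I_m | (z, k) \notin G]); last by apply/setP => z; rewrite !inE.
  by have := hv k; rewrite /degv => -> h; apply: leq_sub2r; rewrite leq_subLR h.
have cT : (n - s - K <= #|T|)%N.
  apply: leq_trans (card_ge_sub _ Kn).
  have := cardsC [set w : 'I_n | (j, w) \in G]; rewrite card_ord.
  rewrite (_ : ~: _ = [set w : 'I_n | (j, w) \notin G]); last by apply/setP => z; rewrite !inE.
  by have := hu j; rewrite /degu => -> h; apply: leq_sub2r; rewrite leq_subLR h.
have hd := hdown; rewrite -(sqrrN (lam R n s)) in hd; apply: (switch_exists gd cT cS hd) => z w.
rewrite !inE => /andP[-> zk] /andP[-> jw].
by rewrite zk jw /= /deviation => /negbTE ->; rewrite sub0r.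
Qed.

Lemma extensions_partition : (\sum_(H in powerset (block J K)) #|Ext H| = #|Bst m n s t|)%N.
Proof.
rewrite -[RHS]sum1_card [RHS](partition_big (induced J K) (mem (powerset (block J K)))) /=.
  apply: eq_bigr => H _; rewrite -sum1_card; apply: eq_bigl => G; by rewrite inE.
by move=> G _; rewrite inE; apply/subsetP => e; rewrite !inE => /andP[].
Qed.

(* Some class is at least of average size, and each edge on the way to another
   class costs a factor [2 m n], as long as the bad graphs are at most half of
   the current class. *)
Lemma extensions_lower :
  (2 * #|Bad| * (4 * (m * n)) ^ #|block J K : {set 'I_m * 'I_n}| <= #|Bst m n s t|)%N ->
  (0 < m * n)%N ->
  forall H, H \subset block J K ->
    (#|Bst m n s t| <= #|Ext H| * (4 * (m * n)) ^ #|block J K : {set 'I_m * 'I_n}|)%N.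
Proof.
set q := #|block J K : {set 'I_m * 'I_n}|; set q' := (m * n)%N => hBad q'0.
(* Pigeonhole over the [2 ^ q] subgraphs of the block; strictness of the sum is taken from the term
   of the empty graph. *)
have [H0 H0B hH0] : exists2 H0 : bgraph m n, H0 \subset block J K & (#|Bst m n s t| <= #|Ext H0| * 2 ^ q)%N.
  have [/existsP[H0 /andP[h1 h2]]|/existsPn h] := boolP [exists H0 : bgraph m n, (H0 \subset block J K) &&
      (#|Bst m n s t| <= #|Ext H0| * 2 ^ q)%N]; first by exists H0.
  exfalso.
  have : (#|Bst m n s t| * 2 ^ q < #|Bst m n s t| * 2 ^ q)%N; last by rewrite ltnn.
  rewrite -{1}extensions_partition -[X in (_ < _ * X)%N]card_powerset [X in (_ < X)%N]mulnC -sum_nat_const.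
  rewrite big_distrl /= (bigD1 set0) ?inE ?sub0set//= [X in (_ < X)%N](bigD1 set0) ?inE ?sub0set//= -addSn.
  have h' H : H \subset block J K -> (#|Ext H| * 2 ^ q < #|Bst m n s t|)%N.
    by move=> HB; have := h H; rewrite HB /= -ltnNge.
  apply: leq_add; first by apply: h'; exact: sub0set.
  by apply: leq_sum => H /andP[]; rewrite inE => /h'/ltnW.
pose sd H := (H :\: H0) :|: (H0 :\: H).
have sdB H : H \subset block J K -> (#|sd H| <= q)%N.
  move=> HB; apply: subset_leq_card; rewrite subUset !(subset_trans (subsetDl _ _))//.
have q2 k : (0 < (2 * q') ^ k)%N by rewrite expn_gt0 (muln_gt0 2) q'0.
have main d H : H \subset block J K -> #|sd H| = d -> (#|Ext H0| <= #|Ext H| * (2 * q') ^ d)%N.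
  elim: d H => [|d IH] H HB hd.
    move/eqP: hd; rewrite cards_eq0 setU_eq0 !setD_eq0 -eqEsubset => /eqP ->.
    by rewrite muln1.
  have dq : (d < q)%N by rewrite -hd; exact: sdB.
  have step H1 : H1 \subset block J K -> #|sd H1| = d ->
      (#|Ext H1| <= q' * #|Ext H| + #|Bad|)%N -> (#|Ext H0| <= #|Ext H| * (2 * q') ^ d.+1)%N.
    move=> H1B sd1 hstep; have h1 := IH _ H1B sd1; apply: leq_trans h1 _.
    (* The induction hypothesis bounds [Ext H1] from below by the average class size over
       [(2 q')^d]; since [d < q], [hBad] has enough room for this loss. *)
    have h2 : (2 * #|Bad| <= #|Ext H1|)%N.
      rewrite -(@leq_pmul2r ((2 * q') ^ d)) ?q2//.
      apply: leq_trans (IH _ H1B sd1).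
      rewrite -(@leq_pmul2r (2 ^ q)) ?expn_gt0//; apply: leq_trans hH0; apply: leq_trans hBad.
      rewrite -mulnA leq_mul2l; apply/orP; right.
      rewrite (_ : 4 * q' = (2 * q') * 2)%N; last by lia.
      rewrite (expnMn (2 * q')); apply: leq_mul => //; apply: leq_pexp2l; first by rewrite (muln_gt0 2).
      exact: ltnW.
    rewrite expnS mulnA leq_mul2r; apply/orP; right; lia.
  have /set0Pn[e] : sd H != set0 by rewrite -cards_eq0 hd.
  have cs H1 : sd H = e |: sd H1 -> e \notin sd H1 -> #|sd H1| = d.
    by move=> h1 h2; move: hd; rewrite h1 cardsU1 h2; lia.
  rewrite !inE => /orP[/andP[e0 e1]|/andP[e0 e1]].
    have eB : e \in block J K by move/subsetP: HB; apply.
    have HB1 : H :\ e \subset block J K by apply: subset_trans HB; exact: subsetDl.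
    apply: (step (H :\ e)) => //.
      apply: cs; last by rewrite !inE eqxx (negbTE e0) /= ?andbF.
      apply/setP => v; rewrite !inE; have [->|] := eqVneq v e; first by rewrite e0 e1.
      by [].
    by rewrite -{2}(setD1K e1); apply: chain_up => //; rewrite !inE eqxx.
  have eB : e \in block J K by move/subsetP: H0B; apply.
  apply: (step (e |: H)).
  - by rewrite subUset sub1set eB.
  - apply: cs; last by rewrite !inE eqxx e1.
    apply/setP => v; rewrite !inE; have [->|] := eqVneq v e; first by rewrite e0 e1.
    by [].
  - exact: chain_down.
move=> H HB; apply: leq_trans hH0 _.
rewrite (_ : 4 * q' = (2 * q') * 2)%N; last by lia.
rewrite (expnMn (2 * q')) mulnA leq_mul2r; apply/orP; right.
apply: leq_trans (main _ _ HB erefl) _; rewrite leq_mul2l; apply/orP; right.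
by apply: leq_pexp2l; [rewrite (muln_gt0 2)|exact: sdB].
Qed.

End Chain.

(** * Orders of magnitude *)

Section Orders.
Context {R : realType}.
Implicit Types (L h x y : R) (c : nat) (k : int).

Definition scales L h := 2 <= L /\ 1 <= h.

(* The implied constant is 1: as [L >= 2], constants are absorbed by powers of
   [L]. *)
Definition isO L h c k x := `|x| <= L ^+ c * h ^ k.

Variables (L h : R).
Hypothesis sc : scales L h.
Local Notation Bo := (isO L h).

Let L2 : 2 <= L. Proof. by case: sc. Qed.
Let h1 : 1 <= h. Proof. by case: sc. Qed.
Let L1 : 1 <= L. Proof. by apply: le_trans L2; rewrite ler1n. Qed.
Let L0 : 0 < L. Proof. exact: lt_le_trans L1. Qed.
Let h0 : 0 < h. Proof. exact: lt_le_trans h1. Qed.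

Lemma scale_ge0 c k : 0 <= L ^+ c * h ^ k.
Proof. by rewrite mulr_ge0 ?exprn_ge0 ?exprz_ge0 ?ltW. Qed.

Lemma scale_gt0 c k : 0 < L ^+ c * h ^ k.
Proof. by rewrite mulr_gt0 ?exprn_gt0 ?exprz_gt0. Qed.

Lemma scale_le c c' k k' : (c <= c')%N -> k <= k' -> L ^+ c * h ^ k <= L ^+ c' * h ^ k'.
Proof.
move=> cc kk; apply: ler_pM.
- by rewrite exprn_ge0 ?ltW.
- by rewrite exprz_ge0 ?ltW.
- exact: ler_weXn2l.
- exact: ler_weXz2l.
Qed.

Lemma Bo_weak c k c' k' x : Bo c k x -> (c <= c')%N -> k <= k' -> Bo c' k' x.
Proof. by move=> hx cc kk; apply: le_trans hx _; exact: scale_le. Qed.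

Lemma Bo_le c k x y : `|x| <= y -> Bo c k y -> Bo c k x.
Proof. by move=> xy hy; apply: le_trans xy _; apply: le_trans hy; exact: ler_norm. Qed.

Lemma BoN c k x : Bo c k x -> Bo c k (- x).
Proof. by rewrite /isO normrN. Qed.

Lemma Bo_norm c k x : Bo c k x -> Bo c k `|x|.
Proof. by rewrite /isO normr_id. Qed.

Lemma BoD c k x y : Bo c k x -> Bo c k y -> Bo c.+1 k (x + y).
Proof.
move=> hx hy; apply: le_trans (ler_normD _ _) _; apply: le_trans (lerD hx hy) _.
by rewrite exprS -mulr2n -mulr_natl -[leRHS]mulrA; apply: ler_wpM2r => //; exact: scale_ge0.
Qed.

Lemma BoB c k x y : Bo c k x -> Bo c k y -> Bo c.+1 k (x - y).
Proof. by move=> hx hy; apply: BoD => //; exact: BoN. Qed.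

Lemma BoM c c' k k' x y : Bo c k x -> Bo c' k' y -> Bo (c + c') (k + k') (x * y).
Proof.
move=> hx hy; rewrite /isO normrM exprD expfzDr ?gt_eqF// mulrACA.
by apply: ler_pM.
Qed.

Lemma BoX c k x (n : nat) : Bo c k x -> Bo (c * n) (k * n%:Z) (x ^+ n).
Proof.
move=> hx; rewrite /isO normrX exprM -exprz_exp -exprMn; apply: lerXn2r; rewrite ?nnegrE//.
exact: scale_ge0.
Qed.

Lemma Bo_const c x : `|x| <= 2 ^+ c -> Bo c 0 x.
Proof.
move=> hx; rewrite /isO expr0z mulr1; apply: le_trans hx _.
by apply: lerXn2r; rewrite ?nnegrE ?(ltW L0).
Qed.

Lemma Bo1 x : `|x| <= 1 -> Bo 0 0 x.
Proof. exact: (@Bo_const 0). Qed.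

Lemma Bo0 c k : Bo c k 0.
Proof. by rewrite /isO normr0 scale_ge0. Qed.

Lemma Bo_sum (I : finType) (P : pred I) (F : I -> R) c k c' k' :
  Bo c' k' #|P|%:R -> (forall i, P i -> Bo c k (F i)) -> Bo (c' + c) (k' + k) (\sum_(i | P i) F i).
Proof.
move=> hP hF; apply: (@Bo_le _ _ _ (#|P|%:R * (L ^+ c * h ^ k))).
  apply: le_trans (ler_norm_sum _ _ _) _.
  apply: le_trans (ler_sum _ _) _; first by move=> i Pi; exact: hF.
  by rewrite sumr_const mulr_natl.
by apply: BoM => //; rewrite /isO ger0_norm ?scale_ge0.
Qed.

Lemma Bo_inv x c k : 0 < x -> L ^- c * h ^ k <= x -> Bo c (- k) x^-1.
Proof.
move=> x0 hx; rewrite /isO normfV gtr0_norm// -[leRHS]invrK.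
rewrite lef_pV2 ?posrE// ?invr_gt0 ?scale_gt0//.
by rewrite invfM expfV exprz_inv opprK.
Qed.

Section Avg.
Context {T : finType}.
Implicit Types (A : {set T}) (f g : T -> R).

Lemma Bo_avg A f c k : A != set0 -> (forall G, G \in A -> Bo c k (f G)) -> Bo c k (avg A f).
Proof.
move=> A0 hf; apply: le_trans (ler_norm_avg _ _) _.
by apply: le_trans (ler_avg hf) _; rewrite avg_const.
Qed.

Lemma sqrt_scale c k : Num.sqrt (L ^+ (2 * c) * h ^ (2 * k)) = L ^+ c * h ^ k.
Proof.
rewrite mulnC mulrC (mulrC 2) exprM -exprz_exp mulrC -exprMn sqrtr_sqr ger0_norm//.
exact: scale_ge0.
Qed.

Lemma Bo_avgM A f g c k c' k' :
  Bo (2 * c) (2 * k) (avg A (fun G => f G ^+ 2)) ->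
  Bo (2 * c') (2 * k') (avg A (fun G => g G ^+ 2)) ->
  Bo (c + c') (k + k') (avg A (fun G => f G * g G)).
Proof.
move=> hf hg; apply: le_trans (avg_cauchy_schwarz _ _ _) _.
rewrite exprD expfzDr ?gt_eqF// mulrACA -(sqrt_scale c k) -(sqrt_scale c' k').
apply: ler_pM; rewrite ?sqrtr_ge0//; apply: ler_wsqrtr; apply: le_trans (ler_norm _) _ => //.
Qed.

End Avg.
End Orders.

(** * Transposition: column statements from row statements *)

Section Transposition.
Context {R : realType}.

Definition transpose {m n} (G : bgraph m n) : bgraph n m := [set e : 'I_n * 'I_m | (e.2, e.1) \in G].

Lemma in_transpose m n (G : bgraph m n) i w : ((w, i) \in transpose G) = ((i, w) \in G).
Proof. by rewrite inE. Qed.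

Lemma transposeK m n (G : bgraph m n) : transpose (transpose G) = G.
Proof. by apply/setP => -[i w]; rewrite !in_transpose. Qed.

Lemma degu_transpose m n (G : bgraph m n) w : degu (transpose G) w = degv G w.
Proof. by apply: eq_card => i; rewrite !inE. Qed.

Lemma degv_transpose m n (G : bgraph m n) i : degv (transpose G) i = degu G i.
Proof. by apply: eq_card => w; rewrite !inE. Qed.

Lemma transpose_block m n J K (H : bgraph m n) :
  H \subset block J K -> transpose H \subset block K J.
Proof.
move=> /subsetP HB; apply/subsetP => -[w i]; rewrite in_transpose => /HB.
by rewrite !inE andbC.
Qed.

Lemma transpose_ext m n s t J K (H G : bgraph m n) : H \subset block J K ->
  G \in extensions s t J K H -> transpose G \in extensions t s K J (transpose H).
Proof.
move=> HB /(extensionsP _ _ _ HB)[/in_BstP[hu hv] hG].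
apply/(extensionsP _ _ _ (transpose_block HB)); split.
  by apply/in_BstP; split=> i; rewrite ?degu_transpose ?degv_transpose.
by move=> [w i] eB; rewrite !in_transpose hG//; move: eB; rewrite !inE andbC.
Qed.

Lemma lam_transpose m n s t : (0 < m)%N -> (0 < n)%N -> (m * s = n * t)%N ->
  lam R m t = lam R n s.
Proof.
move=> m0 n0 e; apply/eqP; rewrite eqr_div ?pnatr_eq0 -?lt0n// -!natrM eqr_nat.
by rewrite mulnC -e mulnC.
Qed.

Lemma avg_transpose m n s t J K (H : bgraph m n) (f : ('I_m -> 'I_n -> R) -> R) :
  (0 < m)%N -> (0 < n)%N -> (m * s = n * t)%N -> H \subset block J K ->
  avg (extensions t s K J (transpose H)) (fun G => f (fun i w => deviation t G w i)) =
  avg (extensions s t J K H) (fun G => f (deviation s G)).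
Proof.
move=> m0 n0 e HB.
have bij : bijective (@transpose m n) by exists (@transpose n m); exact: transposeK.
have memE G : (transpose G \in extensions t s K J (transpose H)) = (G \in extensions s t J K H).
  apply/idP/idP => [hG|]; last exact: transpose_ext.
  by have := transpose_ext (transpose_block HB) hG; rewrite !transposeK.
rewrite /avg -!sum1_card !(reindex (@transpose m n) (onW_bij _ bij)) /=.
rewrite (eq_bigl _ _ memE) (eq_bigl _ _ memE); congr (_ / _).
apply: eq_bigr => G _; congr f; apply/funext => i; apply/funext => w.
by rewrite /deviation in_transpose (lam_transpose m0 n0 e).
Qed.

End Transposition.

(* All quantities are measured on the scale [h ~ sqrt m ~ sqrt n], up to powers
   of the slowly growing parameter [L]. *)
Record regime (R : realType) (L h : R) (m n s t J K l : nat) : Prop := Regime {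
  rg_sc : scales L h;
  rg_m : h ^+ 2 <= m%:R <= L * h ^+ 2;
  rg_n : h ^+ 2 <= n%:R <= L * h ^+ 2;
  rg_J : J%:R <= L * h;
  rg_K : K%:R <= L * h;
  rg_Jm : (J <= m)%N;
  rg_Kn : (K <= n)%N;
  rg_s : (0 < s < n)%N;
  rg_t : (0 < t < m)%N;
  rg_e : (m * s = n * t)%N;
  rg_lam : L^-1 <= lam R n s * (1 - lam R n s);
  rg_l : (8 * (m * n) <= 2 ^ l)%N;
  rg_lL : l%:R <= L;
  rg_big : L ^+ 100 <= h }.

(** * The regime: graphs of large discrepancy are negligible in every class *)

Section Regime.
Context {R : realType} {L h : R} {m n s t J K l : nat}.
Hypothesis rg : regime L h m n s t J K l.
Local Notation lambda := (lam R n s).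
Local Notation Bad D := [set G in Bst m n s t | ~~ discrepancy s (D : R) G].

Lemma rg_m0 : (0 < m)%N. Proof. by case/andP: (rg_t rg); lia. Qed.
Lemma rg_n0 : (0 < n)%N. Proof. by case/andP: (rg_s rg); lia. Qed.

Lemma regime_transpose : regime L h n m t s K J l.
Proof.
case: rg => *; split => //; first by rewrite (@lam_transpose R m n s t) ?rg_m0 ?rg_n0.
by rewrite (mulnC n).
Qed.

Lemma rg_L2 : 2 <= L. Proof. by case: (rg_sc rg). Qed.
Lemma rg_h1 : 1 <= h. Proof. by case: (rg_sc rg). Qed.
Lemma rg_L0 : 0 < L. Proof. by apply: lt_le_trans rg_L2. Qed.
Lemma rg_h0 : 0 < h. Proof. by apply: lt_le_trans rg_h1. Qed.

Lemma rg_lam01 : 0 < lambda < 1.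
Proof. by case/andP: (rg_s rg) => s0 sn; rewrite lam_gt0// lam_lt1. Qed.

Lemma rg_lam_ge : L^-1 <= lambda /\ L^-1 <= 1 - lambda.
Proof. by have := rg_lam rg; case/andP: rg_lam01 => l0 l1 h1; split; nra. Qed.

Lemma rg_lam_n : lambda * n%:R = s%:R.
Proof. by rewrite divfK// pnatr_eq0 -lt0n rg_n0. Qed.

Lemma rg_lam_m : lambda * m%:R = t%:R.
Proof. by rewrite -(@lam_transpose R m n s t) ?rg_m0 ?rg_n0 ?(rg_e rg)// divfK// pnatr_eq0 -lt0n rg_m0. Qed.

Lemma rg_powers a b : (a <= b)%N -> L ^+ a <= L ^+ b.
Proof. by move=> ab; apply: ler_weXn2l => //; apply: le_trans rg_L2; rewrite ler1n. Qed.

Lemma card_block : #|block J K : {set 'I_m * 'I_n}| = (J * K)%N.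
Proof.
transitivity #|setX [set i : 'I_m | (i < J)%N] [set w : 'I_n | (w < K)%N]|.
  by apply: eq_card => e; rewrite !inE.
by rewrite cardsX !card_ord_lt ?(rg_Jm rg) ?(rg_Kn rg).
Qed.

Lemma degree_margin (x N X : R) : L^-1 <= x -> h ^+ 2 <= N -> X <= L * h ->
  h ^+ 2 / (2 * L) <= x * N - X.
Proof.
move=> hx hN hX; have L0 := rg_L0; have L2 := rg_L2; have h0 := rg_h0.
have h2 : 0 < h ^+ 2 by rewrite exprn_gt0.
have i0 : 0 < L^-1 by rewrite invr_gt0.
have h3 : L^-1 * h ^+ 2 <= x * N by apply: ler_pM => //; exact: ltW.
have h4 : L * h <= h ^+ 2 / (2 * L).
  rewrite ler_pdivlMr ?mulr_gt0// expr2.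
  have -> : L * h * (2 * L) = (2 * L ^+ 2) * h by ring.
  rewrite ler_wpM2r ?(ltW h0)//; apply: le_trans (rg_big rg).
  apply: (@le_trans _ _ (L ^+ 3)); last by exact: rg_powers.
  by rewrite (exprS L 2); apply: ler_wpM2r => //; rewrite exprn_ge0 ?ltW.
have -> : h ^+ 2 / (2 * L) = L^-1 * h ^+ 2 - h ^+ 2 / (2 * L) by field; rewrite gt_eqF.
by apply: lerB => //; apply: le_trans hX _.
Qed.

(** [7 * L ^+ 2 * h] is the discrepancy threshold from here on. Its square is of order [L^4 h^2]:
    above the [L^3 h^2] that [bad_rare] has to beat, and far below [h^4 / (4 L^4)], so the
    hypotheses [hup] and [hdown] hold. *)
Lemma disc_small (x y a b : R) : L^-1 <= x -> h ^+ 2 / (2 * L) <= a -> h ^+ 2 / (2 * L) <= b ->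
  (7 * L ^+ 2 * h) ^+ 2 < x ^+ 2 * (a * b).
Proof.
move=> hx ha hb; have L0 := rg_L0; have L2 := rg_L2; have h0 := rg_h0.
have i0 : 0 < L^-1 by rewrite invr_gt0.
have q0 : 0 < h ^+ 2 / (2 * L) by rewrite divr_gt0 ?exprn_gt0 ?mulr_gt0.
have big : L ^+ 24 <= h ^+ 2.
  by rewrite (exprM L 12 2); apply: lerXn2r; rewrite ?nnegrE ?exprn_ge0 ?(ltW L0) ?(ltW h0)//;
    apply: le_trans (rg_big rg); exact: rg_powers.
apply: (@lt_le_trans _ _ (L^-1 ^+ 2 * ((h ^+ 2 / (2 * L)) * (h ^+ 2 / (2 * L))))); last first.
  apply: ler_pM.
  - by rewrite exprn_ge0// ltW.
  - by rewrite mulr_ge0// ltW.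
  - by apply: lerXn2r => //; rewrite nnegrE ltW//; apply: lt_le_trans hx.
  - by apply: ler_pM => //; exact: ltW.
have -> : L^-1 ^+ 2 * ((h ^+ 2 / (2 * L)) * (h ^+ 2 / (2 * L))) = h ^+ 2 * h ^+ 2 / (4 * L ^+ 4).
  by field; rewrite gt_eqF.
rewrite ltr_pdivlMr ?mulr_gt0 ?exprn_gt0//.
have -> : (7 * L ^+ 2 * h) ^+ 2 * (4 * L ^+ 4) = h ^+ 2 * (196 * L ^+ 8) by ring.
rewrite ltr_pM2l ?exprn_gt0//; apply: lt_le_trans big.
have L8 : 256 <= L ^+ 8.
  have -> : 256 = 2 ^+ 8 :> R by rewrite -natrX.
  by apply: lerXn2r => //; rewrite nnegrE ltW.
apply: (@lt_le_trans _ _ (L ^+ 8 * L ^+ 8)); last by rewrite -exprD; exact: rg_powers.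
rewrite ltr_pM2r ?exprn_gt0//; lra.
Qed.

Lemma two_le_expR : 2 <= expR 1 :> R.
Proof. by have := expR_ge1Dx (1 : R); rewrite -[1 + 1]/(2 : R). Qed.

(** All counting factors are bounded by powers of 2 with a total exponent of order [L^3 h^2], which
    [D^2 / 4] exceeds. The spare factor [(m n)^2] is kept for the fourth moment in
    [opbound_moment]. *)
Lemma bad_rare : ((2 * (m * n) ^ 2) * #|Bad (7 * L ^+ 2 * h)| *
   (4 * (m * n)) ^ #|block J K : {set 'I_m * 'I_n}| <= #|Bst m n s t|)%N.
Proof.
have L0 := rg_L0; have L2 := rg_L2; have h0 := rg_h0; have h1 := rg_h1.
set D := 7 * L ^+ 2 * h; have D0 : 0 <= D by rewrite /D !mulr_ge0 ?exprn_ge0 ?ltW.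
case/andP: (rg_s rg) => s0 sn; have := discrepancy_rare s0 sn (rg_e rg) D0.
rewrite -(addn1 (m + n)).
set bad := #|_|; set B := #|Bst m n s t| => hb.
rewrite card_block -(ler_nat R).
pose N := ((1 + 2 * l + l * (J * K)) + ((m + n + 1) + (l * m + l * n)))%N.
have m0 := rg_m0; have n0 := rg_n0; have hl := rg_l rg.
have e1 : (2 * (m * n) ^ 2 * (4 * (m * n)) ^ (J * K) <= 2 ^ (1 + 2 * l + l * (J * K)))%N.
  have f1 : ((m * n) ^ 2 <= 2 ^ (2 * l))%N by rewrite (mulnC 2 l) expnM leq_exp2r//; lia.
  have f2 : ((4 * (m * n)) ^ (J * K) <= 2 ^ (l * (J * K)))%N.
    rewrite (expnM 2); have [->|JK0] := posnP (J * K); first by rewrite !expn0.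
    by rewrite leq_exp2r//; lia.
  rewrite (expnD 2 (1 + 2 * l)); apply: leq_mul f2.
  by rewrite add1n (expnS 2) leq_mul2l f1 orbT.
have e2 : (2 ^ (m + n + 1) * (n.+1 ^ m * m.+1 ^ n) <= 2 ^ ((m + n + 1) + (l * m + l * n)))%N.
  rewrite (expnD 2 (m + n + 1)) leq_mul2l; apply/orP; right; rewrite (expnD 2) !(expnM 2); apply: leq_mul.
    by rewrite leq_exp2r//; nia.
  by rewrite leq_exp2r//; nia.
have e3 : 2 ^+ N <= expR (D ^+ 2 / 4).
  apply: (@le_trans _ _ (expR 1 ^+ N)).
    by apply: lerXn2r; rewrite ?nnegrE ?expR_ge0 ?two_le_expR.
  rewrite -expRM_natl mulr1 ler_expR /N !natrD !natrM.
  have lL := rg_lL rg; have l0 : 0 <= l%:R :> R by [].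
  case/andP: (rg_m rg) => _ hm; case/andP: (rg_n rg) => _ hn.
  have hJ := rg_J rg; have hK := rg_K rg.
  have q1 : 1 <= h ^+ 2 by rewrite exprn_ege1.
  have JKle : J%:R * K%:R <= L ^+ 2 * h ^+ 2 by rewrite -exprMn expr2; apply: ler_pM => //.
  have t1 : l%:R * (J%:R * K%:R) <= L * (L ^+ 2 * h ^+ 2) by apply: ler_pM => //; rewrite mulr_ge0.
  have t2 : l%:R * m%:R <= L * (L * h ^+ 2) by apply: ler_pM => //; rewrite mulr_ge0.
  have t3 : l%:R * n%:R <= L * (L * h ^+ 2) by apply: ler_pM => //; rewrite mulr_ge0.
  have h20 : 0 <= h ^+ 2 by rewrite exprn_ge0 ?ltW.
  have L3 : 4 * (L * h ^+ 2) <= L ^+ 3 * h ^+ 2.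
    rewrite (mulrA 4 L); apply: ler_wpM2r => //.
    by rewrite (exprS L 2) mulrC; apply: ler_wpM2l; [exact: ltW|nra].
  have L3' : 2 * (L * (L * h ^+ 2)) <= L ^+ 3 * h ^+ 2.
    have -> : 2 * (L * (L * h ^+ 2)) = 2 * (L ^+ 2 * h ^+ 2) by ring.
    rewrite (mulrA 2 (L ^+ 2)); apply: ler_wpM2r => //.
    by rewrite (exprS L 2); apply: ler_wpM2r => //; rewrite exprn_ge0 ?ltW.
  have Lq : 0 <= L ^+ 3 * h ^+ 2 by rewrite mulr_ge0 ?exprn_ge0 ?ltW.
  have Lq2 : L * 1 <= L * h ^+ 2 by apply: ler_wpM2l => //; exact: ltW.
  have D2 : 12 * (L ^+ 3 * h ^+ 2) <= D ^+ 2 / 4.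
    have -> : D ^+ 2 / 4 = 49 / 4 * (L * (L ^+ 3 * h ^+ 2)) by rewrite /D; field.
    have : 2 * (L ^+ 3 * h ^+ 2) <= L * (L ^+ 3 * h ^+ 2) by apply: ler_wpM2r.
    lra.
  apply: le_trans D2; lra.
have E0 := expR_gt0 (D ^+ 2 / 4).
rewrite mulnAC natrM; apply: le_trans (ler_wpM2l _ hb) _ => //.
rewrite expRN; set E := expR _ in E0 e3 *.
set a := (2 * (m * n) ^ 2 * (4 * (m * n)) ^ (J * K))%N.
rewrite -[leRHS]mul1r [leLHS](_ : _ = a%:R * (2 ^ (m + n + 1) * (n.+1 ^ m * m.+1 ^ n))%:R / E * B%:R);
  last by rewrite !natrM !natrX; ring.
apply: ler_wpM2r => //; rewrite ler_pdivrMr// mul1r; apply: le_trans e3.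
by rewrite /a -natrM -natrX ler_nat /N (expnD 2 (1 + 2 * l + l * (J * K))) leq_mul.
Qed.

End Regime.

Section Bounds.
Context {R : realType} {L h : R} {m n s t J K l : nat}.
Hypothesis rg : regime L h m n s t J K l.
Local Notation lambda := (lam R n s).
Local Notation Ext := (@extensions m n s t J K).
Local Notation dev := (@deviation R m n s).
Local Notation D := (7 * L ^+ 2 * h).
Local Notation Bo := (isO L h).

Lemma rg_D0 : 0 <= D.
Proof. by rewrite !mulr_ge0 ?exprn_ge0 ?(ltW (rg_L0 rg)) ?(ltW (rg_h0 rg)). Qed.

Lemma rg_margins :
  [/\ h ^+ 2 / (2 * L) <= (s - K)%:R :> R, h ^+ 2 / (2 * L) <= (t - J)%:R :> R,
      h ^+ 2 / (2 * L) <= (n - s - K)%:R :> R & h ^+ 2 / (2 * L) <= (m - t - J)%:R :> R].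
Proof.
have [l1 l2] := rg_lam_ge rg.
case/andP: (rg_m rg) => hm _; case/andP: (rg_n rg) => hn _.
have nb a b : a%:R - b%:R <= (a - b)%:R :> R.
  by rewrite lerBlDr -natrD ler_nat; lia.
case/andP: (rg_s rg) => _ sn; case/andP: (rg_t rg) => _ tm.
split; apply: le_trans (nb _ _).
- by rewrite -(rg_lam_n rg); apply: (degree_margin rg) => //; exact: (rg_K rg).
- by rewrite -(rg_lam_m rg); apply: (degree_margin rg) => //; exact: (rg_J rg).
- rewrite natrB ?(ltnW sn)// -(rg_lam_n rg) -[X in X - _ - _]mul1r -mulrBl.
  by apply: (degree_margin rg) => //; exact: (rg_K rg).
- rewrite natrB ?(ltnW tm)// -(rg_lam_m rg) -[X in X - _ - _]mul1r -mulrBl.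
  by apply: (degree_margin rg) => //; exact: (rg_J rg).
Qed.

Lemma ext_lower (H : bgraph m n) : H \subset block J K ->
  (0 < #|Ext H|)%N /\
  (2 * (m * n) ^ 2 * #|[set G in Bst m n s t | ~~ discrepancy s D G]| <= #|Ext H|)%N.
Proof.
move=> HB; have [h1 h2 h3 h4] := rg_margins; have [l1 l2] := rg_lam_ge rg.
have hup : D ^+ 2 < (1 - lambda) ^+ 2 * ((s - K)%:R * (t - J)%:R) by exact: (disc_small rg).
have hdown : D ^+ 2 < lambda ^+ 2 * ((n - s - K)%:R * (m - t - J)%:R) by exact: (disc_small rg).
have hb := bad_rare rg; set bad := #|_| in hb *; set q := ((4 * _) ^ _)%N in hb.
have mn0 : (0 < m * n)%N by rewrite muln_gt0 (rg_m0 rg) (rg_n0 rg).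
have q0 : (0 < q)%N by rewrite expn_gt0 (muln_gt0 4) mn0.
have lower : (#|Bst m n s t| <= #|Ext H| * q)%N.
  apply: (extensions_lower rg_D0 (rg_Jm rg) (rg_Kn rg) hup hdown _ mn0) => //.
  rewrite -/bad -/q; apply: leq_trans hb; apply: leq_mul => //; apply: leq_mul => //.
  by apply: leq_pmulr; rewrite expn_gt0 mn0.
have bst0 : (0 < #|Bst m n s t|)%N.
  have := Bst_lower (rg_e rg); case: #|Bst m n s t| => //; rewrite muln0 leqn0 expn_eq0 -leqn0.
  by rewrite leqNgt bin_gt0 ltnW//; case/andP: (rg_s rg).
split.
  by move: lower; case: #|Ext H| => //; rewrite mul0n leqNgt bst0.
by rewrite -(leq_pmul2r q0); exact: leq_trans hb lower.
Qed.

Lemma ext_neq0 (H : bgraph m n) : H \subset block J K -> Ext H != set0.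
Proof. by move=> HB; rewrite -card_gt0; case: (ext_lower HB). Qed.

Lemma rg_dev1 (G : bgraph m n) i w : `|dev G i w| <= 1.
Proof. by apply: dev_le1; rewrite ?(rg_n0 rg)//; case/andP: (rg_s rg) => _ /ltnW. Qed.

(* Graphs with large discrepancy get the trivial bound. *)
Definition opbound (G : bgraph m n) : R :=
  if discrepancy s D G then L ^+ 10 * h else Num.sqrt (m * n)%:R.

Lemma opbound_ge0 G : 0 <= opbound G.
Proof.
rewrite /opbound; case: ifP => _; rewrite ?sqrtr_ge0// mulr_ge0 ?exprn_ge0 ?ltW ?(rg_L0 rg)//.
exact: (rg_h0 rg).
Qed.

(** In the good case [operator_norm] loses only powers of [l <= L], which [L ^+ 10] absorbs.
    Otherwise entries of size at most 1 and two bounds of the 1-norm by the 2-norm suffice. *)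
Lemma opboundP G (u : 'I_m -> R) (v : 'I_n -> R) :
  `|\sum_i u i * \sum_w dev G i w * v w| <= opbound G * norm2 u * norm2 v.
Proof.
have L0 := rg_L0 rg; have L2 := rg_L2 rg; have h0 := rg_h0 rg; have h1 := rg_h1 rg.
rewrite /opbound; case: ifP => hd.
  apply: le_trans (operator_norm (l := l) (fun i w => rg_dev1 G i w) rg_D0 _ _ u v) _.
  - by move=> S T; move/forallP: hd => /(_ S)/forallP/(_ T).
  - by rewrite !card_ord; apply: leq_trans (rg_l rg); lia.
  apply: ler_wpM2r; first exact: norm2_ge0.
  apply: ler_wpM2r; first exact: norm2_ge0.
  have lL := rg_lL rg; have l0 : 0 <= l%:R :> R by [].
  have pw := rg_powers rg.
  have L1 : 1 <= L by apply: le_trans L2; rewrite ler1n.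
  have a1 : l%:R * D <= L * D by apply: ler_wpM2r => //; exact: rg_D0.
  have a2 : 1 <= L ^+ 3 * h by rewrite -[1]mulr1; apply: ler_pM => //; exact: exprn_ege1.
  have a3 : 1 <= L ^+ 4 * h by rewrite -[1]mulr1; apply: ler_pM => //; exact: exprn_ege1.
  have a4 : l%:R * (2 * (l%:R * D + 1)) <= L * (2 * (8 * L ^+ 3 * h)).
    apply: ler_pM => //; first by rewrite mulr_ge0// addr_ge0// mulr_ge0// rg_D0.
    apply: ler_wpM2l => //; have : L * D = 7 * (L ^+ 3 * h) by ring.
    lra.
  have a5 : 34 * (L ^+ 4 * h) <= L ^+ 10 * h.
    rewrite mulrA; apply: ler_wpM2r; first exact: ltW.
    rewrite (exprD L 6 4); apply: ler_wpM2r; first by rewrite exprn_ge0// ltW.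
    apply: (@le_trans _ _ (2 ^+ 6)); first by rewrite -natrX ler_nat.
    by apply: lerXn2r => //; rewrite nnegrE ltW.
  lra.
have e : \sum_i u i * \sum_w dev G i w * v w = \sum_i \sum_w u i * (dev G i w * v w).
  by apply: eq_bigr => i _; rewrite mulr_sumr.
rewrite e; apply: (@le_trans _ _ (\sum_i \sum_w `|u i| * `|v w|)).
  apply: le_trans (ler_norm_sum _ _ _) _; apply: ler_sum => i _.
  apply: le_trans (ler_norm_sum _ _ _) _; apply: ler_sum => w _.
  by rewrite !normrM ler_wpM2l// ler_piMl// rg_dev1.
have s1 := sum_abs_le u; have s2 := sum_abs_le v; rewrite !card_ord in s1 s2.
have -> : Num.sqrt (m * n)%:R * norm2 u * norm2 v =
    (Num.sqrt m%:R * norm2 u) * (Num.sqrt n%:R * norm2 v) by rewrite natrM sqrtrM//; ring.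
under eq_bigr do rewrite -mulr_sumr.
rewrite -mulr_suml; apply: ler_pM => //.
- exact: sumr_ge0.
- exact: sumr_ge0.
Qed.

(** A bad graph contributes at most [(m n)^2] for exponents up to 4, and by [ext_lower] the
    proportion of bad graphs is below the reciprocal of this. *)
Lemma opbound_moment (H : bgraph m n) (a : nat) : H \subset block J K -> (a <= 4)%N ->
  Bo (10 * a).+1 a (avg (Ext H) (fun G => opbound G ^+ a)).
Proof.
move=> HB a4; have [N0 hbad] := ext_lower HB.
have L0 := rg_L0 rg; have L2 := rg_L2 rg; have h0 := rg_h0 rg; have h1 := rg_h1 rg.
have sc := rg_sc rg.
have mn1 : (1 : R) <= (m * n)%:R by rewrite ler1n muln_gt0 (rg_m0 rg) (rg_n0 rg).
pose P : R := L ^+ 10 * h.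
have P1 : 1 <= P by rewrite -[1]mulr1; apply: ler_pM => //; apply: exprn_ege1; lra.
pose b (G : bgraph m n) : R := (~~ discrepancy s D G)%:R * (m * n)%:R ^+ 2.
apply: (@Bo_le _ _ _ _ _ _ (P ^+ a + 1)); last first.
  apply: BoD => //; last first.
    apply: (@Bo_weak _ _ _ sc 0 0) => //; apply: Bo1 => //; by rewrite normr1.
  rewrite /isO /P exprMn -exprM ger0_norm ?mulr_ge0 ?exprn_ge0 ?(ltW L0) ?(ltW h0)//.
rewrite ger0_norm; last by apply: avg_ge0 => G _; rewrite exprn_ge0// opbound_ge0.
apply: (@le_trans _ _ (avg (Ext H) (fun G => P ^+ a + b G))).
  apply: ler_avg => G _; rewrite /opbound /b; case: ifP => hd /=; first by rewrite mul0r addr0.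
  rewrite mul1r; apply: (@le_trans _ _ ((m * n)%:R ^+ 2)); last by rewrite lerDr exprn_ge0// ltW// (lt_le_trans _ P1).
  apply: (@le_trans _ _ (Num.sqrt (m * n)%:R ^+ 4)).
    by apply: ler_weXn2l => //; rewrite -[X in X <= _]sqrtr1; apply: ler_wsqrtr.
  by rewrite (exprM _ 2 2) sqr_sqrtr.
rewrite avgD avg_const ?ext_neq0//; rewrite lerD2l.
rewrite /avg /b -mulr_suml ler_pdivrMr ?ltr0n// mul1r.
apply: (@le_trans _ _ (#|[set G in Bst m n s t | ~~ discrepancy s D G]|%:R * (m * n)%:R ^+ 2)).
  apply: ler_wpM2r; first exact: exprn_ge0.
  rewrite -natr_sum ler_nat -sum1_card big_mkcond [leqRHS]big_mkcond; apply: leq_sum => G _.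
  case: ifP => // hG; rewrite [G \in [set _ in _ | _]]inE.
  by move: hG; rewrite inE => /andP[-> _]; case: discrepancy.
rewrite -natrX -natrM ler_nat; apply: leq_trans hbad.
by rewrite mulnC leq_mul2r -[leqLHS]mul1n leq_mul2r orbT orbT.
Qed.

End Bounds.

Lemma sum_ord_lt (R : realType) (n K : nat) (x : R) : (K <= n)%N ->
  \sum_(w : 'I_n | (w < K)%N) x = K%:R * x.
Proof. by move=> Kn; rewrite -(big_ord_widen n (fun=> x) Kn) sumr_const card_ord mulr_natl. Qed.

Lemma sum_ord_ge (R : realType) (n K : nat) (x : R) : (K <= n)%N ->
  \sum_(w : 'I_n | (K <= w)%N) x = (n%:R - K%:R) * x.
Proof.
move=> Kn; have := sum_ord_lt x (leqnn n).
rewrite (eq_bigl xpredT) => [|w]; last exact: ltn_ord.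
rewrite (bigID (fun w : 'I_n => (w < K)%N)) /= sum_ord_lt// mulrBl => <-.
by rewrite addrAC subrr add0r; apply: eq_bigl => w; rewrite leqNgt.
Qed.

(** * Moments of edge indicators *)

Section Exchange.
Context {R : realType} {L h : R} {m n s t J K l : nat}.
Hypothesis rg : regime L h m n s t J K l.
Variable H : bgraph m n.
Hypothesis HB : H \subset block J K.
Local Notation lambda := (lam R n s).
Local Notation Ext := (@extensions m n s t J K).
Local Notation dev := (@deviation R m n s).
Local Notation Bo := (isO L h).
Local Notation E := (avg (Ext H)).
Local Notation m' := (m%:R - J%:R : R).
Local Notation n' := (n%:R - K%:R : R).

Lemma Bo_m : Bo 1 2 m%:R.
Proof. by rewrite /isO expr1 ger0_norm//; case/andP: (rg_m rg). Qed.
Lemma Bo_n : Bo 1 2 n%:R.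
Proof. by rewrite /isO expr1 ger0_norm//; case/andP: (rg_n rg). Qed.
Lemma Bo_J : Bo 1 1 J%:R.
Proof. by rewrite /isO expr1 ger0_norm//; exact: (rg_J rg). Qed.
Lemma Bo_K : Bo 1 1 K%:R.
Proof. by rewrite /isO expr1 ger0_norm//; exact: (rg_K rg). Qed.

Lemma scale_half (N X : R) : h ^+ 2 <= N -> X <= L * h -> L^-1 * h ^+ 2 <= N - X.
Proof.
move=> hN hX; have L0 := rg_L0 rg; have L2 := rg_L2 rg; have h0 := rg_h0 rg.
have h1 : 2 * L <= h.
  apply: le_trans (rg_big rg); apply: (@le_trans _ _ (L ^+ 2)); last by exact: (rg_powers rg).
  by rewrite expr2; apply: ler_wpM2r => //; exact: ltW.
have h2 : L * h <= h ^+ 2 / 2 by rewrite ler_pdivlMr// expr2; nra.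
have h3 : L^-1 * h ^+ 2 <= h ^+ 2 / 2.
  rewrite mulrC; apply: ler_wpM2l; first by rewrite exprn_ge0 ?ltW.
  by rewrite lef_pV2 ?posrE.
lra.
Qed.

Lemma Bo_n'V : 0 < n' /\ Bo 1 (-2) n'^-1.
Proof.
have h1 : L^-1 * h ^+ 2 <= n' by apply: scale_half; [case/andP: (rg_n rg)|exact: (rg_K rg)].
have n0 : 0 < n' by apply: lt_le_trans h1; rewrite mulr_gt0 ?invr_gt0 ?exprn_gt0 ?(rg_L0 rg) ?(rg_h0 rg).
by split=> //; apply: (Bo_inv (rg_sc rg)) => //; rewrite expr1.
Qed.

Lemma Bo_m'V : 0 < m' /\ Bo 1 (-2) m'^-1.
Proof.
have h1 : L^-1 * h ^+ 2 <= m' by apply: scale_half; [case/andP: (rg_m rg)|exact: (rg_J rg)].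
have n0 : 0 < m' by apply: lt_le_trans h1; rewrite mulr_gt0 ?invr_gt0 ?exprn_gt0 ?(rg_L0 rg) ?(rg_h0 rg).
by split=> //; apply: (Bo_inv (rg_sc rg)) => //; rewrite expr1.
Qed.

Lemma Bo_mV : Bo 0 (-2) m%:R^-1.
Proof.
by apply: (Bo_inv (rg_sc rg)); rewrite ?ltr0n ?(rg_m0 rg)// expr0 invr1 mul1r; case/andP: (rg_m rg).
Qed.

Lemma Bo_nV : Bo 0 (-2) n%:R^-1.
Proof.
by apply: (Bo_inv (rg_sc rg)); rewrite ?ltr0n ?(rg_n0 rg)// expr0 invr1 mul1r; case/andP: (rg_n rg).
Qed.

Lemma Bo_lamV : Bo 1 0 (lambda * (1 - lambda))^-1.
Proof.
have [/andP[l0 l1]] := rg_lam01 rg.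
rewrite -oppr0; apply: (Bo_inv (rg_sc rg)); first by rewrite mulr_gt0// subr_gt0.
by rewrite expr0z mulr1 expr1; exact: (rg_lam rg).
Qed.

Lemma Bo_dev G i w : Bo 0 0 (dev G i w).
Proof. by apply: (Bo1 (rg_sc rg)); exact: (rg_dev1 rg). Qed.

Lemma ext_Bst G : G \in Ext H -> G \in Bst m n s t.
Proof. by case/(extensionsP _ _ _ HB). Qed.

Lemma sum_col_tail G i : G \in Ext H ->
  \sum_(w : 'I_n | (K <= w)%N) dev G i w = - \sum_(k : 'I_n | (k < K)%N) dev G i k.
Proof.
move=> /ext_Bst GB; have := @row_sum_dev R _ _ _ _ _ i (rg_n0 rg) GB.
rewrite (bigID (fun w : 'I_n => (w < K)%N)) /= => /eqP; rewrite addr_eq0 => /eqP ->.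
by rewrite opprK; apply: eq_bigl => w; rewrite leqNgt.
Qed.

Lemma sum_row_tail G w : G \in Ext H ->
  \sum_(z : 'I_m | (J <= z)%N) dev G z w = - \sum_(j : 'I_m | (j < J)%N) dev G j w.
Proof.
move=> /ext_Bst GB; have := @col_sum_dev R _ _ _ _ _ w (rg_n0 rg) (rg_e rg) GB.
rewrite (bigID (fun z : 'I_m => (z < J)%N)) /= => /eqP; rewrite addr_eq0 => /eqP ->.
by rewrite opprK; apply: eq_bigl => z; rewrite leqNgt.
Qed.

(** For [H] inside the block this is the quantity [x_j - lambda K] of the theorem, see
    [rowdev_degu]. It takes the same value on every graph of the class. *)
Definition row_dev j : R := \sum_(k : 'I_n | (k < K)%N) dev H j k.

Lemma rowdevE G (j : 'I_m) : G \in Ext H -> (j < J)%N ->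
  \sum_(k : 'I_n | (k < K)%N) dev G j k = row_dev j.
Proof. by move=> GE jJ; apply: eq_bigr => k kK; exact: (dev_ext HB GE). Qed.

Lemma rowdev_le j : `|row_dev j| <= K%:R.
Proof.
rewrite -[leRHS]mulr1 -(sum_ord_lt 1 (rg_Kn rg)); apply: le_trans (ler_norm_sum _ _ _) _.
by apply: ler_sum => k _; exact: (rg_dev1 rg).
Qed.

Lemma Bo_rowdev j : Bo 1 1 (row_dev j).
Proof. exact: (Bo_le (rowdev_le j) Bo_K). Qed.

(** A moment at one outer column becomes a sum over all of them, which the degree conditions or the
    operator norm can evaluate. The hypothesis on [F] says that it depends on the outer columns only
    through the marked one or symmetrically. *)
Lemma exch_col (F : ('I_m -> 'I_n -> R) -> 'I_n -> R) (w0 : 'I_n) : (K <= w0)%N ->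
  (forall g (w w' : 'I_n), (K <= w)%N -> (K <= w')%N ->
     F (fun i v => g i (tperm w w' v)) w' = F g w) ->
  n' * E (fun G => F (dev G) w0) = E (fun G => \sum_(w : 'I_n | (K <= w)%N) F (dev G) w).
Proof.
move=> w0K hF; rewrite avg_sum.
transitivity (\sum_(w : 'I_n | (K <= w)%N) E (fun G => F (dev G) w0)).
  by rewrite sum_ord_ge// (rg_Kn rg).
apply: eq_bigr => w wK; rewrite -(@avg_col_exchange _ _ _ _ _ _ _ _ w w0 (fun g => F g w0))//.
by apply: eq_avg => G _; rewrite hF.
Qed.

Lemma exch_row (F : ('I_m -> 'I_n -> R) -> 'I_m -> R) (z0 : 'I_m) : (J <= z0)%N ->
  (forall g (z z' : 'I_m), (J <= z)%N -> (J <= z')%N ->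
     F (fun i v => g (tperm z z' i) v) z' = F g z) ->
  m' * E (fun G => F (dev G) z0) = E (fun G => \sum_(z : 'I_m | (J <= z)%N) F (dev G) z).
Proof.
move=> z0J hF; rewrite avg_sum.
transitivity (\sum_(z : 'I_m | (J <= z)%N) E (fun G => F (dev G) z0)).
  by rewrite sum_ord_ge// (rg_Jm rg).
apply: eq_bigr => z zJ; rewrite -(@avg_row_exchange _ _ _ _ _ _ _ _ z z0 (fun g => F g z0))//.
by apply: eq_avg => G _; rewrite hF.
Qed.

Let nE : Ext H != set0. Proof. exact: (ext_neq0 rg HB). Qed.

Lemma E_const (a : R) : E (fun=> a) = a.
Proof. exact: avg_const. Qed.

(** The row sum of deviations vanishes, so the outer entries of row [j] share [- row_dev j] equally
    in the mean. *)
Lemma E_jw (j : 'I_m) (w : 'I_n) : (j < J)%N -> (K <= w)%N -> E (fun G => dev G j w) = - (row_dev j / n').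
Proof.
move=> jJ wK; have [n0 _] := Bo_n'V.
apply: (mulfI (x := n')); first by rewrite gt_eqF.
rewrite (exch_col (F := fun g w => g j w))//; last by move=> g w1 w2 _ _; rewrite tpermR.
rewrite mulrN mulrCA divff ?gt_eqF// mulr1 -[RHS]E_const; apply: eq_avg => G GE.
by rewrite sum_col_tail// rowdevE.
Qed.

Lemma E_jw_sqr (j : 'I_m) (w : 'I_n) : (j < J)%N -> (K <= w)%N ->
  E (fun G => dev G j w ^+ 2) = lambda * (1 - lambda) - (1 - 2 * lambda) * (row_dev j / n').
Proof.
move=> jJ wK; under [LHS]eq_avg => G _ do rewrite dev_sqr.
by rewrite avgD E_const avgZ E_jw// mulrN.
Qed.

Section Switching.
Variables (j : 'I_m) (w : 'I_n).
Hypotheses (jJ : (j < J)%N) (wK : (K <= w)%N).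

(** These are images of short vectors under the deviation matrix: [ucor] applies it to the outer
    part of row [j], [Rcor] to the indicator of the block columns, and [Qcor] and [Tcor] apply its
    transpose to the results. This is how the operator norm enters. *)
Definition ucor (g : 'I_m -> 'I_n -> R) i := \sum_(v : 'I_n | (K <= v)%N) g j v * g i v.
Definition Qcor (g : 'I_m -> 'I_n -> R) w := \sum_i g i w * ucor g i.
Definition Rcor (g : 'I_m -> 'I_n -> R) i := \sum_(k : 'I_n | (k < K)%N) g i k.
Definition Tcor (g : 'I_m -> 'I_n -> R) w := \sum_i g i w * Rcor g i.

(** Total effect on a test function of the switches that create an edge at [(j, w)]. A test function
    is useful when this is small compared with the number of switches. *)
Definition change (f : bgraph m n -> R) :=
  E (fun G => \sum_i \sum_(v : 'I_n | (K <= v)%N)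
    (apat G j i w v)%:R * (f (switch j i w v @^-1: G) - f G)).

(** Each indicator is a product of four factors affine in the deviations. The pattern is void for
    [i = j] and for [v = w], so these values stay in the range; complete column sums arise and
    vanish. *)
Lemma sum_dpat G : G \in Ext H ->
  \sum_i \sum_(v : 'I_n | (K <= v)%N) (dpat G j i w v)%:R =
  (lambda + dev G j w) * (lambda * (1 - lambda) * m%:R * ((1 - lambda) * n' + row_dev j) +
     (1 - lambda) * Tcor (dev G) w + Qcor (dev G) w).
Proof.
move=> GE; set g := dev G.
have e i v : (dpat G j i w v)%:R = (lambda + g j w) *
    (((1 - lambda) - g i w) * (((1 - lambda) * (lambda + g i v) - lambda * g j v) - g j v * g i v)).
  by rewrite /g /deviation /dpat; do 4!case: (_ \in G) => /=; ring.
under eq_bigr do (under eq_bigr do rewrite e; rewrite -!mulr_sumr).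
rewrite -mulr_sumr; congr (_ * _).
have cn : \sum_(v : 'I_n | (K <= v)%N) (1 : R) = n'.
  by rewrite sum_ord_ge ?mulr1// (rg_Kn rg).
have e1 i : \sum_(v : 'I_n | (K <= v)%N) (((1 - lambda) * (lambda + g i v) - lambda * g j v) - g j v * g i v) =
    lambda * ((1 - lambda) * n' + row_dev j) - (1 - lambda) * Rcor g i - ucor g i.
  transitivity (\sum_(v : 'I_n | (K <= v)%N) ((1 - lambda) * lambda * 1 + (1 - lambda) * g i v - lambda * g j v - g j v * g i v)).
    by apply: eq_bigr => v _; ring.
  rewrite !sumrB big_split /= -!mulr_sumr cn !sum_col_tail// (rowdevE GE jJ) -/(ucor g i) -/(Rcor g i).
  by ring.
under eq_bigr do rewrite e1.
have GB := ext_Bst GE.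
have s0 : \sum_i g i w = 0 by exact: (@col_sum_dev R _ _ _ _ _ w (rg_n0 rg) (rg_e rg) GB).
have sR : \sum_i Rcor g i = 0.
  rewrite /Rcor exchange_big big1//= => k _; exact: (@col_sum_dev R _ _ _ _ _ k (rg_n0 rg) (rg_e rg) GB).
have su : \sum_i ucor g i = 0.
  rewrite /ucor exchange_big big1//= => v _; rewrite -mulr_sumr.
  by rewrite (@col_sum_dev R _ _ _ _ _ v (rg_n0 rg) (rg_e rg) GB) mulr0.
set c := lambda * _.
transitivity (\sum_i ((1 - lambda) * c * 1 - c * g i w - (1 - lambda) ^+ 2 * Rcor g i
    - (1 - lambda) * ucor g i + (1 - lambda) * (g i w * Rcor g i) + g i w * ucor g i)).
  by apply: eq_bigr => i _; ring.
rewrite !big_split /= !sumrN -!mulr_sumr s0 sR su -/(Tcor g w) -/(Qcor g w).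
by rewrite sumr_const card_ord /c; ring.
Qed.

Lemma sum_apat_col G i : G \in Ext H ->
  \sum_(v : 'I_n | (K <= v)%N) (apat G j i w v)%:R =
  (1 - lambda - dev G j w) * ((lambda + dev G i w) *
    ((1 - lambda) * (lambda * n' - row_dev j) + lambda * Rcor (dev G) i - ucor (dev G) i)).
Proof.
move=> GE; set g := dev G.
have e v : (apat G j i w v)%:R = (1 - lambda - g j w) *
    ((lambda + g i w) * (((1 - lambda) * (lambda + g j v) - lambda * g i v) - g j v * g i v)).
  by rewrite /g /deviation /apat; do 4!case: (_ \in G) => /=; ring.
under eq_bigr do rewrite e.
rewrite -!mulr_sumr; congr (_ * (_ * _)).
have cn : \sum_(v : 'I_n | (K <= v)%N) (1 : R) = n'.
  by rewrite sum_ord_ge ?mulr1// (rg_Kn rg).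
transitivity (\sum_(v : 'I_n | (K <= v)%N) ((1 - lambda) * lambda * 1 + (1 - lambda) * g j v - lambda * g i v - g j v * g i v)).
  by apply: eq_bigr => v _; ring.
rewrite !sumrB big_split /= -!mulr_sumr cn !sum_col_tail// (rowdevE GE jJ) -/(ucor g i) -/(Rcor g i).
by ring.
Qed.

Lemma sum_apat G : G \in Ext H ->
  \sum_i \sum_(v : 'I_n | (K <= v)%N) (apat G j i w v)%:R =
  (1 - lambda - dev G j w) * (lambda * (1 - lambda) * m%:R * (lambda * n' - row_dev j) +
     lambda * Tcor (dev G) w - Qcor (dev G) w).
Proof.
move=> GE; under eq_bigr do rewrite sum_apat_col//.
set g := dev G; rewrite -mulr_sumr; congr (_ * _).
have GB := ext_Bst GE.
have s0 : \sum_i g i w = 0 by exact: (@col_sum_dev R _ _ _ _ _ w (rg_n0 rg) (rg_e rg) GB).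
have sR : \sum_i Rcor g i = 0.
  rewrite /Rcor exchange_big big1//= => k _; exact: (@col_sum_dev R _ _ _ _ _ k (rg_n0 rg) (rg_e rg) GB).
have su : \sum_i ucor g i = 0.
  rewrite /ucor exchange_big big1//= => v _; rewrite -mulr_sumr.
  by rewrite (@col_sum_dev R _ _ _ _ _ v (rg_n0 rg) (rg_e rg) GB) mulr0.
set c := (1 - lambda) * _.
transitivity (\sum_i (lambda * c * 1 + c * g i w + lambda ^+ 2 * Rcor g i
    - lambda * ucor g i + lambda * (g i w * Rcor g i) - g i w * ucor g i)).
  by apply: eq_bigr => i _; ring.
rewrite !big_split /= !sumrN -!mulr_sumr s0 sR su -/(Tcor g w) -/(Qcor g w).
by rewrite sumr_const card_ord /c; ring.
Qed.

(* Equating the two ways of counting switches at the entry [(j, w)]. The main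
   terms combine to the exact factor [lambda (1 - lambda) m n'], and all
   dependence on other entries is through [Qcor] and [Tcor]. *)
Lemma switching_identity f :
  lambda * (1 - lambda) * m%:R * E (fun G => f G * (n' * dev G j w + row_dev j)) =
  change f - E (fun G => f G * (Qcor (dev G) w + dev G j w * Tcor (dev G) w)).
Proof.
have key : E (fun G => (\sum_i \sum_(v : 'I_n | (K <= v)%N) (dpat G j i w v)%:R) * f G) =
    change f + E (fun G => (\sum_i \sum_(v : 'I_n | (K <= v)%N) (apat G j i w v)%:R) * f G).
  rewrite /change -avgD.
  transitivity (\sum_i \sum_(v : 'I_n | (K <= v)%N) E (fun G => (dpat G j i w v)%:R * f G)).
    under [RHS]eq_bigr do rewrite -avg_sum.
    rewrite -avg_sum; apply: eq_avg => G _; rewrite mulr_suml; apply: eq_bigr => i _.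
    by rewrite mulr_suml.
  transitivity (\sum_i \sum_(v : 'I_n | (K <= v)%N)
      E (fun G => (apat G j i w v)%:R * f (switch j i w v @^-1: G))).
    by apply: eq_bigr => i _; apply: eq_bigr => v vK; exact: ext_switch_avg.
  under eq_bigr do rewrite -avg_sum.
  rewrite -avg_sum; apply: eq_avg => G _; rewrite mulr_suml -big_split; apply: eq_bigr => i _ /=.
  rewrite mulr_suml -big_split; apply: eq_bigr => v _ /=; ring.
have -> : change f = E (fun G => (\sum_i \sum_(v : 'I_n | (K <= v)%N) (dpat G j i w v)%:R) * f G) -
    E (fun G => (\sum_i \sum_(v : 'I_n | (K <= v)%N) (apat G j i w v)%:R) * f G) by rewrite key addrK.
rewrite -avgZ -!avgB; apply: eq_avg => G GE; rewrite sum_dpat// sum_apat//; ring.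
Qed.

End Switching.
End Exchange.

Lemma norm2_le_sqrt {R : realType} {I : finType} (v : I -> R) :
  (forall i, `|v i| <= 1) -> norm2 v <= Num.sqrt #|I|%:R.
Proof.
move=> v1; have := norm2_set (R := R) [set: I]; rewrite cardsT => <-.
by apply: le_norm2 => i; rewrite inE normr1.
Qed.

(** * Correlations of two entries *)

Section PairCorrelations.
Context {R : realType} {L h : R} {m n s t J K l : nat}.
Hypothesis rg : regime L h m n s t J K l.
Variable H : bgraph m n.
Hypothesis HB : H \subset block J K.
Local Notation lambda := (lam R n s).
Local Notation Ext := (@extensions m n s t J K).
Local Notation dev := (@deviation R m n s).
Local Notation Bo := (isO L h).
Local Notation E := (avg (Ext H)).
Local Notation opb := (@opbound R L h m n s).
Local Notation m' := (m%:R - J%:R : R).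
Local Notation n' := (n%:R - K%:R : R).
Local Notation rowdev := (@row_dev R m n s K H).
Let sc := rg_sc rg.
Let nE : Ext H != set0. Proof. exact: (ext_neq0 rg HB). Qed.

(** The bilinear bound is tested against the image vector itself and divided by its norm. *)
Lemma row_operator G (v : 'I_n -> R) :
  norm2 (fun i => \sum_w dev G i w * v w) <= opb G * norm2 v.
Proof.
set u := fun i => _; have := opboundP rg G u v.
rewrite (eq_bigr (fun i => u i ^+ 2)); last by move=> i _; rewrite expr2.
rewrite -sqr_norm2 ger0_norm ?sqr_ge0// => hu.
have [->|u0] := eqVneq (norm2 u) 0; first by rewrite mulr_ge0 ?norm2_ge0// (opbound_ge0 rg).
have up : 0 < norm2 u by rewrite lt_def u0 norm2_ge0.
by rewrite -(ler_pM2r up) -expr2 mulrAC.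
Qed.

Lemma col_operator G (u : 'I_m -> R) :
  norm2 (fun w => \sum_i dev G i w * u i) <= opb G * norm2 u.
Proof.
set v := fun w => _; have := opboundP rg G u v.
rewrite (_ : \sum_i _ = \sum_w v w ^+ 2); last first.
  transitivity (\sum_i \sum_w dev G i w * u i * v w).
    by apply: eq_bigr => i _; rewrite mulr_sumr; apply: eq_bigr => w _; rewrite mulrA (mulrC (u i)).
  by rewrite exchange_big; apply: eq_bigr => w _; rewrite -mulr_suml expr2.
rewrite -sqr_norm2 ger0_norm ?sqr_ge0// => hv.
have [->|v0] := eqVneq (norm2 v) 0; first by rewrite mulr_ge0 ?norm2_ge0// (opbound_ge0 rg).
have vp : 0 < norm2 v by rewrite lt_def v0 norm2_ge0.
by rewrite -(ler_pM2r vp) -expr2.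
Qed.

Lemma ucor_norm G j : norm2 (ucor (K := K) j (dev G)) <= opb G * Num.sqrt n%:R.
Proof.
have -> : ucor (K := K) j (dev G) = fun i => \sum_w dev G i w * (if (K <= w)%N then dev G j w else 0).
  apply/funext => i; rewrite /ucor big_mkcond; apply: eq_bigr => w _.
  by case: ifP => _; rewrite ?mulr0 1?mulrC.
apply: le_trans (row_operator _ _) _; apply: ler_wpM2l; first exact: (opbound_ge0 rg).
rewrite -[X in Num.sqrt X%:R](card_ord n); apply: norm2_le_sqrt => w.
by case: ifP => _; rewrite ?normr0// (rg_dev1 rg).
Qed.

Lemma Rcor_norm G : norm2 (Rcor (K := K) (dev G)) <= opb G * Num.sqrt n%:R.
Proof.
have -> : Rcor (K := K) (dev G) = fun i => \sum_w dev G i w * (if (w < K)%N then 1 else 0).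
  apply/funext => i; rewrite /Rcor big_mkcond; apply: eq_bigr => w _.
  by case: ifP => _; rewrite ?mulr0 ?mulr1.
apply: le_trans (row_operator _ _) _; apply: ler_wpM2l; first exact: (opbound_ge0 rg).
rewrite -[X in Num.sqrt X%:R](card_ord n); apply: norm2_le_sqrt => w.
by case: ifP => _; rewrite ?normr0 ?normr1.
Qed.

Lemma sqr_operator_bound G (u : 'I_m -> R) : norm2 u <= opb G * Num.sqrt n%:R ->
  \sum_w (\sum_i dev G i w * u i) ^+ 2 <= n%:R * opb G ^+ 4.
Proof.
move=> hu; rewrite -sqr_norm2; have p0 := opbound_ge0 rg G.
have h1 : norm2 (fun w => \sum_i dev G i w * u i) <= opb G * (opb G * Num.sqrt n%:R).
  by apply: le_trans (col_operator _ _) _; apply: ler_wpM2l.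
apply: (@le_trans _ _ ((opb G * (opb G * Num.sqrt n%:R)) ^+ 2)).
  by apply: lerXn2r; rewrite ?nnegrE ?norm2_ge0// !mulr_ge0 ?sqrtr_ge0.
have -> : (opb G * (opb G * Num.sqrt n%:R)) ^+ 2 = Num.sqrt n%:R ^+ 2 * opb G ^+ 4 by ring.
by rewrite sqr_sqrtr.
Qed.

(** Exchangeability replaces the second moment at one outer column by the mean over all of them, so
    an operator norm bound for the whole vector becomes a bound for a single coordinate. The order 2
    of [C] cancels against [n']. *)
Lemma E_sum_sqr (F : ('I_m -> 'I_n -> R) -> 'I_n -> R) (w : 'I_n) (a c : nat) (C : R) :
  (K <= w)%N ->
  (forall g (w w' : 'I_n), (K <= w)%N -> (K <= w')%N ->
     F (fun i v => g i (tperm w w' v)) w' = F g w) ->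
  (forall G, G \in Ext H -> \sum_w F (dev G) w ^+ 2 <= C * opb G ^+ a) -> (a <= 4)%N ->
  Bo c 2 C -> Bo (c + (10 * a).+1 + 1) a (E (fun G => F (dev G) w ^+ 2)).
Proof.
move=> wK hF hC a4 hc; have [n0 hn] := Bo_n'V rg.
have e := exch_col rg HB (F := fun g w => F g w ^+ 2) wK.
have {}e := e (fun g w1 w2 h1 h2 => congr1 (fun x => x ^+ 2) (hF g w1 w2 h1 h2)).
have -> : E (fun G => F (dev G) w ^+ 2) = n' * E (fun G => F (dev G) w ^+ 2) * n'^-1.
  by rewrite mulrAC divff ?mul1r// gt_eqF.
rewrite e (_ : (a : int) = 2 + a%:Z + -2); last by lia.
apply: (BoM sc) hn.
apply: (@Bo_le _ _ _ _ _ _ (C * E (fun G => opb G ^+ a))); last first.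
  by apply: (BoM sc) => //; exact: (opbound_moment rg).
rewrite -avgZ; apply: le_trans (ler_norm_avg _ _) _; apply: ler_avg => G GE.
rewrite ger0_norm; last by apply: sumr_ge0 => v _; exact: sqr_ge0.
apply: le_trans (hC _ GE); rewrite [leRHS](bigID (fun v : 'I_n => (K <= v)%N)) /= lerDl.
by apply: sumr_ge0 => v _; exact: sqr_ge0.
Qed.

Lemma tperm_ge (w w' v : 'I_n) : (K <= w)%N -> (K <= w')%N ->
  (K <= tperm w w' v)%N = (K <= v)%N.
Proof. by move=> wK w'K; case: tpermP => [->|->|//]; rewrite wK w'K. Qed.

Lemma E_Qcor_sqr (j : 'I_m) (w : 'I_n) : (K <= w)%N ->
  Bo 44 4 (E (fun G => Qcor (K := K) j (dev G) w ^+ 2)).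
Proof.
move=> wK; apply: (@Bo_weak _ _ _ sc (1 + (10 * 4).+1 + 1) 4) => //.
apply: (E_sum_sqr (F := Qcor (K := K) j) (C := n%:R)) => //.
- move=> g w1 w2 h1 h2; apply: eq_bigr => i _; rewrite tpermR; congr (_ * _).
  rewrite /ucor [RHS](reindex_inj (@perm_inj _ (tperm w1 w2))) /=.
  by apply: eq_bigl => v; rewrite tperm_ge.
- by move=> G _; apply: sqr_operator_bound; exact: ucor_norm.
- exact: (Bo_n rg).
Qed.

Lemma E_Tcor_sqr (w : 'I_n) : (K <= w)%N ->
  Bo 44 4 (E (fun G => Tcor (K := K) (dev G) w ^+ 2)).
Proof.
move=> wK; apply: (@Bo_weak _ _ _ sc (1 + (10 * 4).+1 + 1) 4) => //.
apply: (E_sum_sqr (F := Tcor (K := K)) (C := n%:R)) => //.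
- move=> g w1 w2 h1 h2; apply: eq_bigr => i _; rewrite tpermR; congr (_ * _).
  apply: eq_bigr => k kK; rewrite tpermD// neq_ltn; apply/orP; right.
    exact: leq_trans kK _.
  exact: leq_trans kK _.
- by move=> G _; apply: sqr_operator_bound; exact: Rcor_norm.
- exact: (Bo_n rg).
Qed.

Lemma E_weight_error (f : bgraph m n -> R) (j : 'I_m) (w : 'I_n) (c : nat) (k : int) :
  (K <= w)%N -> Bo (2 * c) (2 * k) (E (fun G => f G ^+ 2)) ->
  Bo (c + 22).+1 (k + 2) (E (fun G => f G * (Qcor (K := K) j (dev G) w + dev G j w * Tcor (K := K) (dev G) w))).
Proof.
move=> wK hf; under eq_avg => G _ do rewrite mulrDr.
rewrite avgD; apply: (BoD sc).
  by apply: (Bo_avgM sc) => //; exact: E_Qcor_sqr.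
rewrite (eq_avg (f' := fun G => (f G * dev G j w) * Tcor (K := K) (dev G) w)); last first.
  by move=> G _; rewrite mulrA.
apply: (Bo_avgM sc); last exact: E_Tcor_sqr.
apply: (Bo_le _ hf); rewrite ger0_norm; last by apply: avg_ge0 => G _; exact: sqr_ge0.
apply: ler_avg => G _; rewrite exprMn ler_piMr ?sqr_ge0//.
rewrite -(real_normK (num_real _)); apply: exprn_ile1 => //; exact: (rg_dev1 rg).
Qed.

(** By [E_jw] the second factor has mean zero, so this bounds a covariance. It has the size of [f]
    itself although the other factor carries [n']: dividing the switching identity by [m] gains
    [h^2]. *)
Lemma E_dev_test (f : bgraph m n -> R) (j : 'I_m) (w : 'I_n) (c c1 : nat) (k : int) :
  (j < J)%N -> (K <= w)%N -> Bo (2 * c) (2 * k) (E (fun G => f G ^+ 2)) ->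
  Bo c1 (k + 2) (change (s := s) (t := t) (J := J) (K := K) H j w f) ->
  Bo (maxn c1 (c + 23)).+2 k (E (fun G => f G * (n' * dev G j w + rowdev j))).
Proof.
move=> jJ wK hf hc; have e := switching_identity rg HB jJ wK f.
have [/andP[l0 l1]] := rg_lam01 rg.
have m0 : (m%:R : R) != 0 by rewrite pnatr_eq0 -lt0n (rg_m0 rg).
have ll : lambda * (1 - lambda) != 0 by rewrite gt_eqF// mulr_gt0// subr_gt0.
have -> : E (fun G => f G * (n' * dev G j w + rowdev j)) = (lambda * (1 - lambda) * m%:R *
   E (fun G => f G * (n' * dev G j w + rowdev j))) * (lambda * (1 - lambda))^-1 * m%:R^-1.
  by move: (avg _ _) => x; field; rewrite m0 subr_eq0 eq_sym (lt_eqF l1) (gt_eqF l0).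
rewrite e.
have h1 := Bo_weak sc hc (leq_maxl c1 (c + 23)) (lexx _).
have h2 : Bo (maxn c1 (c + 23)) (k + 2)
    (E (fun G => f G * (Qcor (K := K) j (dev G) w + dev G j w * Tcor (K := K) (dev G) w))).
  by apply: (Bo_weak sc (E_weight_error j wK hf)) => //; rewrite -addnS leq_maxr.
by apply: (Bo_weak sc (BoM sc (BoM sc (BoB sc h1 h2) (Bo_lamV rg)) (Bo_mV rg))); rewrite ?addn0 ?addn1 ?addr0 ?addrK.
Qed.

(** The test function is the entry [(j', w)]. Only switches with [i = j'] change it, and there are
    at most [n] of these among all pairs of a row and a column. *)
Lemma pair_row (j j' : 'I_m) (w : 'I_n) : (j < J)%N -> (j' < J)%N -> j' != j -> (K <= w)%N ->
  Bo 28 (-2) (E (fun G => dev G j w * dev G j' w)).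
Proof.
move=> jJ j'J jj wK; have [n0 hn] := Bo_n'V rg.
have hf2 : Bo (2 * 0) (2 * 0) (E (fun G => dev G j' w ^+ 2)).
  by apply: Bo_avg => // G _; exact: (@BoX _ _ _ sc 0 0 _ 2 (Bo_dev rg G j' w)).
have hch : Bo 1 (0 + 2) (change (s := s) (t := t) (J := J) (K := K) H j w (fun G => dev G j' w)).
  apply: Bo_avg => // G _; apply: (@Bo_le _ _ _ _ _ _ n%:R); last exact: (Bo_n rg).
  rewrite (bigD1 j') //= [X in _ + X]big1 ?addr0; last first.
    move=> i ij; apply: big1 => v _.
    have -> : dev (switch j i w v @^-1: G) j' w = dev G j' w.
      by rewrite /deviation inE /switch /col_swap /= (negbTE jj) eq_sym (negbTE ij).
    by rewrite subrr mulr0.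
  apply: le_trans (ler_norm_sum _ _ _) _.
  apply: (@le_trans _ _ (\sum_(v : 'I_n | (K <= v)%N) 1)).
    apply: ler_sum => v _; rewrite normrM normr_nat mulr_ile1//; first by case: apat.
    rewrite /deviation (_ : forall a b c : R, a - c - (b - c) = a - b); last by move=> a b c; ring.
    by do 2!case: (_ \in _); rewrite /= ?subrr ?subr0 ?sub0r ?normrN ?normr0 ?normr1.
  by rewrite sum_ord_ge ?(rg_Kn rg)// mulr1 lerBlDr lerDl.
have hE := E_dev_test jJ wK hf2 hch.
have e : E (fun G => dev G j' w * (n' * dev G j w + rowdev j)) =
    n' * E (fun G => dev G j w * dev G j' w) - rowdev j * (rowdev j' / n').
  rewrite -[rowdev j * _]opprK -mulrN -(E_jw rg HB j'J wK) -!avgZ -avgN -avgB.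
  by apply: eq_avg => G _; rewrite opprK; ring.
have -> : E (fun G => dev G j w * dev G j' w) =
    (E (fun G => dev G j' w * (n' * dev G j w + rowdev j)) + rowdev j * (rowdev j' * n'^-1)) * n'^-1.
  by rewrite e; field; rewrite gt_eqF.
have hd := BoM sc (Bo_rowdev rg H j) (BoM sc (Bo_rowdev rg H j') hn).
have hs := BoD sc (Bo_weak sc hE (leqnn _) (lexx _)) (Bo_weak sc hd (_ : _ <= _)%N (_ : _ <= 0)).
by apply: (Bo_weak sc (BoM sc (hs _ _) hn)).
Qed.

(** Column [w] sums to zero. Against the entry [(j, w)] its outer part therefore yields minus the
    square of that entry, hence the main term [lambda (1 - lambda)], and at most [J] correlations
    bounded by [pair_row]. *)
Lemma pair_edge_row (j z : 'I_m) (w : 'I_n) : (j < J)%N -> (J <= z)%N -> (K <= w)%N ->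
  Bo 31 (-1) (m' * E (fun G => dev G j w * dev G z w) + lambda * (1 - lambda)).
Proof.
move=> jJ zJ wK; have [n0 hn] := Bo_n'V rg.
have jz : tperm z z j = j by rewrite tperm1 perm1.
rewrite (exch_row rg HB (F := fun g z => g j w * g z w))//; last first.
  move=> g z1 z2 h1 h2; rewrite tpermR tpermD// neq_ltn; apply/orP; right; exact: leq_trans jJ _.
have -> : E (fun G => \sum_(z : 'I_m | (J <= z)%N) dev G j w * dev G z w) =
   - E (fun G => dev G j w ^+ 2) - \sum_(j' : 'I_m | (j' < J)%N && (j' != j)) E (fun G => dev G j w * dev G j' w).
  rewrite -avg_sum -avgN -avgB; apply: eq_avg => G GE.
  rewrite -mulr_sumr (sum_row_tail rg HB)// (bigD1 j)//= mulrN mulrDr opprD mulr_sumr expr2.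
  by [].
rewrite (E_jw_sqr rg HB)//.
have -> (x y : R) : - (lambda * (1 - lambda) - x) - y + lambda * (1 - lambda) = x - y by ring.
have [/andP[l0 l1]] := rg_lam01 rg.
have h1 : Bo 0 0 (1 - 2 * lambda).
  by apply: (Bo1 sc); rewrite ler_norml; apply/andP; split; lra.
have h2 : Bo 30 (-1) ((1 - 2 * lambda) * (rowdev j / n')).
  exact: (Bo_weak sc (BoM sc h1 (BoM sc (Bo_rowdev rg H j) hn))).
apply: (BoB sc h2).
have hJ : Bo 1 1 #|(fun j' : 'I_m => (j' < J)%N && (j' != j))|%:R.
  apply: (@Bo_le _ _ _ _ _ _ J%:R); last exact: (Bo_J rg).
  rewrite ger0_norm// ler_nat -[X in (_ <= X)%N](card_ord_lt (rg_Jm rg)).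
  by apply: subset_leq_card; apply/subsetP => j'; rewrite inE => /andP[].
by apply: (Bo_weak sc (Bo_sum sc hJ (c := 28) (k := -2) _)) => // j' /andP[j'J j'j]; exact: pair_row.
Qed.

End PairCorrelations.

(** * The path of three entries *)

Section TripleCorrelation.
Context {R : realType} {L h : R} {m n s t J K l : nat}.
Hypothesis rg : regime L h m n s t J K l.
Variable H : bgraph m n.
Hypothesis HB : H \subset block J K.
Local Notation lambda := (lam R n s).
Local Notation Ext := (@extensions m n s t J K).
Local Notation dev := (@deviation R m n s).
Local Notation Bo := (isO L h).
Local Notation E := (avg (Ext H)).
Local Notation opb := (@opbound R L h m n s).
Local Notation m' := (m%:R - J%:R : R).
Local Notation n' := (n%:R - K%:R : R).
Local Notation rowdev := (@row_dev R m n s K H).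
Let sc := rg_sc rg.
Let nE : Ext H != set0. Proof. exact: (ext_neq0 rg HB). Qed.

Definition col_dev k : R := \sum_(j : 'I_m | (j < J)%N) dev H j k.

Lemma rowdev_transpose k : @row_dev R n m t J (transpose H) k = col_dev k.
Proof.
apply: eq_bigr => j _; rewrite /deviation in_transpose (@lam_transpose R m n s t) ?(rg_m0 rg) ?(rg_n0 rg)//.
exact: (rg_e rg).
Qed.

Lemma E_transpose (f : ('I_m -> 'I_n -> R) -> R) :
  avg (extensions t s K J (transpose H)) (fun G => f (fun i w => deviation t G w i)) = E (fun G => f (dev G)).
Proof. by apply: avg_transpose => //; [exact: rg_m0 rg|exact: rg_n0 rg|exact: rg_e rg]. Qed.

Lemma E_zk (z : 'I_m) (k : 'I_n) : (J <= z)%N -> (k < K)%N -> E (fun G => dev G z k) = - (col_dev k / m').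
Proof.
move=> zJ kK; have HT := transpose_block HB; have rgT := regime_transpose rg.
by rewrite -(E_transpose (fun g => g z k)) (E_jw rgT HT kK zJ) rowdev_transpose.
Qed.

Lemma E_zw (z : 'I_m) (w : 'I_n) : (J <= z)%N -> (K <= w)%N ->
  E (fun G => dev G z w) = (\sum_(j : 'I_m | (j < J)%N) rowdev j) / (m' * n').
Proof.
move=> zJ wK; have [n0 _] := Bo_n'V rg; have [m0 _] := Bo_m'V rg.
apply: (mulfI (x := m')); first by rewrite gt_eqF.
rewrite (exch_row rg HB (F := fun g z => g z w))//; last by move=> g z1 z2 _ _; rewrite tpermR.
rewrite (eq_avg (f' := fun G => - \sum_(j : 'I_m | (j < J)%N) dev G j w)); last first.
  by move=> G GE; exact: (sum_row_tail rg HB).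
rewrite avgN avg_sum (eq_bigr (fun j => - (rowdev j / n'))); last by move=> j jJ; exact: (E_jw rg HB).
rewrite sumrN opprK -mulr_suml; field; by rewrite !gt_eqF.
Qed.

(** The two entries share neither row nor column, so exchangeability alone gives an exact value. *)
Lemma E_jw_zk (j z : 'I_m) (k w : 'I_n) : (j < J)%N -> (J <= z)%N -> (k < K)%N -> (K <= w)%N ->
  E (fun G => dev G j w * dev G z k) = (rowdev j / n') * (col_dev k / m').
Proof.
move=> jJ zJ kK wK; have [n0 _] := Bo_n'V rg.
apply: (mulfI (x := n')); first by rewrite gt_eqF.
rewrite (exch_col rg HB (F := fun g w => g j w * g z k))//; last first.
  move=> g w1 w2 h1 h2; rewrite tpermR tpermD// neq_ltn; apply/orP; right; exact: leq_trans kK _.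
rewrite (eq_avg (f' := fun G => - rowdev j * dev G z k)); last first.
  by move=> G GE; rewrite -mulr_suml (sum_col_tail rg HB)// (rowdevE HB GE).
have [m0 _] := Bo_m'V rg; rewrite avgZ E_zk//; field; by rewrite !gt_eqF.
Qed.

Lemma pair_edge_col (z : 'I_m) (k w : 'I_n) : (J <= z)%N -> (k < K)%N -> (K <= w)%N ->
  Bo 31 (-1) (n' * E (fun G => dev G z k * dev G z w) + lambda * (1 - lambda)).
Proof.
move=> zJ kK wK; have HT := transpose_block HB; have rgT := regime_transpose rg.
have := pair_edge_row rgT HT kK wK zJ.
rewrite (E_transpose (fun g => g z k * g z w)).
by rewrite (@lam_transpose R m n s t) ?(rg_m0 rg) ?(rg_n0 rg)// (rg_e rg).
Qed.

Lemma Bo_lam : [/\ Bo 0 0 lambda, Bo 0 0 (1 - lambda) & Bo 0 0 (lambda * (1 - lambda))].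
Proof.
have [/andP[l0 l1]] := rg_lam01 rg.
have a1 : Bo 0 0 lambda by apply: (Bo1 sc); rewrite ger0_norm ltW.
have a2 : Bo 0 0 (1 - lambda) by apply: (Bo1 sc); rewrite ger0_norm; lra.
by split=> //; exact: (BoM sc a1 a2).
Qed.

Lemma Bo_pair_edge_col (z : 'I_m) (k w : 'I_n) : (J <= z)%N -> (k < K)%N -> (K <= w)%N ->
  Bo 33 (-2) (E (fun G => dev G z k * dev G z w)).
Proof.
move=> zJ kK wK; have [n0 hn] := Bo_n'V rg; have [_ _ hl] := Bo_lam.
have h1 := Bo_weak sc (pair_edge_col zJ kK wK) (leqnn _) (isT : -1 <= 0 :> int).
have h2 := BoB sc h1 (Bo_weak sc hl (isT : (0 <= 31)%N) (lexx _)).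
by have := BoM sc h2 hn; rewrite addrK mulrAC divff ?mul1r// gt_eqF.
Qed.

Section Triple.
Variables (j z : 'I_m) (k w : 'I_n).
Hypotheses (jJ : (j < J)%N) (zJ : (J <= z)%N) (kK : (k < K)%N) (wK : (K <= w)%N).

Definition Fcor (g : 'I_m -> 'I_n -> R) w := \sum_(i : 'I_m | (J <= i)%N) g i k * g i w.

Lemma sqrt_scale_le (N : R) : N <= L * h ^+ 2 -> Num.sqrt N <= L * h.
Proof.
move=> hN; have L0 := rg_L0 rg; have h0 := rg_h0 rg; have L2 := rg_L2 rg.
rewrite -[leRHS]ger0_norm ?mulr_ge0 ?(ltW L0) ?(ltW h0)// -sqrtr_sqr; apply: ler_wsqrtr.
apply: le_trans hN _; rewrite exprMn.
by apply: ler_wpM2r; [rewrite exprn_ge0// ltW|rewrite expr2 ler_peMl ?ltW//; lra].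
Qed.

(** [Fcor] is the transposed deviation matrix applied to a vector of norm at most the square root of
    [m]; its typical size is [h], where the trivial bound is [h^2]. *)
Lemma E_Fcor_sqr : Bo (2 * 12) (2 * 1) (E (fun G => Fcor (dev G) w ^+ 2)).
Proof.
apply: (@Bo_weak _ _ _ sc (1 + (10 * 2).+1 + 1) 2) => //.
apply: (E_sum_sqr rg HB (F := Fcor) (C := m%:R)) => //; last exact: (Bo_m rg).
  move=> g w1 w2 h1 h2; apply: eq_bigr => i _; rewrite tpermR tpermD// neq_ltn; apply/orP; right.
    exact: leq_trans kK _.
  exact: leq_trans kK _.
move=> G GE; pose u (i : 'I_m) := if (J <= i)%N then dev G i k else 0.
have -> : \sum_w0 Fcor (dev G) w0 ^+ 2 = norm2 (fun w0 => \sum_i dev G i w0 * u i) ^+ 2.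
  rewrite sqr_norm2; apply: eq_bigr => w0 _; congr (_ ^+ 2); rewrite /Fcor big_mkcond.
  by apply: eq_bigr => i _; rewrite /u; case: ifP => _; rewrite ?mulr0 1?mulrC.
have nu : norm2 u <= Num.sqrt m%:R.
  rewrite -[X in Num.sqrt X%:R](card_ord m); apply: norm2_le_sqrt => i; rewrite /u.
  by case: ifP => _; rewrite ?normr0// (rg_dev1 rg).
have p0 := opbound_ge0 rg G.
apply: (@le_trans _ _ ((opb G * Num.sqrt m%:R) ^+ 2)).
  apply: lerXn2r; rewrite ?nnegrE ?norm2_ge0// ?mulr_ge0 ?sqrtr_ge0//.
  by apply: le_trans (col_operator rg _ _) _; apply: ler_wpM2l.
by rewrite exprMn sqr_sqrtr// mulrC.
Qed.

(** Row [j] lies in the block and does not occur in [Fcor], so a switch is felt only at [(i, w)],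
    which turns from an edge into a non-edge. *)
Lemma Fcor_switch G i v : apat G j i w v -> (K <= v)%N ->
  Fcor (dev (switch j i w v @^-1: G)) w - Fcor (dev G) w = - ((J <= i)%N%:R * dev G i k).
Proof.
move=> hp vK; have ij : j != i by case/and4P: hp => h1 _ h3 _; apply: contraNneq h1 => ->.
have [_ _ hw _] := in_switch w v G ij.
have kw : k != w by rewrite neq_ltn; apply/orP; left; exact: leq_trans kK _.
have kv : k != v by rewrite neq_ltn; apply/orP; left; exact: leq_trans kK _.
have dk i' : dev (switch j i w v @^-1: G) i' k = dev G i' k.
  rewrite /deviation inE /switch /col_swap /=; case: ifP => // _.
  by rewrite tpermD// eq_sym.
have dw (i' : 'I_m) : (J <= i')%N -> i' != i -> dev (switch j i w v @^-1: G) i' w = dev G i' w.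
  move=> i'J i'i; rewrite /deviation inE /switch /col_swap /= (negbTE i'i) orbF.
  case: eqP => // e; move: i'J; rewrite e leqNgt.
  by rewrite jJ.
rewrite /Fcor -sumrB; have [iJ|iJ] := boolP (J <= i)%N.
  rewrite (bigD1 i)//= big1 ?addr0 => [|i' /andP[i'J i'i]]; last by rewrite dk dw// subrr.
  rewrite dk /deviation hw; case/and4P: hp => _ _ -> /negbTE -> /=; ring.
rewrite mul0r oppr0; apply: big1 => i' i'J; rewrite dk dw ?subrr//.
by apply: contraNneq iJ => <-.
Qed.

(** Counting switches gives only order [h^4]. In the main part, of weight [C0], the sum of
    [(lambda + g i w) * g i k] over outer rows reduces to a block column sum and [Fcor], both of
    order [h]; the remainder consists of 1-norms of [Rcor] and [ucor], of order [h^3]. *)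
Lemma change_Fcor : Bo 16 3 (change (s := s) (t := t) (J := J) (K := K) H j w (fun G => Fcor (dev G) w)).
Proof.
have [n0 _] := Bo_n'V rg; have L0 := rg_L0 rg; have h0 := rg_h0 rg.
have [/andP[l0 l1]] := rg_lam01 rg.
have [bl bl1 _] := Bo_lam.
pose C0 := (1 - lambda) * (lambda * n' - rowdev j).
have hC0 : Bo 2 2 C0.
  have hn' : Bo 1 2 n'.
    by apply: (Bo_le _ (Bo_n rg)); rewrite gtr0_norm// lerBlDr lerDl.
  have hr := Bo_weak sc (Bo_rowdev rg H j) (leqnn _) (isT : 1 <= 2 :> int).
  exact: (BoM sc bl1 (BoB sc (BoM sc bl hn') hr)).
pose Y G := `|C0| * (J%:R + `|Fcor (dev G) w|) + 2 * (L * h) * (L * h) * opb G.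
apply: (@Bo_le _ _ _ _ _ _ (E Y)).
  apply: le_trans (ler_norm_avg _ _) _; apply: ler_avg => G GE.
  pose a := 1 - lambda - dev G j w.
  have a1 : `|a| <= 1.
    rewrite /a /deviation (_ : forall x y : R, 1 - y - (x - y) = 1 - x); last by move=> x y; ring.
    by case: (_ \in G); rewrite /= ?subrr ?normr0 ?subr0 ?normr1.
  have -> : \sum_i \sum_(v : 'I_n | (K <= v)%N) (apat G j i w v)%:R *
      (Fcor (dev (switch j i w v @^-1: G)) w - Fcor (dev G) w) =
    - a * (C0 * (\sum_(i : 'I_m | (J <= i)%N) (lambda + dev G i w) * dev G i k) +
      \sum_(i : 'I_m | (J <= i)%N) (lambda + dev G i w) * dev G i k *
         (lambda * Rcor (K := K) (dev G) i - ucor (K := K) j (dev G) i)).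
    transitivity (\sum_(i : 'I_m) (- ((J <= i)%N%:R * dev G i k)) *
       (\sum_(v : 'I_n | (K <= v)%N) (apat G j i w v)%:R)).
      apply: eq_bigr => i _; rewrite mulr_sumr; apply: eq_bigr => v vK.
      case: (boolP (apat G j i w v)) => hp; first by rewrite Fcor_switch// mul1r mulr1.
      by rewrite mul0r mulr0.
    under eq_bigr do rewrite (sum_apat_col rg HB w jJ)//.
    rewrite mulr_sumr -big_split /= mulr_sumr [RHS]big_mkcond; apply: eq_bigr => i _.
    by case: ifP => _; rewrite /a /C0 ?mul0r ?mul1r; ring.
  rewrite normrM normrN; apply: (@le_trans _ _ (1 * `|C0 * (\sum_(i : 'I_m | (J <= i)%N) (lambda + dev G i w) * dev G i k) +
      \sum_(i : 'I_m | (J <= i)%N) (lambda + dev G i w) * dev G i k *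
         (lambda * Rcor (K := K) (dev G) i - ucor (K := K) j (dev G) i)|)).
    by apply: ler_wpM2r.
  rewrite mul1r; apply: le_trans (ler_normD _ _) _; apply: lerD.
    rewrite normrM; apply: ler_wpM2l => //.
    have -> : \sum_(i : 'I_m | (J <= i)%N) (lambda + dev G i w) * dev G i k =
        lambda * (- \sum_(j : 'I_m | (j < J)%N) dev G j k) + Fcor (dev G) w.
      rewrite -(sum_row_tail rg HB)// mulr_sumr -big_split; apply: eq_bigr => i _ /=; ring.
    apply: le_trans (ler_normD _ _) _; apply: lerD => //.
    rewrite normrM normrN (gtr0_norm l0) -[leRHS]mul1r; apply: ler_pM => //; first exact: ltW.
      exact: ltW.
    apply: le_trans (ler_norm_sum _ _ _) _; rewrite -[leRHS]mulr1 -(sum_ord_lt 1 (rg_Jm rg)).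
    by apply: ler_sum => i _; exact: (rg_dev1 rg).
  apply: le_trans (ler_norm_sum _ _ _) _.
  apply: (@le_trans _ _ (\sum_i (`|Rcor (K := K) (dev G) i| + `|ucor (K := K) j (dev G) i|))).
    rewrite [leLHS]big_mkcond; apply: ler_sum => i _; case: ifP => _; last by rewrite addr_ge0.
    rewrite -ind_dev normrM -[leRHS]mul1r; apply: ler_pM => //.
      rewrite normrM mulr_ile1 ?(rg_dev1 rg)//.
      by case: (_ \in G); rewrite /= ?normr0 ?normr1.
    apply: le_trans (ler_normB _ _) _; apply: lerD => //; rewrite normrM (gtr0_norm l0) ler_piMl//; exact: ltW.
  rewrite big_split /=.
  have p0 := opbound_ge0 rg G.
  have sm : 0 <= Num.sqrt m%:R :> R by exact: sqrtr_ge0.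
  have sm' : Num.sqrt m%:R <= L * h by apply: sqrt_scale_le; case/andP: (rg_m rg).
  have sn : Num.sqrt n%:R <= L * h by apply: sqrt_scale_le; case/andP: (rg_n rg).
  have bnd (x : 'I_m -> R) : norm2 x <= opb G * Num.sqrt n%:R -> \sum_i `|x i| <= L * h * (L * h) * opb G.
    move=> hx; apply: le_trans (sum_abs_le _) _; rewrite card_ord -mulrA.
    apply: ler_pM => //; first exact: norm2_ge0.
    by apply: le_trans hx _; rewrite mulrC; apply: ler_wpM2r.
  have b1 := bnd _ (Rcor_norm rg G); have b2 := bnd _ (ucor_norm rg G j).
  have -> : 2 * (L * h) * (L * h) * opb G = L * h * (L * h) * opb G + L * h * (L * h) * opb G by ring.
  exact: lerD b1 b2.
rewrite /Y avgD 2!avgZ avgD (avg_const _ nE).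
have hLh : Bo 1 1 (L * h) by rewrite /isO expr1 expr1z ger0_norm// mulr_ge0 ?(ltW L0) ?(ltW h0).
have h2 : Bo 1 0 (2 : R) by apply: (Bo_const sc); rewrite normr_nat expr1.
have hp := opbound_moment rg HB (isT : (1 <= 4)%N).
rewrite (_ : avg _ (fun G => opb G) = E (fun G => opb G ^+ 1)); last by apply: eq_avg.
have t2 := BoM sc (BoM sc (BoM sc h2 hLh) hLh) hp.
have hF : Bo (12 + 0) (1 + 0) (E (fun G => `|Fcor (dev G) w|)).
  rewrite (eq_avg (f' := fun G => `|Fcor (dev G) w| * 1)); last by move=> G _; rewrite mulr1.
  apply: (Bo_avgM sc).
    rewrite (eq_avg (f' := fun G => Fcor (dev G) w ^+ 2)); first exact: E_Fcor_sqr.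
    by move=> G _; rewrite real_normK ?num_real.
  rewrite expr1n avg_const//; apply: (Bo1 sc); by rewrite normr1.
have t1 := BoM sc (Bo_norm hC0) (BoD sc (Bo_weak sc (Bo_J rg) (isT : (1 <= 12 + 0)%N) (lexx _)) hF).
by apply: (@BoD _ _ _ sc 15 3); [exact: t1|exact: (Bo_weak sc t2)].
Qed.

(* The switching identity is applied to a sum over all rows outside the block,
   which a single switch changes only by [O(1)]. *)
Lemma triple : Bo 40 (-3) (E (fun G => dev G j w * (dev G z k * dev G z w))).
Proof.
have [n0 hn] := Bo_n'V rg; have [m0 hm] := Bo_m'V rg.
have hE := E_dev_test rg HB jJ wK E_Fcor_sqr change_Fcor.
have eF : m' * E (fun G => dev G z k * dev G z w) = E (fun G => Fcor (dev G) w).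
  rewrite (exch_row rg HB (F := fun g z => g z k * g z w))//.
  by move=> g z1 z2 h1 h2; rewrite tpermR.
have eT : m' * E (fun G => dev G j w * (dev G z k * dev G z w)) = E (fun G => dev G j w * Fcor (dev G) w).
  rewrite (exch_row rg HB (F := fun g z => g j w * (g z k * g z w)))//; last first.
    move=> g z1 z2 h1 h2; rewrite tpermR tpermD// neq_ltn; apply/orP; right; exact: leq_trans jJ _.
  by apply: eq_avg => G _; rewrite mulr_sumr.
have e : E (fun G => Fcor (dev G) w * (n' * dev G j w + rowdev j)) =
    n' * E (fun G => dev G j w * Fcor (dev G) w) + rowdev j * E (fun G => Fcor (dev G) w).
  by rewrite -!avgZ -avgD; apply: eq_avg => G _; ring.
have -> : E (fun G => dev G j w * (dev G z k * dev G z w)) =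
   (E (fun G => Fcor (dev G) w * (n' * dev G j w + rowdev j)) - rowdev j * E (fun G => Fcor (dev G) w)) * n'^-1 * m'^-1.
  by rewrite e -eT; field; rewrite !gt_eqF.
have hm' : Bo 1 2 m'.
  by apply: (Bo_le _ (Bo_m rg)); rewrite gtr0_norm// lerBlDr lerDl.
have hF := BoM sc hm' (Bo_pair_edge_col zJ kK wK); rewrite eF in hF.
have h1 := BoM sc (Bo_rowdev rg H j) hF.
have h1' : Bo 37 1 (rowdev j * E (fun G => Fcor (dev G) w)) by apply: (Bo_weak sc h1).
have h2 := BoB sc hE h1'.
exact: (BoM sc (BoM sc h2 hn) hm).
Qed.

End Triple.
End TripleCorrelation.

(** * Adding one edge to the prescribed subgraph *)

Section LogExpansion.
Context {R : realType} {L h : R}.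
Hypothesis sc : scales L h.
Local Notation Bo := (isO L h).

Lemma Bo_nat c (x : nat) : (x <= 2 ^ c)%N -> Bo c 0 x%:R.
Proof. by move=> hx; apply: (Bo_const sc); rewrite normr_nat -natrX ler_nat. Qed.

Lemma Bo_half : Bo 0 0 (2^-1 : R).
Proof. by apply: (Bo1 sc); rewrite normfV normr_nat invf_le1// ler1n. Qed.

(** With [s] of order [1/h] and [r] of order [1/h^2], only [s] contributes to the quadratic term at
    this precision. *)
Lemma ln_expansion (s r : R) : L ^+ 60 <= h -> Bo 50 (-1) s -> Bo 50 (-2) r ->
  `|s + r| <= 1 / 4 /\ Bo 157 (-3) (ln (1 + (s + r)) - (s + r - s ^+ 2 / 2)).
Proof.
move=> big hs hr; have hr' : Bo 50 (-1) r by apply: (Bo_weak sc hr).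
have hu := BoD sc hs hr'.
have [L2 h1] := sc; have L0 : 0 < L by lra. have h0 : 0 < h by lra.
have u4 : `|s + r| <= 1 / 4.
  apply: le_trans hu _; rewrite exprN1 ler_pdivrMr//.
  apply: (@le_trans _ _ (1 / 4 * L ^+ 60)); last by apply: ler_wpM2l => //; lra.
  rewrite (exprD L 9 51) mulrA ler_peMl ?exprn_ge0 ?(ltW L0)//.
  have : 2 ^+ 9 <= L ^+ 9 by apply: lerXn2r => //; rewrite nnegrE ltW.
  have : (4 : R) <= 2 ^+ 9 by rewrite -natrX ler_nat.
  by move=> h4 h5; have := le_trans h4 h5; move: (L ^+ 9) => x; lra.
split => //.
have hl : Bo 155 (-3) (ln (1 + (s + r)) - (s + r - (s + r) ^+ 2 / 2)).
  apply: (Bo_le (ln1D_taylor2 u4)).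
  have h3 : Bo 2 0 (3 : R) by exact: Bo_nat.
  have := BoM sc h3 (BoX sc 3 (Bo_norm hu)).
  by move=> hh; apply: (Bo_weak sc hh).
have e : ln (1 + (s + r)) - (s + r - s ^+ 2 / 2) =
   (ln (1 + (s + r)) - (s + r - (s + r) ^+ 2 / 2)) - (s * r + r ^+ 2 * 2^-1) by field.
rewrite e; apply: (Bo_weak sc (BoB sc hl (_ : Bo 155 (-3) _))) => //.
have hsr := BoM sc hs hr; have hrr := BoM sc (BoX sc 2 hr) Bo_half.
by apply: (Bo_weak sc (BoD sc (Bo_weak sc hsr (isT : (50 + 50 <= 100)%N) (isT : -1 - 2 <= -3 :> int))
  (Bo_weak sc hrr (isT : (50 * 2 + 0 <= 100)%N) (isT : -2 * 2 + 0 <= -3 :> int)))).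
Qed.

End LogExpansion.

Section Ratio.
Context {R : realType} {L h : R} {m n s t J K l : nat}.
Hypothesis rg : regime L h m n s t J K l.
Local Notation lambda := (lam R n s).
Local Notation Ext := (@extensions m n s t J K).
Local Notation dev := (@deviation R m n s).
Local Notation Bo := (isO L h).
Local Notation m' := (m%:R - J%:R : R).
Local Notation n' := (n%:R - K%:R : R).
Let sc := rg_sc rg.

(** Up to sign these are the means of the three outer entries: that of [(j, w)] is [- rho], that of
    [(z, k)] is [- zeta], that of [(z, w)] is [eta]. *)
Definition rho (H : bgraph m n) (j : 'I_m) : R := @row_dev R m n s K H j / n'.
Definition zeta (H : bgraph m n) (k : 'I_n) : R := @col_dev R m n s J H k / m'.
Definition eta (H : bgraph m n) : R := (\sum_(j : 'I_m | (j < J)%N) @row_dev R m n s K H j) / (m' * n').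

Lemma coldev_le H k : `|@col_dev R m n s J H k| <= J%:R.
Proof. by rewrite -(rowdev_transpose rg); exact: (rowdev_le (regime_transpose rg)). Qed.

Lemma Bo_coldev H k : Bo 1 1 (@col_dev R m n s J H k).
Proof. exact: (Bo_le (coldev_le H k) (Bo_J rg)). Qed.

Lemma Bo_total H : Bo 2 2 (\sum_(j : 'I_m | (j < J)%N) @row_dev R m n s K H j).
Proof.
have hJ : Bo 1 1 #|(fun j' : 'I_m => (j' < J)%N)|%:R.
  by rewrite -sumr_const big_mkcond -big_mkcond sum_ord_lt ?(rg_Jm rg)// mulr1; exact: (Bo_J rg).
exact: (Bo_sum sc hJ (fun j _ => Bo_rowdev rg H j)).
Qed.

Section Prob.
Variable H : bgraph m n.
Hypothesis HB : H \subset block J K.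
Variables (j z : 'I_m) (k w : 'I_n).
Hypotheses (jJ : (j < J)%N) (zJ : (J <= z)%N) (kK : (k < K)%N) (wK : (K <= w)%N).
Local Notation E := (avg (Ext H)).

Let nE : Ext H != set0. Proof. exact: (ext_neq0 rg HB). Qed.

(** The parameters cover both sides of the switching relation: [lambda, 1 - lambda, -1] for edge,
    edge, non-edge, and [- (1 - lambda), lambda, 1] for the opposite pattern, where the signs of the
    two non-edges cancel. *)
Lemma path_moments : exists e1 e2 e3 : R,
  [/\ Bo 31 (-1) e1, Bo 31 (-1) e2, Bo 40 (-3) e3 &
   forall x y v : R, E (fun G => (x + dev G j w) * (x + dev G z k) * (y + v * dev G z w)) =
     x ^+ 2 * y - x * y * (rho H j + zeta H k) + x ^+ 2 * v * eta H + y * (rho H j * zeta H k)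
     + x * v * ((e1 - lambda * (1 - lambda)) / m' + (e2 - lambda * (1 - lambda)) / n') + v * e3].
Proof.
have [n0 _] := Bo_n'V rg; have [m0 _] := Bo_m'V rg.
exists (m' * E (fun G => dev G j w * dev G z w) + lambda * (1 - lambda)),
  (n' * E (fun G => dev G z k * dev G z w) + lambda * (1 - lambda)),
  (E (fun G => dev G j w * (dev G z k * dev G z w))); split.
- exact: (pair_edge_row rg HB jJ zJ wK).
- exact: (pair_edge_col rg HB zJ kK wK).
- exact: (triple rg HB jJ zJ kK wK).
move=> x y v; rewrite !addrK.
have -> : E (fun G => (x + dev G j w) * (x + dev G z k) * (y + v * dev G z w)) =
  x ^+ 2 * y + x * y * E (fun G => dev G j w) + x * y * E (fun G => dev G z k) + x ^+ 2 * v * E (fun G => dev G z w)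
  + y * E (fun G => dev G j w * dev G z k) + x * v * E (fun G => dev G j w * dev G z w)
  + x * v * E (fun G => dev G z k * dev G z w) + v * E (fun G => dev G j w * (dev G z k * dev G z w)).
  rewrite -[x ^+ 2 * y](avg_const _ nE) -!avgZ -!avgD; apply: eq_avg => G _; ring.
rewrite (E_jw rg HB jJ wK) (E_zk rg HB zJ kK) (E_zw rg HB zJ wK) (E_jw_zk rg HB jJ zJ kK wK).
rewrite -/(rho H j) -/(zeta H k) -/(eta H); field.
by rewrite !gt_eqF.
Qed.

End Prob.

End Ratio.

(** * Increment of the exponent under one new edge *)

Section Exponent.
Context {R : realType} {L h : R} {m n s t J K l : nat}.
Hypothesis rg : regime L h m n s t J K l.
Local Notation lambda := (lam R n s).
Local Notation rowdev := (@row_dev R m n s K).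
Local Notation coldev := (@col_dev R m n s J).

Lemma rowdev_degu (H : bgraph m n) (j : 'I_m) : H \subset block J K ->
  rowdev H j = (degu H j)%:R - lambda * K%:R.
Proof.
move=> /subsetP HB; rewrite /row_dev sumrB sum_ord_lt ?(rg_Kn rg)// mulrC; congr (_ - _).
rewrite degu_sum natr_sum big_mkcond; apply: eq_bigr => w _; case: ifP => // wK.
by case: (boolP ((j, w) \in H)) => // /HB; rewrite inE /= wK andbF.
Qed.

Lemma coldev_degv (H : bgraph m n) (k : 'I_n) : H \subset block J K ->
  coldev H k = (degv H k)%:R - lambda * J%:R.
Proof.
move=> /subsetP HB; rewrite /col_dev sumrB sum_ord_lt ?(rg_Jm rg)// mulrC; congr (_ - _).
rewrite degv_sum natr_sum big_mkcond; apply: eq_bigr => i _; case: ifP => // iJ.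
by case: (boolP ((i, k) \in H)) => // /HB; rewrite inE /= iJ.
Qed.

Lemma omega_rowdev (H : bgraph m n) e : H \subset block J K ->
  omega R s J K H e = \sum_(j : 'I_m | (j < J)%N) rowdev H j ^+ e.
Proof. by move=> HB; apply: eq_bigr => j _; rewrite rowdev_degu. Qed.

Lemma omega'_coldev (H : bgraph m n) e : H \subset block J K ->
  omega' R s J K H e = \sum_(k : 'I_n | (k < K)%N) coldev H k ^+ e.
Proof. by move=> HB; apply: eq_bigr => k _; rewrite coldev_degv. Qed.

Section Step.
Variables (H : bgraph m n) (j : 'I_m) (k : 'I_n).
Hypotheses (HB : H \subset block J K) (jJ : (j < J)%N) (kK : (k < K)%N) (jkH : (j, k) \notin H).

Lemma dev_add i w : deviation s ((j, k) |: H) i w = deviation s H i w + ((i == j) && (w == k))%:R :> R.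
Proof.
rewrite /deviation !inE xpair_eqE; case: eqP => [->|_] /=; last by rewrite addr0.
by case: eqP => [->|_] /=; rewrite ?addr0// (negbTE jkH) /=; ring.
Qed.

Lemma rowdev_add i : rowdev ((j, k) |: H) i = rowdev H i + (i == j)%:R.
Proof.
rewrite /row_dev; under eq_bigr do rewrite dev_add.
rewrite big_split /=; congr (_ + _); case: eqP => _ /=; last by rewrite big1.
by rewrite (bigD1 k)//= eqxx big1 ?addr0// => w /andP[_ /negbTE ->].
Qed.

Lemma coldev_add w : coldev ((j, k) |: H) w = coldev H w + (w == k)%:R.
Proof.
rewrite /col_dev; under eq_bigr do rewrite dev_add.
rewrite big_split /=; congr (_ + _); case: eqP => _ /=; last by rewrite big1// => i _; rewrite andbF.
by rewrite (bigD1 j)//= eqxx big1 ?addr0// => w' /andP[_ /negbTE ->].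
Qed.

Lemma block_add : (j, k) |: H \subset block J K.
Proof. by rewrite subUset HB andbT sub1set inE /= jJ. Qed.

Lemma omega_step e : omega R s J K ((j, k) |: H) e =
  omega R s J K H e + ((rowdev H j + 1) ^+ e - rowdev H j ^+ e).
Proof.
rewrite !omega_rowdev ?block_add// (bigD1 j)//= [in RHS](bigD1 j)//= rowdev_add eqxx.
rewrite (eq_bigr (fun i => rowdev H i ^+ e)) => [|i /andP[_ /negbTE ij]]; last by rewrite rowdev_add ij addr0.
by ring.
Qed.

Lemma omega'_step e : omega' R s J K ((j, k) |: H) e =
  omega' R s J K H e + ((coldev H k + 1) ^+ e - coldev H k ^+ e).
Proof.
rewrite !omega'_coldev ?block_add// (bigD1 k)//= [in RHS](bigD1 k)//= coldev_add eqxx.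
rewrite (eq_bigr (fun i => coldev H i ^+ e)) => [|i /andP[_ /negbTE ij]]; last by rewrite coldev_add ij addr0.
by ring.
Qed.

Lemma exponent_step : let d := rowdev H j in let e := coldev H k in
  let w1 := \sum_(i : 'I_m | (i < J)%N) rowdev H i in
  let q := (lambda * (1 - lambda))^-1 in let a := n%:R^-1 in let b := m%:R^-1 in
  main_exponent R s J K ((j, k) |: H) - main_exponent R s J K H =
    (1 - 2 * lambda) * q / 2 * (b + a) - (2 * w1 + 1) * q / 2 * (a * b)
    - (a + K%:R * a ^+ 2) * (2 * d + 1) * q / 2 - (b + J%:R * b ^+ 2) * (2 * e + 1) * q / 2
    - (1 - 2 * lambda) * q ^+ 2 / 6 * ((3 * d ^+ 2 + 3 * d + 1) * a ^+ 2 + (3 * e ^+ 2 + 3 * e + 1) * b ^+ 2).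
Proof.
move=> d e w1 q a b.
have [/andP[l0 l1]] := rg_lam01 rg.
have m0 : (m%:R : R) != 0 by rewrite pnatr_eq0 -lt0n (rg_m0 rg).
have n0 : (n%:R : R) != 0 by rewrite pnatr_eq0 -lt0n (rg_n0 rg).
have l0' : lambda != 0 by rewrite gt_eqF.
have l1' : 1 - lambda != 0 by rewrite subr_eq0 eq_sym lt_eqF.
rewrite /main_exponent !omega_step !omega'_step /Acoef -/d -/e.
have -> : omega R s J K H 1 = w1 by rewrite omega_rowdev//; apply: eq_bigr => i _; rewrite expr1.
move: (omega _ _ _ _ _ _) (omega _ _ _ _ _ _) (omega' _ _ _ _ _ _) (omega' _ _ _ _ _ _) => o2 o3 o2' o3'.
rewrite /q /a /b; field.
by rewrite ?l0' ?l1' ?m0 ?n0.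
Qed.

End Step.
End Exponent.

Section Automation.
Context {R : realType} {L h : R}.
Hypothesis sc : scales L h.
Local Notation Bo := (isO L h).

Lemma BoDl c c' k k' (x y : R) : Bo c k x -> Bo c' k' y -> k' <= k -> Bo (maxn c c').+1 k (x + y).
Proof.
move=> hx hy kk; apply: (BoD sc); first exact: (Bo_weak sc hx (leq_maxl _ _) (lexx _)).
exact: (Bo_weak sc hy (leq_maxr _ _) kk).
Qed.

Lemma BoDr c c' k k' (x y : R) : Bo c k x -> Bo c' k' y -> k <= k' -> Bo (maxn c c').+1 k' (x + y).
Proof.
move=> hx hy kk; apply: (BoD sc); last exact: (Bo_weak sc hy (leq_maxr _ _) (lexx _)).
exact: (Bo_weak sc hx (leq_maxl _ _) kk).
Qed.
End Automation.

(** The orders [c] and [k] are left as existential variables and read off the syntax of the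
    expression; a sum tries either summand as the one with the larger power of [h]. [bo_le] then
    compares closed numbers by computation. *)
Ltac bo sc := lazymatch goal with
  | |- is_true (isO _ _ _ _ (_ + _)) =>
      first [eassumption
            |eapply (BoDl sc); [bo sc | bo sc | reflexivity]
            |eapply (BoDr sc); [bo sc | bo sc | reflexivity]]
  | |- is_true (isO _ _ _ _ (_ * _)) => eapply (BoM sc); [bo sc | bo sc]
  | |- is_true (isO _ _ _ _ (_ ^+ _)) => eapply (BoX sc); bo sc
  | |- is_true (isO _ _ _ _ (- _)) => eapply BoN; bo sc
  | |- _ => eassumption
  end.

Ltac bo_le sc := eapply (Bo_weak sc); [bo sc | reflexivity | reflexivity].

(** * Agreement of the logarithmic ratio with the increment up to third order *)

Section Algebra.
Context {R : realType} {L h : R}.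
Hypothesis sc : scales L h.
Hypothesis big : L ^+ 60 <= h.
Local Notation Bo := (isO L h).
Variables (lam n K m J d e w eu ev : R).
Hypotheses (l0 : lam != 0) (l1 : 1 - lam != 0) (n0 : n != 0) (n1 : n - K != 0)
  (m0 : m != 0) (m1 : m - J != 0).
Hypotheses (hl : Bo 0 0 lam) (hil : Bo 1 0 lam^-1) (hir : Bo 1 0 (1 - lam)^-1).
Hypotheses (hn : Bo 0 (-2) n^-1) (hn1 : Bo 1 (-2) (n - K)^-1) (hm : Bo 0 (-2) m^-1) (hm1 : Bo 1 (-2) (m - J)^-1).
Hypotheses (hK : Bo 1 1 K) (hJ : Bo 1 1 J) (hd : Bo 1 1 d) (he : Bo 1 1 e) (hw : Bo 2 2 w).
Hypotheses (heu : Bo 48 (-3) eu) (hev : Bo 48 (-3) ev).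

(* [1 + su + ru] and [1 + sv + rv] are the normalised path probabilities in the
   classes of [H] and of [(j, k) |: H], split into parts of order [1/h] and
   [1/h^2]; in the second class [d] and [e] have grown by 1. *)
Let rho := d / (n - K).
Let zeta := e / (m - J).
Let eta := w / ((m - J) * (n - K)).
Let su := - ((rho + zeta) * lam^-1).
Let ru := - (eta * (1 - lam)^-1) + rho * zeta * lam^-1 ^+ 2 + ((m - J)^-1 + (n - K)^-1) + eu.
Let sv := (rho + zeta) * (1 - lam)^-1.
Let rv := ((m - J)^-1 + (n - K)^-1) * (1 - lam)^-1 + (eta + ((m - J) * (n - K))^-1) * lam^-1
  + (rho + (n - K)^-1) * (zeta + (m - J)^-1) * (1 - lam)^-1 ^+ 2 + ((m - J)^-1 + (n - K)^-1) + ev.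
Let q := (lam * (1 - lam))^-1.
Let a := n^-1.
Let b := m^-1.

Definition exponent_increment :=
    (1 - 2 * lam) * q / 2 * (b + a) - (2 * w + 1) * q / 2 * (a * b)
    - (a + K * a ^+ 2) * (2 * d + 1) * q / 2 - (b + J * b ^+ 2) * (2 * e + 1) * q / 2
    - (1 - 2 * lam) * q ^+ 2 / 6 * ((3 * d ^+ 2 + 3 * d + 1) * a ^+ 2 + (3 * e ^+ 2 + 3 * e + 1) * b ^+ 2).

Let h1 : Bo 0 0 (1 : R). Proof. by apply: (Bo1 sc); rewrite normr1. Qed.
Let h2 : Bo 1 0 (2 : R). Proof. exact: (Bo_nat sc). Qed.
Let h3 : Bo 2 0 (3 : R). Proof. exact: (Bo_nat sc). Qed.
Let i2 : Bo 0 0 (2^-1 : R). Proof. exact: (Bo_half sc). Qed.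
Let i6 : Bo 0 0 (6^-1 : R). Proof. by apply: (Bo1 sc); rewrite normfV normr_nat invf_le1// ler1n. Qed.

(** All terms up to order [h^-2] cancel. The rewriting displays the rest as products each visibly of
    order [h^-3], from [1/(n - K) - 1/n = K a a'] and [1/(n - K) - 1/n - K/n^2 = K^2 a^2 a'], and
    likewise for [m] and [J]. *)
Lemma main_terms :
  Bo 60 (-3) ((su + ru - su ^+ 2 / 2) - (sv + rv - sv ^+ 2 / 2) - exponent_increment).
Proof.
pose a' := (n - K)^-1; pose b' := (m - J)^-1; pose il := lam^-1; pose ir := (1 - lam)^-1.
have -> : (su + ru - su ^+ 2 / 2) - (sv + rv - sv ^+ 2 / 2) - exponent_increment =
  eu - ev - il * (a' * b') - ir ^+ 2 * (d * (a' * b') + e * (b' * a') + a' * b')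
  - (il * ir) * (d * (K ^+ 2 * (a ^+ 2 * a')) + (lam * (K * (a * a')) - K * (a ^+ 2 * 2^-1)))
  + (1 + - 2 * lam) * ((il * ir) ^+ 2 * (d ^+ 2 * (K * (a * (a' * ((a' + a) * - 2^-1)))) + (3 * d + 1) * (a ^+ 2 * 6^-1)))
  - (il * ir) * (e * (J ^+ 2 * (b ^+ 2 * b')) + (lam * (J * (b * b')) - J * (b ^+ 2 * 2^-1)))
  + (1 + - 2 * lam) * ((il * ir) ^+ 2 * (e ^+ 2 * (J * (b * (b' * ((b' + b) * - 2^-1)))) + (3 * e + 1) * (b ^+ 2 * 6^-1)))
  - (il * ir) * (w * (K * (a * (a' * b')) + J * (a * (b * b'))) - a * b * 2^-1).
  rewrite /su /ru /sv /rv /exponent_increment /q /rho /zeta /eta /a /b /a' /b' /il /ir; field.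
  by rewrite ?l0 ?l1 ?n0 ?n1 ?m0 ?m1.
have ha : Bo 0 (-2) a := hn. have hb : Bo 0 (-2) b := hm.
have ha' : Bo 1 (-2) a' := hn1. have hb' : Bo 1 (-2) b' := hm1.
have hi : Bo 1 0 il := hil. have hi' : Bo 1 0 ir := hir.
move: a' b' il ir a b ha hb ha' hb' hi hi' => a1 b1 il ir a2 b2 *.
have ? := h1; have ? := h2; have ? := h3; have ? := i2; have ? := i6.
have ? := hl; have ? := hK; have ? := hJ; have ? := hd; have ? := he; have ? := hw; have ? := heu; have ? := hev.
bo_le sc.
Qed.

Lemma log_ratio_expansion : [/\ `|su + ru| <= 1 / 4, `|sv + rv| <= 1 / 4 &
  Bo 160 (-3) (ln (1 + (su + ru)) - ln (1 + (sv + rv)) - exponent_increment)].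
Proof.
have ? := h1; have ? := hil; have ? := hir; have ? := hm1; have ? := hn1.
have ? := hd; have ? := he; have ? := hw; have ? := heu; have ? := hev.
have b1 : Bo 50 (-1) su by rewrite /su /rho /zeta; bo_le sc.
have b2 : Bo 50 (-2) ru by rewrite /ru /eta /rho /zeta invfM; bo_le sc.
have b3 : Bo 50 (-1) sv by rewrite /sv /rho /zeta; bo_le sc.
have b4 : Bo 50 (-2) rv by rewrite /rv /eta /rho /zeta invfM; bo_le sc.
have [u4 lu] := ln_expansion sc big b1 b2; have [v4 lv] := ln_expansion sc big b3 b4.
split=> //; have mt := main_terms.
have -> : ln (1 + (su + ru)) - ln (1 + (sv + rv)) - exponent_increment =
  (ln (1 + (su + ru)) - (su + ru - su ^+ 2 / 2)) - (ln (1 + (sv + rv)) - (sv + rv - sv ^+ 2 / 2))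
  + (su + ru - su ^+ 2 / 2 - (sv + rv - sv ^+ 2 / 2) - exponent_increment) by ring.
move: lu lv mt; move: (ln _ - _) (ln _ - _) (_ - exponent_increment) => x y v lu lv mt.
bo_le sc.
Qed.

End Algebra.

(** * Ratio of two neighbouring classes *)

Section RatioEstimate.
Context {R : realType} {L h : R} {m n s t J K l : nat}.
Hypothesis rg : regime L h m n s t J K l.
Local Notation lambda := (lam R n s).
Local Notation Ext := (@extensions m n s t J K).
Local Notation dev := (@deviation R m n s).
Local Notation Bo := (isO L h).
Local Notation m' := (m%:R - J%:R : R).
Local Notation n' := (n%:R - K%:R : R).
Variables (H : bgraph m n) (j : 'I_m) (k : 'I_n).
Hypotheses (HB : H \subset block J K) (jJ : (j < J)%N) (kK : (k < K)%N) (jkH : (j, k) \notin H).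

Lemma card_avg (H1 : bgraph m n) (p : pred (bgraph m n)) : H1 \subset block J K ->
  #|[set G in Ext H1 | p G]|%:R = #|Ext H1|%:R * avg (Ext H1) (fun G => (p G)%:R) :> R.
Proof.
move=> H1B; have := ext_neq0 rg H1B; rewrite -card_gt0 => c0.
rewrite /avg mulrCA divff ?mulr1; last by rewrite pnatr_eq0 -lt0n.
rewrite -natr_sum; congr _%:R; rewrite -sum1_card big_mkcond [RHS]big_mkcond.
by apply: eq_bigr => G _; rewrite inE; case: (G \in Ext H1) => //=; case: (p G).
Qed.

Lemma ratio_estimate :
  Bo 160 (-3) (ln (#|Ext ((j, k) |: H)|%:R / #|Ext H|%:R) - ln (lambda / (1 - lambda))
     - (main_exponent R s J K ((j, k) |: H) - main_exponent R s J K H)).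
Proof.
have pos (x : R) : `|x| <= 1 / 4 -> 0 < 1 + x by rewrite ler_norml => /andP[? _]; lra.
have sc := rg_sc rg; have HB' := block_add HB jJ kK.
have [n0 hn'] := Bo_n'V rg; have [m0 hm'] := Bo_m'V rg.
have Jm : (J < m)%N by rewrite -(ltr_nat R) -subr_gt0.
have Kn : (K < n)%N by rewrite -(ltr_nat R) -subr_gt0.
(* Any outer row and column would serve; these are the first ones beyond the block. *)
pose z := Ordinal Jm; pose w := Ordinal Kn.
have zJ : (J <= z)%N by []. have wK : (K <= w)%N by [].
have [/andP[l0 l1]] := rg_lam01 rg.
have cnt := ext_switch_edge (R := R) s t jJ kK HB jkH zJ wK.
move/(congr1 (fun x : nat => x%:R : R)): cnt; rewrite !card_avg//.
have [e1 [e2 [e3 [he1 he2 he3 hp]]]] := path_moments rg HB jJ zJ kK wK.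
have [f1 [f2 [f3 [hf1 hf2 hf3 hp']]]] := path_moments rg HB' jJ zJ kK wK.
rewrite (eq_avg (f' := fun G => (lambda + dev G j w) * (lambda + dev G z k) * ((1 - lambda) + -1 * dev G z w))); last first.
  by move=> G _; rewrite /deviation; do 3!case: (_ \in G) => /=; ring.
rewrite hp [X in _ = _ * X -> _](eq_avg (f' := fun G => (- (1 - lambda) + dev G j w) * (- (1 - lambda) + dev G z k) *
    (lambda + 1 * dev G z w))); last first.
  by move=> G _; rewrite /deviation; do 3!case: (_ \in G) => /=; ring.
rewrite hp' => {hp hp'}.
have eta' : eta (s := s) (J := J) (K := K) ((j, k) |: H) = eta (s := s) (J := J) (K := K) H + (m' * n')^-1 :> R.
  rewrite /eta (_ : \sum_(i : 'I_m | (i < J)%N) @row_dev R m n s K ((j, k) |: H) i =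
    \sum_(i : 'I_m | (i < J)%N) @row_dev R m n s K H i + 1); first by rewrite mulrDl mul1r.
  under eq_bigr do rewrite rowdev_add//.
  rewrite big_split /=; congr (_ + _); rewrite (bigD1 j)//= eqxx big1 ?addr0// => i /andP[_ /negbTE ->] //.
rewrite eta' /rho /zeta rowdev_add// coldev_add// !eqxx /=.
set w1 := \sum_(i : 'I_m | (i < J)%N) @row_dev R m n s K H i.
set d := row_dev H j; set e := col_dev H k.
have -> : eta (s := s) (J := J) (K := K) H = w1 / (m' * n') by [].
rewrite (exponent_step rg HB jJ kK jkH) -/d -/e -/w1.
(* [eu] and [ev] are the errors of the path moments divided by the leading terms
   [lambda^2 (1 - lambda)] and [lambda (1 - lambda)^2], whose quotient is the factor
   [lambda / (1 - lambda)]. *)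
pose eu := (- (lambda * (e1 / m' + e2 / n')) - e3) * (lambda^-1 ^+ 2 * (1 - lambda)^-1).
pose ev := (- ((1 - lambda) * (f1 / m' + f2 / n')) + f3) * (lambda^-1 * (1 - lambda)^-1 ^+ 2).
have lam0 : lambda != 0 by rewrite gt_eqF.
have lam1 : 1 - lambda != 0 by rewrite subr_eq0 eq_sym lt_eqF.
have nn0 : (n%:R : R) != 0 by rewrite pnatr_eq0 -lt0n (rg_n0 rg).
have mm0 : (m%:R : R) != 0 by rewrite pnatr_eq0 -lt0n (rg_m0 rg).
have [hl hl1 _] := Bo_lam rg.
have [g1 g2] := rg_lam_ge rg.
have hil : Bo 1 0 lambda^-1 by rewrite -oppr0; apply: (Bo_inv sc) => //; rewrite expr0z mulr1 expr1.
have hir : Bo 1 0 (1 - lambda)^-1.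
  by rewrite -oppr0; apply: (Bo_inv sc); rewrite ?subr_gt0// expr0z mulr1 expr1.
have heu : Bo 48 (-3) eu by rewrite /eu; bo_le sc.
have hev : Bo 48 (-3) ev by rewrite /ev; bo_le sc.
have big : L ^+ 60 <= h by apply: le_trans (rg_big rg); exact: (rg_powers rg).
have := log_ratio_expansion sc big lam0 lam1 nn0 (lt0r_neq0 n0) mm0 (lt0r_neq0 m0) hl hil hir
  (Bo_nV rg) hn' (Bo_mV rg) hm' (Bo_K rg) (Bo_J rg) (Bo_rowdev rg H j) (Bo_coldev rg H k) (Bo_total rg H) heu hev.
rewrite -/d -/e -/w1 /exponent_increment.
set u := (X in `|X| <= _); set v := (X in [/\ _, `|X| <= _ & _]).
move=> [u4 v4 hln] cnt.
suff -> : ln (#|Ext ((j, k) |: H)|%:R / #|Ext H|%:R) - ln (lambda / (1 - lambda)) = ln (1 + u) - ln (1 + v) by [].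
have u0 := pos _ u4; have v0 := pos _ v4.
have N0 : 0 < #|Ext H|%:R :> R by rewrite ltr0n card_gt0 (ext_neq0 rg HB).
have N'0 : 0 < #|Ext ((j, k) |: H)|%:R :> R by rewrite ltr0n card_gt0 (ext_neq0 rg HB').
have l1' : 0 < 1 - lambda by rewrite subr_gt0.
transitivity (ln (#|Ext ((j, k) |: H)|%:R / #|Ext H|%:R / (lambda / (1 - lambda)))).
  have q1 : 0 < lambda / (1 - lambda) by exact: divr_gt0.
  have q2 : 0 < #|Ext ((j, k) |: H)|%:R / #|Ext H|%:R :> R by exact: divr_gt0.
  by rewrite [RHS]ln_div ?posrE.
transitivity (ln ((1 + u) / (1 + v))); last by rewrite ln_div ?posrE.
congr ln.
have cnt' : #|Ext H|%:R * (lambda ^+ 2 * (1 - lambda) * (1 + u)) =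
   #|Ext ((j, k) |: H)|%:R * (lambda * (1 - lambda) ^+ 2 * (1 + v)) :> R.
  have -> : lambda ^+ 2 * (1 - lambda) * (1 + u) =
    lambda ^+ 2 * (1 - lambda) - lambda * (1 - lambda) * (d / n' + e / m') + lambda ^+ 2 * -1 * (w1 / (m' * n')) +
      (1 - lambda) * (d / n' * (e / m')) + lambda * -1 * ((e1 - lambda * (1 - lambda)) / m' + (e2 - lambda * (1 - lambda)) / n') + -1 * e3.
    by rewrite /u /eu; field; rewrite lam0 lam1 !gt_eqF.
  rewrite cnt; congr (_ * _); rewrite /v /ev; field.
  by rewrite lam0 lam1 !gt_eqF.
have -> : #|Ext ((j, k) |: H)|%:R = #|Ext H|%:R * (lambda ^+ 2 * (1 - lambda) * (1 + u)) / (lambda * (1 - lambda) ^+ 2 * (1 + v)) :> R.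
  by rewrite cnt' mulfK//; apply: lt0r_neq0; exact: (mulr_gt0 (mulr_gt0 l0 (exprn_gt0 2 l1')) v0).
field; by rewrite lam0 lam1 !gt_eqF.
Qed.

End RatioEstimate.

(** * Normalisation *)

Section Normalisation.
Context {R : realType} {T : finType}.
Variables (P : pred T) (prob beta Q theta : T -> R) (c eps e1 e2 : R).
Hypotheses (beta0 : forall H, P H -> 0 <= beta H) (prob0 : forall H, P H -> 0 <= prob H).
Hypotheses (beta1 : \sum_(H | P H) beta H = 1) (prob1 : \sum_(H | P H) prob H = 1).
Hypothesis probE : forall H, P H -> prob H = expR c * beta H * expR (Q H + theta H).
Hypothesis thetaE : forall H, P H -> `|theta H| <= eps.
Hypotheses (meanb : `|\sum_(H | P H) beta H * Q H| <= e1) (meanp : `|\sum_(H | P H) prob H * Q H| <= e2).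
Hypotheses (e12 : e1 <= 1 / 2) (e22 : e2 <= 1 / 2).

Lemma ln_near1 (x e : R) : `|x| <= e -> e <= 1 / 2 -> - (2 * e) <= ln (1 + x).
Proof.
move=> xe eh; have := xe; rewrite ler_norml => /andP[x0 x1].
have p : 0 < 1 + x by lra.
rewrite lerNl -lnV ?posrE//.
have -> : (1 + x)^-1 = 1 + - x / (1 + x) by field; rewrite gt_eqF.
apply: le_trans (le_ln1Dx _) _.
  by rewrite -subr_gt0 opprK (_ : - x / (1 + x) + 1 = (1 + x)^-1) ?invr_gt0//; field; rewrite gt_eqF.
rewrite ler_pdivrMr//; have e0 : 0 <= e by apply: le_trans xe.
nra.
Qed.

(* Jensen's inequality [e^x >= 1 + x], applied under both measures, bounds the
   normalising constant from both sides. *)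
Lemma normalisation : `|c| <= eps + 2 * e1 + 2 * e2.
Proof.
have eb := meanb; have ep := meanp; have h1 := e12; have h2 := e22.
have e1_0 : 0 <= e1 by apply: le_trans eb.
have e2_0 : 0 <= e2 by apply: le_trans ep.
have xpos (x e : R) : `|x| <= e -> e <= 1 / 2 -> 0 < 1 + x.
  by rewrite ler_norml => /andP[x0 _] eh; lra.
have conclude (y x e : R) : `|x| <= e -> e <= 1 / 2 -> expR y * (1 + x) <= 1 -> y <= 2 * e.
  move=> hx he; rewrite -[X in _ * X](lnK (xpos _ _ hx he)) -expRD expR_le1.
  by have := ln_near1 hx he; lra.
have thb H : P H -> - eps <= theta H <= eps by move=> PH; rewrite -ler_norml; exact: thetaE.
rewrite ler_norml; apply/andP; split; last first.
  have h : expR (c - eps) * (1 + \sum_(H | P H) beta H * Q H) <= 1.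
    rewrite -[leRHS]prob1 -{1}beta1 -big_split /= mulr_sumr; apply: ler_sum => H PH.
    have b0 := beta0 PH; have /andP[t0 _] := thb _ PH.
    have -> : beta H + beta H * Q H = beta H * (1 + Q H) by ring.
    rewrite probE// mulrCA -mulrA [leRHS]mulrCA; apply: ler_wpM2l => //.
    rewrite expRD -mulrA; apply: ler_wpM2l; first exact: expR_ge0.
    apply: (@le_trans _ _ (expR (- eps) * expR (Q H))).
      by apply: ler_wpM2l; [exact: expR_ge0|exact: expR_ge1Dx].
    by rewrite expRD mulrC; apply: ler_wpM2l; [exact: expR_ge0|rewrite ler_expR].
  by have := conclude _ _ _ eb h1 h; lra.
have nep : `|- \sum_(H | P H) prob H * Q H| <= e2 by rewrite normrN.
have h : expR (- c - eps) * (1 - \sum_(H | P H) prob H * Q H) <= 1.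
  rewrite -[leRHS]beta1 -{1}prob1 -sumrB mulr_sumr; apply: ler_sum => H PH.
  have p0 := prob0 PH; have /andP[_ t0] := thb _ PH.
  have -> : beta H = prob H * (expR (- c) * expR (- (Q H + theta H))).
    by rewrite probE// !expRN; field; rewrite !expR_eq0.
  have -> : prob H - prob H * Q H = prob H * (1 - Q H) by ring.
  rewrite mulrCA; apply: ler_wpM2l => //.
  rewrite expRD -mulrA; apply: ler_wpM2l; first exact: expR_ge0.
  apply: (@le_trans _ _ (expR (- eps) * expR (- Q H))).
    by apply: ler_wpM2l; [exact: expR_ge0|exact: expR_ge1Dx].
  rewrite opprD [X in _ <= X]expRD mulrC; apply: ler_wpM2l; [exact: expR_ge0|].
  by rewrite ler_expR lerN2.
by have := conclude _ _ _ nep h2 h; lra.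
Qed.

End Normalisation.

(** * Multiplying the ratios edge by edge *)

Section Telescoping.
Context {R : realType} {L h : R} {m n s t J K l : nat}.
Hypothesis rg : regime L h m n s t J K l.
Local Notation lambda := (lam R n s).
Local Notation Ext := (@extensions m n s t J K).
Implicit Types H : bgraph m n.

Lemma telescoping H : H \subset block J K ->
  `|ln (#|Ext H|%:R / #|Ext set0|%:R) - #|H|%:R * ln (lambda / (1 - lambda))
     - (main_exponent R s J K H - main_exponent R s J K (set0 : bgraph m n))| <= #|H|%:R * (L ^+ 160 * h ^ (-3 : int)).
Proof.
have [k] := ubnP #|H|; elim: k H => // k IH H; rewrite ltnS => Hk HB.
have [->|[e eH]] := set_0Vmem H.
  rewrite cards0 !mul0r !subr0 divff ?ln1 ?subrr ?normr0//.
  by rewrite pnatr_eq0 -lt0n card_gt0; apply: (ext_neq0 rg); exact: sub0set.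
have H1B : H :\ e \subset block J K by apply: subset_trans HB; exact: subsetDl.
have cH : #|H| = #|H :\ e|.+1 by rewrite (cardsD1 e) eH.
have eB : e \in block J K by move/subsetP: HB; apply.
have := IH (H :\ e); rewrite -cH => /(_ Hk H1B) hIH.
move: eH eB cH H1B hIH; case: e => i w eH; rewrite inE /= => /andP[iJ wK] cH H1B hIH.
have niw : (i, w) \notin H :\ (i, w) by rewrite !inE eqxx.
have := ratio_estimate rg H1B iJ wK niw; rewrite setD1K// /isO => hr.
have N0 H' : H' \subset block J K -> 0 < #|Ext H'|%:R :> R.
  by move=> h'; rewrite ltr0n card_gt0 (ext_neq0 rg).
have p1 := N0 _ HB; have p2 := N0 _ H1B; have p3 := N0 _ (sub0set (block J K)).
have -> : ln (#|Ext H|%:R / #|Ext set0|%:R) =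
   ln (#|Ext H|%:R / #|Ext (H :\ (i, w))|%:R) + ln (#|Ext (H :\ (i, w))|%:R / #|Ext set0|%:R) :> R.
  by rewrite !ln_div ?posrE// addrA subrK.
rewrite cH -natr1 mulrDl mul1r [leRHS]mulrDl mul1r.
rewrite [leRHS]addrC; apply: le_trans (lerD hr hIH); apply: le_trans (ler_normD _ _).
by rewrite le_eqVlt; apply/orP; left; apply/eqP; congr `|_|; ring.
Qed.

End Telescoping.

(** * Mean of the exponent under a centred, nearly uncorrelated measure *)

Section MeanExponent.
Context {R : realType} {L h : R} {m n s t J K l : nat}.
Hypothesis rg : regime L h m n s t J K l.
Local Notation lambda := (lam R n s).
Local Notation rowdev := (@row_dev R m n s K).
Local Notation coldev := (@col_dev R m n s J).
Local Notation dev := (@deviation R m n s).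
Local Notation Bo := (isO L h).
Variable mu : bgraph m n -> R.
Local Notation M f := (\sum_(H : bgraph m n | H \subset block J K) mu H * f H).
Hypothesis mu0 : forall H : bgraph m n, H \subset block J K -> 0 <= mu H.
Hypothesis mu1 : \sum_(H : bgraph m n | H \subset block J K) mu H = 1.
Hypothesis mean0 : forall (i : 'I_m) (w : 'I_n), (i < J)%N -> (w < K)%N -> M (fun H => dev H i w) = 0.
Hypothesis row_pair : forall (i : 'I_m) (w w' : 'I_n), (i < J)%N -> (w < K)%N -> (w' < K)%N -> w != w' ->
  `|M (fun H => dev H i w * dev H i w')| <= 2 * h ^- 2.
Hypothesis col_pair : forall (i i' : 'I_m) (w : 'I_n), (i < J)%N -> (i' < J)%N -> (w < K)%N -> i != i' ->
  `|M (fun H => dev H i w * dev H i' w)| <= 2 * h ^- 2.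

Let sc := rg_sc rg.

Lemma M_sum (I : finType) (P : pred I) (F : I -> bgraph m n -> R) :
  M (fun H => \sum_(i | P i) F i H) = \sum_(i | P i) M (F i).
Proof. by under eq_bigr do rewrite mulr_sumr; exact: exchange_big. Qed.

Lemma M_le (f g : bgraph m n -> R) : (forall H : bgraph m n, H \subset block J K -> `|f H| <= g H) ->
  `|M f| <= M g.
Proof.
move=> fg; apply: le_trans (ler_norm_sum _ _ _) _; apply: ler_sum => H HB.
by rewrite normrM ger0_norm ?mu0// ler_wpM2l ?mu0 ?fg.
Qed.

Lemma M_sqr (i : 'I_m) (w : 'I_n) : (i < J)%N -> (w < K)%N ->
  M (fun H => dev H i w * dev H i w) = lambda * (1 - lambda).
Proof.
move=> iJ wK; rewrite (eq_bigr (fun H => lambda * (1 - lambda) * mu H + (1 - 2 * lambda) * (mu H * dev H i w))).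
  by rewrite big_split /= -!mulr_sumr mu1 mean0// mulr1 mulr0 addr0.
by move=> H _; rewrite -expr2 dev_sqr; ring.
Qed.

Lemma Bo_2h : Bo 1 (-2) (2 * h ^- 2).
Proof.
have h0 := rg_h0 rg; have L2 := rg_L2 rg.
rewrite /isO ger0_norm; last by rewrite mulr_ge0// invr_ge0 exprn_ge0// ltW.
by rewrite expr1; apply: ler_pM => //; rewrite invr_ge0 exprn_ge0// ltW.
Qed.

(** The diagonal gives the main term. The off-diagonal pairs, of order [h^3] in number, contribute
    [2 h^-2] each at most. Stated for general index types to serve rows and columns alike. *)
Lemma M_sqsum (I W : finType) (A : pred I) (B : pred W) (g : bgraph m n -> I -> W -> R) (v : R) :
  Bo 1 1 #|A|%:R -> Bo 1 1 #|B|%:R ->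
  (forall i w, A i -> B w -> M (fun H => g H i w * g H i w) = v) ->
  (forall i w w', A i -> B w -> B w' -> w != w' -> `|M (fun H => g H i w * g H i w')| <= 2 * h ^- 2) ->
  Bo 4 1 (M (fun H => \sum_(i | A i) (\sum_(w | B w) g H i w) ^+ 2) - #|A|%:R * (#|B|%:R * v)).
Proof.
move=> hA hB sq pair.
have -> : M (fun H => \sum_(i | A i) (\sum_(w | B w) g H i w) ^+ 2) - #|A|%:R * (#|B|%:R * v) =
  \sum_(i | A i) \sum_(w | B w) \sum_(w' | B w') (M (fun H => g H i w * g H i w') - (w == w')%:R * v).
  rewrite M_sum [X in _ - X]mulr_natl -sumr_const -sumrB; apply: eq_bigr => i Ai.
  rewrite mulr_natl -sumr_const.
  rewrite (eq_bigr (fun H => mu H * (\sum_(w | B w) \sum_(w' | B w') g H i w * g H i w'))); last first.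
    by move=> H _; rewrite expr2 mulr_suml; congr (_ * _); apply: eq_bigr => w _; rewrite mulr_sumr.
  rewrite M_sum -sumrB; apply: eq_bigr => w Bw; rewrite M_sum sumrB; congr (_ - _).
  by rewrite (bigD1 w)//= eqxx mul1r big1 ?addr0// => w' /andP[_ /negbTE]; rewrite eq_sym => ->; rewrite mul0r.
apply: (Bo_sum sc hA (c := 3) (k := 0)) => i Ai.
apply: (Bo_sum sc hB (c := 2) (k := -1)) => w Bw.
apply: (Bo_sum sc hB (c := 1) (k := -2)) => w' Bw'.
have [<-|ww'] := eqVneq w w'; first by rewrite sq// mul1r subrr; exact: (Bo0 sc).
by rewrite mul0r subr0; apply: (Bo_le (pair _ _ _ Ai Bw Bw' ww')); exact: Bo_2h.
Qed.

Lemma card_ord_pred (p q : nat) : (q <= p)%N -> #|(fun i : 'I_p => (i < q)%N)| = q.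
Proof. by move=> qp; rewrite -[RHS](card_ord_lt qp); apply: eq_card => i; rewrite inE. Qed.

Lemma M_rowsq : Bo 4 1 (M (fun H => \sum_(j : 'I_m | (j < J)%N) rowdev H j ^+ 2)
   - J%:R * (K%:R * (lambda * (1 - lambda)))).
Proof.
have := @M_sqsum _ _ (fun j : 'I_m => (j < J)%N) (fun k : 'I_n => (k < K)%N) (fun H j k => dev H j k).
rewrite !card_ord_pred ?(rg_Jm rg) ?(rg_Kn rg)//; apply; [exact: (Bo_J rg)|exact: (Bo_K rg)|exact: M_sqr|exact: row_pair].
Qed.

Lemma M_colsq : Bo 4 1 (M (fun H => \sum_(k : 'I_n | (k < K)%N) coldev H k ^+ 2)
   - K%:R * (J%:R * (lambda * (1 - lambda)))).
Proof.
have := @M_sqsum _ _ (fun k : 'I_n => (k < K)%N) (fun j : 'I_m => (j < J)%N) (fun H k j => dev H j k).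
rewrite !card_ord_pred ?(rg_Jm rg) ?(rg_Kn rg)//; apply; [exact: (Bo_K rg)|exact: (Bo_J rg)| |].
  by move=> k j kK jJ; exact: M_sqr.
by move=> k j j' kK jJ j'J; exact: col_pair.
Qed.

Lemma abs_cube (x y : R) : `|x| <= y -> `|x ^+ 3| <= y * x ^+ 2.
Proof.
by move=> xy; rewrite normrX exprS -(real_normK (num_real x)) ler_wpM2r ?exprn_ge0.
Qed.

(** The means of the two quadratic terms cancel [J K / 2] times [1/m + 1/n], because the mean of
    [omega_2] is [2 A J K] up to order [h], and the linear term has mean zero. The rest is of order
    [1/h]: [omega_1^2] is at most [J omega_2], and a cubic sum at most [K] or [J] times the
    quadratic one. *)
Lemma mean_exponent : Bo 30 (-1) (M (fun H => main_exponent R s J K H)).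
Proof.
pose q := (lambda * (1 - lambda))^-1; pose a : R := n%:R^-1; pose b : R := m%:R^-1.
pose o1 H := \sum_(j : 'I_m | (j < J)%N) rowdev H j.
pose o2 H := \sum_(j : 'I_m | (j < J)%N) rowdev H j ^+ 2.
pose o3 H := \sum_(j : 'I_m | (j < J)%N) rowdev H j ^+ 3.
pose p2 H := \sum_(k : 'I_n | (k < K)%N) coldev H k ^+ 2.
pose p3 H := \sum_(k : 'I_n | (k < K)%N) coldev H k ^+ 3.
have [/andP[l0 l1]] := rg_lam01 rg.
have m0 : (m%:R : R) != 0 by rewrite pnatr_eq0 -lt0n (rg_m0 rg).
have n0 : (n%:R : R) != 0 by rewrite pnatr_eq0 -lt0n (rg_n0 rg).
have l0' : lambda != 0 by rewrite gt_eqF.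
have l1' : 1 - lambda != 0 by rewrite subr_eq0 eq_sym lt_eqF.
have M1 : M o1 = 0.
  rewrite M_sum big1// => j jJ; rewrite /row_dev M_sum big1// => k kK; exact: mean0.
pose x2 := M o2 - J%:R * (K%:R * (lambda * (1 - lambda))).
pose y2 := M p2 - K%:R * (J%:R * (lambda * (1 - lambda))).
have hx2 : Bo 4 1 x2 by exact: M_rowsq.
have hy2 : Bo 4 1 y2 by exact: M_colsq.
have -> : M (fun H => main_exponent R s J K H) =
   - (q * 2^-1 * (M (fun H => o1 H ^+ 2) * (a * b))) - q * 2^-1 * (a * x2) - q * 2^-1 * (K%:R * (a ^+ 2 * M o2))
   - q * 2^-1 * (b * y2) - q * 2^-1 * (J%:R * (b ^+ 2 * M p2))
   - (1 + - 2 * lambda) * (q ^+ 2 * 6^-1 * (M o3 * a ^+ 2 + M p3 * b ^+ 2)).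
  transitivity (M (fun H => J%:R * K%:R / 2 * (b + a) + (1 - 2 * lambda) * q / 2 * (b + a) * o1 H - q * 2^-1 * (a * b) * o1 H ^+ 2
    - q * 2^-1 * (a + K%:R * a ^+ 2) * o2 H - q * 2^-1 * (b + J%:R * b ^+ 2) * p2 H
    - (1 - 2 * lambda) * (q ^+ 2 * 6^-1 * a ^+ 2) * o3 H - (1 - 2 * lambda) * (q ^+ 2 * 6^-1 * b ^+ 2) * p3 H)).
    apply: eq_bigr => H HB; congr (_ * _).
    rewrite /main_exponent !(omega_rowdev rg)// !(omega'_coldev rg)// -/(o2 H) -/(o3 H) -/(p2 H) -/(p3 H) /Acoef.
    rewrite (eq_bigr (fun j => rowdev H j)); last by move=> i _; rewrite expr1.
    rewrite -/(o1 H); move: (o1 H) (o2 H) (o3 H) (p2 H) (p3 H) => z1 z2 z3 z4 z5.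
    by rewrite /q /a /b; field; rewrite ?l0' ?l1' ?m0 ?n0.
  transitivity (J%:R * K%:R / 2 * (b + a) * 1 + (1 - 2 * lambda) * q / 2 * (b + a) * M o1 - q * 2^-1 * (a * b) * M (fun H => o1 H ^+ 2)
    - q * 2^-1 * (a + K%:R * a ^+ 2) * M o2 - q * 2^-1 * (b + J%:R * b ^+ 2) * M p2
    - (1 - 2 * lambda) * (q ^+ 2 * 6^-1 * a ^+ 2) * M o3 - (1 - 2 * lambda) * (q ^+ 2 * 6^-1 * b ^+ 2) * M p3).
    by rewrite -mu1 !mulr_sumr -!sumrN -!big_split /=; apply: eq_bigr => H _; ring.
  rewrite M1 /x2 /y2; move: (M o2) (M p2) (M o3) (M p3) (M (fun H => o1 H ^+ 2)) => z1 z2 z3 z4 z5.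
  by rewrite /q /a /b; field; rewrite ?l0' ?l1' ?m0 ?n0.
have [_ _ hll] := Bo_lam rg.
have hJ := Bo_J rg; have hK := Bo_K rg.
have ho2 : Bo 5 2 (M o2).
  have -> : M o2 = x2 + J%:R * (K%:R * (lambda * (1 - lambda))) by rewrite subrK.
  move: hx2 hll; move: x2 (lambda * (1 - lambda)) => *; bo_le sc.
have hp2 : Bo 5 2 (M p2).
  have -> : M p2 = y2 + K%:R * (J%:R * (lambda * (1 - lambda))) by rewrite subrK.
  move: hy2 hll; move: y2 (lambda * (1 - lambda)) => *; bo_le sc.
have ho1 : Bo 6 3 (M (fun H => o1 H ^+ 2)).
  apply: (@Bo_le _ _ _ _ _ _ (J%:R * M o2)); last by move: (M o2) ho2 => *; bo_le sc.
  have -> : J%:R * M o2 = M (fun H => J%:R * o2 H).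
    by rewrite mulr_sumr; apply: eq_bigr => H _; ring.
  apply: M_le => H HB; rewrite normrX.
  have := cauchy_schwarz (fun j : 'I_m => (j < J)%N%:R) (fun j => (j < J)%N%:R * rowdev H j).
  rewrite (_ : \sum_i _ = o1 H); last first.
    by rewrite /o1 [RHS]big_mkcond; apply: eq_bigr => i _; case: ifP => _; rewrite /= ?mul1r ?mul0r.
  move=> hcs; apply: (le_trans (lerXn2r 2 _ _ hcs)); rewrite ?nnegrE ?mulr_ge0 ?norm2_ge0//.
  rewrite exprMn !sqr_norm2; apply: ler_pM; rewrite ?sumsq_ge0//.
    rewrite -[leRHS]mulr1 -(sum_ord_lt 1 (rg_Jm rg)) [leRHS]big_mkcond; apply: ler_sum => i _.
    by case: ifP => _; rewrite /= ?expr1n ?expr0n.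
  rewrite /o2 [leRHS]big_mkcond; apply: ler_sum => i _.
  by case: ifP => _; rewrite /= ?mul1r ?mul0r ?expr0n.
have ho3 : Bo 6 3 (M o3).
  apply: (@Bo_le _ _ _ _ _ _ (K%:R * M o2)); last by move: (M o2) ho2 => *; bo_le sc.
  have -> : K%:R * M o2 = M (fun H => K%:R * o2 H) by rewrite mulr_sumr; apply: eq_bigr => H _; ring.
  apply: M_le => H HB; apply: le_trans (ler_norm_sum _ _ _) _; rewrite mulr_sumr; apply: ler_sum => j _.
  by apply: abs_cube; exact: (rowdev_le rg).
have hp3 : Bo 6 3 (M p3).
  apply: (@Bo_le _ _ _ _ _ _ (J%:R * M p2)); last by move: (M p2) hp2 => *; bo_le sc.
  have -> : J%:R * M p2 = M (fun H => J%:R * p2 H) by rewrite mulr_sumr; apply: eq_bigr => H _; ring.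
  apply: M_le => H HB; apply: le_trans (ler_norm_sum _ _ _) _; rewrite mulr_sumr; apply: ler_sum => j _.
  by apply: abs_cube; exact: (coldev_le rg).
have hq : Bo 1 0 q := Bo_lamV rg. have ha : Bo 0 (-2) a := Bo_nV rg. have hb : Bo 0 (-2) b := Bo_mV rg.
have i2 : Bo 0 0 (2^-1 : R) := Bo_half sc.
have i6 : Bo 0 0 (6^-1 : R) by apply: (Bo1 sc); rewrite normfV normr_nat invf_le1// ler1n.
have c1 : Bo 0 0 (1 : R) by apply: (Bo1 sc); rewrite normr1.
have c2 : Bo 1 0 (2 : R) by exact: (Bo_nat sc).
have [hl _ _] := Bo_lam rg.
move: ho1 ho2 hp2 ho3 hp3 hx2 hy2 hq ha hb; move: (M (fun H => o1 H ^+ 2)) (M o2) (M p2) (M o3) (M p3) x2 y2 q a b.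
move=> *; bo_le sc.
Qed.

End MeanExponent.

(** * Two-entry correlations without a prescribed block *)

Section Free.
Context {R : realType} {L h : R} {m n s t l : nat}.
Hypothesis rg : regime L h m n s t 0 0 l.
Variable H : bgraph m n.
Hypothesis HB : H \subset block 0 0.
Local Notation lambda := (lam R n s).
Local Notation dev := (@deviation R m n s).
Local Notation E := (avg (@extensions m n s t 0 0 H)).

Lemma free_mean (i : 'I_m) (w : 'I_n) : E (fun G => dev G i w) = 0.
Proof. by rewrite (E_zw rg HB)// big_pred0 ?mul0r. Qed.

(** All pairs in a row have the same correlation by exchangeability, and the row sums to zero; this
    determines it as [- lambda (1 - lambda) / (n - 1)]. *)
Lemma free_row_pair (i : 'I_m) (w w' : 'I_n) : w != w' ->
  `|E (fun G => dev G i w * dev G i w')| <= 2 * h ^- 2.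
Proof.
move=> ww'; have nE := ext_neq0 rg HB.
have [/andP[l0 l1]] := rg_lam01 rg; have h0 := rg_h0 rg.
set x := E _.
have eqx v : v != w -> E (fun G => dev G i w * dev G i v) = x.
  move=> vw; rewrite -(@avg_col_exchange _ _ _ _ _ _ _ _ w' v (fun g => g i w * g i v))//.
  by apply: eq_avg => G _; rewrite tpermR tpermD// eq_sym.
have e : lambda * (1 - lambda) + (n%:R - 1) * x = 0.
  rewrite -[RHS](avg_const 0 nE).
  rewrite (eq_avg (f' := fun G => \sum_v dev G i w * dev G i v)); last first.
    move=> G GE; rewrite -mulr_sumr (@row_sum_dev R _ _ _ _ _ i (rg_n0 rg) (ext_Bst HB GE)).
    by rewrite mulr0.
  rewrite avg_sum (bigD1 w)//= (eq_bigr (fun=> x)) => [|v]; last exact: eqx.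
  congr (_ + _).
    under [RHS]eq_avg => G _ do rewrite -expr2 dev_sqr.
    by rewrite avgD avg_const// avgZ free_mean mulr0 addr0.
  have := sum_ord_ge (R := R) x (leq0n n); rewrite (bigD1 w)//= subr0 => hh.
  by move: hh; rewrite mulrBl mul1r mulrC => <-; rewrite addrAC subrr add0r.
have n2 : (2 : R) <= n%:R by rewrite ler_nat; case/andP: (rg_s rg); lia.
have nh : h ^+ 2 <= n%:R by case/andP: (rg_n rg).
have n1 : 0 < n%:R - 1 :> R by lra.
have -> : x = - (lambda * (1 - lambda)) / (n%:R - 1).
  apply: (mulIf (x := n%:R - 1)); first by rewrite gt_eqF.
  by rewrite divfK ?gt_eqF// mulrC; apply/eqP; rewrite -addr_eq0 addrC e.
have ll0 : 0 <= lambda * (1 - lambda) by apply: mulr_ge0; [exact: ltW|rewrite subr_ge0 ltW].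
rewrite normrM normrN normfV (gtr0_norm n1) (ger0_norm ll0).
have ll : lambda * (1 - lambda) <= 1 by nra.
have h2 : 0 < h ^+ 2 by rewrite exprn_gt0.
rewrite ler_pdivrMr// [leRHS]mulrAC ler_pdivlMr//.
apply: (@le_trans _ _ (1 * h ^+ 2)); last by lra.
by apply: ler_wpM2r => //; exact: ltW.
Qed.

End Free.

(** * The two measures on subgraphs of the block and the estimate at fixed size *)

Section Finite.
Context {R : realType} {L h : R} {m n s t J K l : nat}.
Hypothesis rg : regime L h m n s t J K l.
Local Notation lambda := (lam R n s).
Local Notation dev := (@deviation R m n s).
Local Notation Ext := (@extensions m n s t J K).
Implicit Types H G : bgraph m n.

Definition bern H : R := lambda ^+ #|H| * (1 - lambda) ^+ (J * K - #|H|).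
Definition indprob H : R := #|Ext H|%:R / #|Bst m n s t|%:R.

Lemma rg_free : regime L h m n s t 0 0 l.
Proof.
case: rg => *; split=> //; rewrite mulr_ge0 ?(ltW (rg_L0 rg)) ?(ltW (rg_h0 rg))//.
Qed.

Lemma Bst_free : extensions s t 0 0 set0 = Bst m n s t.
Proof.
by apply/setP => G; rewrite inE andb_idr// => _; apply/eqP/setP => e; rewrite !inE andbF.
Qed.

(** Weights of presence and absence, extended by 0 and 1 off the block. Sums over subgraphs of the
    block thereby become sums over all graphs, to which distributivity of products over sums
    applies. *)
Let F (e : 'I_m * 'I_n) : R := if e \in block J K then lambda else 0.
Let F' (e : 'I_m * 'I_n) : R := if e \in block J K then 1 - lambda else 1.

Lemma bern_prod H : \prod_e (if e \in H then F e else F' e) =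
  if H \subset block J K then bern H else 0.
Proof.
case: ifP => [HB|/negbT/subsetPn[e eH eB]]; last first.
  by rewrite (bigD1 e)//= eH /F (negbTE eB) mul0r.
rewrite (bigID (mem H)) /=; congr (_ * _).
  rewrite -prodr_const; apply: eq_bigr => e eH; by rewrite eH /F (subsetP HB).
have -> : (J * K - #|H| = #|block J K :\: H|)%N.
  by rewrite cardsD (card_block rg) (setIidPr HB).
rewrite -prodr_const big_mkcond [RHS]big_mkcond; apply: eq_bigr => e _; rewrite /F' in_setD.
by case: (e \in H) => //=; case: (e \in block J K).
Qed.

Lemma bern_moment (S : {set 'I_m * 'I_n}) : S \subset block J K ->
  \sum_(H : bgraph m n | H \subset block J K) bern H * \prod_(e in S) dev H e.1 e.2 = (S == set0)%:R.
Proof.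
move=> SB; rewrite big_mkcond.
pose a e : R := F e * (if e \in S then 1 - lambda else 1).
pose b e : R := F' e * (if e \in S then - lambda else 1).
transitivity (\sum_(H in {set 'I_m * 'I_n}) \prod_e (if e \in H then a e else b e)).
  apply: eq_big => // H _.
  have -> : \prod_e (if e \in H then a e else b e) =
      \prod_e (if e \in H then F e else F' e) * \prod_(e in S) dev H e.1 e.2.
    rewrite [X in _ * X]big_mkcond -big_split; apply: eq_bigr => -[i w] _ /=.
    by rewrite /a /b /deviation; case: ifP => _; case: ifP => _; rewrite ?mulr1 ?sub0r.
  by rewrite bern_prod; case: ifP => // _; rewrite mul0r.
rewrite -bigA_distr; have [S0|/set0Pn[e eS]] := eqVneq S set0.
  apply: big1 => e _; rewrite /a /b /F /F' S0 in_set0 !mulr1.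
  by case: ifP => _; rewrite /= ?add0r// addrC subrK.
rewrite (bigD1 e)//= /a /b /F /F' eS (subsetP SB e eS).
by rewrite (_ : _ + _ = 0) ?mul0r//; ring.
Qed.

Lemma bern_pair (i i' : 'I_m) (w w' : 'I_n) : (i, w) \in block J K -> (i', w') \in block J K ->
  (i, w) != (i', w') -> \sum_(H : bgraph m n | H \subset block J K) bern H * (dev H i w * dev H i' w') = 0.
Proof.
move=> h1 h2 ne; have SB : [set (i, w); (i', w')] \subset block J K by rewrite subUset !sub1set h1.
have := bern_moment SB; rewrite (_ : _ == set0 = false); last first.
  by apply/negbTE/set0Pn; exists (i, w); rewrite !inE eqxx.
apply: etrans; apply: eq_bigr => H _; congr (_ * _).
by rewrite big_setU1 ?big_set1// inE.
Qed.

Lemma bern_mean : `|\sum_(H : bgraph m n | H \subset block J K) bern H * main_exponent R s J K H| <= L ^+ 30 * h ^ (-1 : int).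
Proof.
have [/andP[l0 l1]] := rg_lam01 rg; have h0 := rg_h0 rg.
have p2 : 0 <= 2 * h ^- 2 by rewrite mulr_ge0// invr_ge0 exprn_ge0 ?ltW.
apply: (mean_exponent rg).
- by move=> H _; rewrite mulr_ge0 ?exprn_ge0 ?subr_ge0 ?(ltW l0) ?(ltW l1).
- have := bern_moment (sub0set _); rewrite eqxx; apply: etrans.
  by apply: eq_bigr => H _; rewrite big_set0 mulr1.
- move=> i w iJ wK; have SB : [set (i, w)] \subset block J K by rewrite sub1set inE /= iJ.
  have := bern_moment SB; rewrite (_ : _ == set0 = false); last first.
    by apply/negbTE/set0Pn; exists (i, w); rewrite inE.
  by apply: etrans; apply: eq_bigr => H _; rewrite big_set1.
- move=> i w w' iJ wK w'K ww'; rewrite bern_pair ?normr0 ?inE /= ?iJ//.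
  by rewrite xpair_eqE eqxx.
- move=> i i' w iJ i'J wK ii'; rewrite bern_pair ?normr0 ?inE /= ?iJ ?i'J//.
  by rewrite xpair_eqE (negbTE ii').
Qed.

Lemma Bst_gt0 : 0 < #|Bst m n s t|%:R :> R.
Proof. by rewrite -Bst_free ltr0n card_gt0; apply: (ext_neq0 rg_free); exact: sub0set. Qed.

(** Law of total probability over the induced subgraph: block moments under the true distribution
    are moments of an unconditioned graph, that is, of the case [J = K = 0]. *)
Lemma indprob_avg (f : ('I_m -> 'I_n -> R) -> R) :
  (forall H G, H \subset block J K -> G \in Ext H -> f (dev H) = f (dev G)) ->
  \sum_(H : bgraph m n | H \subset block J K) indprob H * f (dev H) =
  avg (extensions s t 0 0 set0) (fun G => f (dev G)).
Proof.
move=> hf; rewrite Bst_free /avg.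
rewrite [in RHS](partition_big (induced J K) (fun H => H \subset block J K)) /=; last first.
  by move=> G _; apply/subsetP => e; rewrite !inE => /andP[].
rewrite mulr_suml; apply: eq_bigr => H HB.
rewrite /indprob mulrAC; congr (_ / _); rewrite -sum1_card natr_sum mulr_suml.
by apply: eq_big => [G|G GE]; [rewrite inE|rewrite mul1r; exact: hf].
Qed.

Lemma indprob_mean : `|\sum_(H : bgraph m n | H \subset block J K) indprob H * main_exponent R s J K H| <= L ^+ 30 * h ^ (-1 : int).
Proof.
have s0 : (set0 : bgraph m n) \subset block 0 0 by exact: sub0set.
have nE := ext_neq0 rg_free s0.
apply: (mean_exponent rg).
- by move=> H _; rewrite divr_ge0.
- have := indprob_avg (f := fun=> 1) (fun _ _ _ _ => erefl); rewrite avg_const// => <-.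
  by apply: eq_bigr => H _; rewrite mulr1.
- move=> i w iJ wK; rewrite (indprob_avg (f := fun g => g i w)) ?(free_mean rg_free s0)//.
  by move=> H G HB GE; rewrite (dev_ext HB GE).
- move=> i w w' iJ wK w'K ww'; rewrite (indprob_avg (f := fun g => g i w * g i w')).
    exact: (free_row_pair rg_free s0).
  by move=> H G HB GE; rewrite !(dev_ext HB GE).
- move=> i i' w iJ i'J wK ii'; rewrite (indprob_avg (f := fun g => g i w * g i' w)).
    rewrite -(E_transpose rg_free s0 (fun g => g i w * g i' w)).
    by apply: (free_row_pair (regime_transpose rg_free)) => //; exact: transpose_block.
  by move=> H G HB GE; rewrite !(dev_ext HB GE).
Qed.

Lemma finite_estimate H : H \subset block J K ->
  exists delta : R, `|delta| <= L ^+ 200 * h ^ (-1 : int) /\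
  prob_induced R s t J K H =
    lambda ^+ #|H| * (1 - lambda) ^+ (J * K - #|H|) * expR (main_exponent R s J K H + delta).
Proof.
have [/andP[l0 l1]] := rg_lam01 rg; have h0 := rg_h0 rg; have L2 := rg_L2 rg; have sc := rg_sc rg.
have l1' : 0 < 1 - lambda by rewrite subr_gt0.
pose H0 : bgraph m n := set0.
have N0 H' : H' \subset block J K -> 0 < #|Ext H'|%:R :> R.
  by move=> h'; rewrite ltr0n card_gt0 (ext_neq0 rg).
have p0 := N0 H0 (sub0set _); have B0 := Bst_gt0.
(* The factor that the ratios leave open; it is 1 if the main term is exact at the empty subgraph.
   [normalisation] bounds its logarithm. *)
pose kappa := #|Ext H0|%:R / #|Bst m n s t|%:R / (1 - lambda) ^+ (J * K) * expR (- main_exponent R s J K H0).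
have k0 : 0 < kappa by rewrite !mulr_gt0 ?invr_gt0 ?exprn_gt0 ?expR_gt0.
pose theta H' := ln (#|Ext H'|%:R / #|Ext H0|%:R) - #|H'|%:R * ln (lambda / (1 - lambda))
     - (main_exponent R s J K H' - main_exponent R s J K H0) : R.
have probE H' : H' \subset block J K -> indprob H' = expR (ln kappa) * bern H' * expR (main_exponent R s J K H' + theta H').
  move=> HB'; rewrite lnK ?posrE//.
  have -> : main_exponent R s J K H' + theta H' =
    ln (#|Ext H'|%:R / #|Ext H0|%:R) - ln (lambda / (1 - lambda)) * #|H'|%:R + main_exponent R s J K H0.
    by rewrite /theta; ring.
  have q0 : 0 < lambda / (1 - lambda) by exact: divr_gt0.
  have q1 : 0 < #|Ext H'|%:R / #|Ext H0|%:R :> R by apply: divr_gt0 => //; exact: N0.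
  rewrite expRD expRB lnK ?posrE// expRM_natr lnK ?posrE// /kappa /bern expRN /indprob.
  have cH : (#|H'| <= J * K)%N by rewrite -(card_block rg); exact: subset_leq_card.
  rewrite -{1}(subnK cH) exprD (@expr_div_n _ lambda (1 - lambda)).
  move: (lambda ^+ _) ((1 - lambda) ^+ _) ((1 - lambda) ^+ _)
    (lt0r_neq0 (exprn_gt0 #|H'| l0)) (lt0r_neq0 (exprn_gt0 #|H'| l1'))
    (lt0r_neq0 (exprn_gt0 (J * K - #|H'|) l1')) => u v v' u0 v0 v'0.
  by field; rewrite ?expR_eq0 ?(gt_eqF B0) ?(gt_eqF p0) ?u0 ?v0 ?v'0.
pose eps := L ^+ 170 * h ^ (-1 : int).
have thetaE H' : H' \subset block J K -> `|theta H'| <= eps.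
  move=> HB'; apply: le_trans (telescoping rg HB') _.
  have cH : isO L h 2 2 (#|H'|%:R : R).
    apply: (@Bo_le _ _ _ _ _ _ (J%:R * K%:R)); last exact: (BoM sc (Bo_J rg) (Bo_K rg)).
    by rewrite ger0_norm// -natrM ler_nat -(card_block rg); exact: subset_leq_card.
  have hz : isO L h 160 (-3) (L ^+ 160 * h ^ (-3 : int)).
    by rewrite /isO ger0_norm// (scale_ge0 sc).
  have := Bo_weak sc (BoM sc cH hz) (isT : (162 <= 170)%N) (isT : 2 - 3 <= -1 :> int).
  by apply: le_trans; exact: ler_norm.
have small : L ^+ 30 * h ^ (-1 : int) <= 1 / 2.
  have L0 := rg_L0 rg.
  rewrite exprN1 ler_pdivrMr//; apply: (@le_trans _ _ (1 / 2 * L ^+ 100)); last first.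
    by apply: ler_wpM2l; [lra|exact: (rg_big rg)].
  have h31 : 2 * L ^+ 30 <= L ^+ 31 by rewrite exprS; exact: (ler_wpM2r (exprn_ge0 30 (ltW L0)) L2).
  have : L ^+ 31 <= L ^+ 100 by exact: (rg_powers rg).
  by move: (L ^+ 30) (L ^+ 31) (L ^+ 100) h31 => x y v; lra.
have sum1 : \sum_(H' : bgraph m n | H' \subset block J K) bern H' = 1.
  have := bern_moment (sub0set _); rewrite eqxx; apply: etrans.
  by apply: eq_bigr => H' _; rewrite big_set0 mulr1.
have sum2 : \sum_(H' : bgraph m n | H' \subset block J K) indprob H' = 1.
  have := indprob_avg (f := fun=> 1) (fun _ _ _ _ => erefl).
  rewrite avg_const ?(ext_neq0 rg_free) ?sub0set// => <-.
  by apply: eq_bigr => H' _; rewrite mulr1.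
have hk := normalisation (P := fun H' : bgraph m n => H' \subset block J K) (c := ln kappa)
  (fun H' _ => mulr_ge0 (exprn_ge0 _ (ltW l0)) (exprn_ge0 _ (ltW l1'))) (fun H' _ => divr_ge0 (ler0n _ _) (ler0n _ _))
  sum1 sum2 probE thetaE bern_mean indprob_mean small small.
move=> HB; exists (ln kappa + theta H); split.
  apply: le_trans (ler_normD _ _) _; apply: le_trans (lerD hk (thetaE _ HB)) _.
  have e30 : L ^+ 30 * h ^ (-1 : int) <= eps by exact: (scale_le sc).
  (* Six times [eps] has to be absorbed: five from the normalising constant and one from
     [theta H]. *)
  have e200 : 2 ^+ 30 * eps <= L ^+ 200 * h ^ (-1 : int).
    rewrite /eps mulrA (exprD L 30 170); apply: ler_wpM2r; first by rewrite exprz_ge0 ?ltW.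
    apply: ler_wpM2r; first by rewrite exprn_ge0 ?(ltW (rg_L0 rg)).
    by apply: lerXn2r; rewrite ?nnegrE ?(ltW (rg_L0 rg)).
  have e0 : 0 <= eps by exact: (scale_ge0 sc).
  have : (6 : R) <= 2 ^+ 30 by rewrite -natrX ler_nat.
  move: (2 ^+ 30) e200 => x e200 x6; have : 6 * eps <= x * eps by apply: ler_wpM2r.
  by move: e30 e200; move: (L ^+ 30 * _) (L ^+ 200 * _) => y z; move: (x * eps) e0; rewrite -/eps; move: (eps) => e u; clear small hk x6; lra.
have -> : prob_induced R s t J K H = indprob H.
  rewrite /prob_induced /indprob; congr (_%:R / _); apply: eq_card => G; rewrite !inE.
  suff -> : induced J K H = H by [].
  by apply/setP => e; rewrite inE andb_idr// => eH; move/subsetP : HB => /(_ _ eH); rewrite inE.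
rewrite probE// [X in _ = _ * expR X]addrCA [X in _ = _ * X]expRD -/(bern H) -mulrA.
exact: mulrCA.
Qed.

End Finite.

(** * Asymptotics *)

Section Asymptotics.
Context {R : realType}.

Lemma ln_le_powR (x eps : R) : 1 <= x -> 0 < eps -> ln x <= x `^ eps / eps.
Proof.
move=> x1 e0; have x0 : 0 < x by apply: lt_le_trans x1.
rewrite ler_pdivlMr// mulrC -ln_powR; apply/ltW/ln_sublinear; exact: powR_gt0.
Qed.

Lemma ln2_ge : 1 / 2 <= ln (2 : R).
Proof.
have : ln (1 / 2 : R) <= 1 / 2 - 1.
  have := @le_ln1Dx R (- (1 / 2)); rewrite (_ : 1 + - (1 / 2) = 1 / 2); last by field.
  by move=> /(_ _)/le_trans; apply; lra.
by rewrite div1r lnV ?posrE//; lra.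
Qed.

Lemma powR_eventually (eps T : R) : 0 < eps -> exists k : nat, forall n, (k <= n)%N -> T <= n%:R `^ eps.
Proof.
move=> e0; exists (Num.truncn (`|T| `^ (eps^-1))).+1 => n kn.
apply: le_trans (ler_norm T) _; 
have -> : `|T| = (`|T| `^ eps^-1) `^ eps by rewrite -powRrM mulVf ?gt_eqF// powRr1.
apply: ge0_ler_powR; rewrite ?nnegrE ?powR_ge0// ?(ltW e0)//.
apply: (@le_trans _ _ (Num.truncn (`|T| `^ eps^-1)).+1%:R); last by rewrite ler_nat.
by apply/ltW; exact: truncnS_gt.
Qed.

Lemma biregular_lt (m n s t : nat) : (0 < m)%N -> (s < n)%N -> (m * s = n * t)%N -> (t < m)%N.
Proof. by nia. Qed.

(** With [x = lambda (1 - lambda)] the quotient [(1 - 2 lambda)^2 / (8 A)] equals [1 / (4 x) - 1],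
    so the logarithmic hypothesis bounds [1 / x]. *)
Lemma density_lower (n s : nat) (a r y : R) : let x := lam R n s * (1 - lam R n s) in
  0 < x -> a <= 1 / 2 -> 0 <= y -> 0 <= r ->
  (1 - 2 * lam R n s) ^+ 2 / (8 * Acoef R n s) * (1 + r) <= a * y -> x^-1 <= 4 + 2 * y.
Proof.
move=> x x0 a2 y0 r0 hA.
have h1 : (1 - 4 * x) / (4 * x) <= 1 / 2 * y.
  apply: (@le_trans _ _ (a * y)); last by apply: ler_wpM2r.
  apply: le_trans hA; rewrite (_ : _ ^+ 2 = 1 - 4 * x); last by rewrite /x; ring.
  have -> : 8 * Acoef R n s = 4 * x by rewrite /Acoef -/x; field.
  rewrite ler_peMr//; last by rewrite lerDl.
  rewrite (_ : 1 - 4 * x = (1 - 2 * lam R n s) ^+ 2); last by rewrite /x; ring.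
  by rewrite divr_ge0 ?sqr_ge0// mulr_ge0 ?(ltW x0).
have h2 : (1 - 4 * x) / (4 * x) = x^-1 / 4 - 1 by field; rewrite lt0r_neq0.
by rewrite h2 in h1; lra.
Qed.

(** Here [8 m n <= n^6], and [ln 2 >= 1/2] doubles the 6 to 12; the 1 pays for rounding up. *)
Lemma up_log_le (m n : nat) : (0 < m)%N -> (2 <= n)%N -> (m <= n ^ 2)%N ->
  (up_log 2 (8 * (m * n)))%:R <= 1 + 12 * ln (n%:R : R).
Proof.
move=> m0 n2 mn; have n0 : (0 < n)%N by exact: leq_trans n2.
have mn8 : (1 < 8 * (m * n))%N by rewrite (@leq_trans 8)// leq_pmulr// muln_gt0 m0.
have /andP[lo _] := up_log_bounds (isT : (1 < 2)%N) mn8.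
set l := up_log _ _ in lo *; have l0 : (0 < l)%N by rewrite up_log_gt0 mn8.
have h1 : l.-1%:R * ln (2 : R) <= 6 * ln (n%:R : R).
  rewrite 2!mulr_natl -!lnXn// ?ltr0n// ler_ln ?posrE ?exprn_gt0 ?ltr0n// -!natrX ler_nat.
  apply: leq_trans (ltnW lo) _; rewrite (_ : n ^ 6 = n ^ 3 * (n ^ 2 * n))%N; last by rewrite -expnSr -expnD.
  by apply: leq_mul; [rewrite -[8%N]/(2 ^ 3)%N leq_exp2r|rewrite leq_mul2r mn orbT].
have h2 : l.-1%:R / 2 <= l.-1%:R * ln (2 : R) by apply: ler_wpM2l => //; have := ln2_ge; lra.
by rewrite -(prednK l0) -natr1; lra.
Qed.

(** The exponent 3 in [L = n^(3 eps)] comes from the block size: [C n^(1/2 + eps)] is at most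
    [n^(1/2 + 2 eps)], while [h] is only known to be at least [n^(1/2 - eps)]. The threshold
    [4 + 12 / eps] for [n^eps] makes the logarithmic quantities, at most [n^eps / eps] up to
    constants, smaller than [L]. *)
Lemma regimeP (eps C a : R) (m n s t J K : nat) :
  let N : R := n%:R in let y := N `^ eps in
  0 < eps -> 302 * eps <= 1 / 2 -> a <= 1 / 2 ->
  2 <= N -> (0 < m)%N -> 4 + 12 / eps <= y -> C <= y ->
  (0 < s < n)%N -> (0 < t)%N -> (m * s = n * t)%N -> (J <= m)%N -> (K <= n)%N ->
  J%:R <= C * N `^ (1 / 2 + eps) -> K%:R <= C * N `^ (1 / 2 + eps) ->
  N <= m%:R `^ (1 + eps) -> m%:R <= N `^ (1 + eps) ->
  (1 - 2 * lam R n s) ^+ 2 / (8 * Acoef R n s)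
    * (1 + 5 * m%:R / (6 * N) + 5 * N / (6 * m%:R)) <= a * ln N ->
  N `^ (1 / 2 - eps) <= Num.sqrt (Num.min m%:R N) /\
  regime (N `^ (3 * eps)) (Num.sqrt (Num.min m%:R N)) m n s t J K (up_log 2 (8 * (m * n))).
Proof.
move=> N y e0 e302 a2 N2 m0 yT Cy sn t0 mst Jm Kn JC KC NM MN hA.
have [s0 sn'] := andP sn; have n0 : (0 < n)%N by exact: leq_ltn_trans sn'.
have mn8 : (1 < 8 * (m * n))%N by rewrite (@leq_trans 8)// leq_pmulr// muln_gt0 m0.
have N1 : 1 <= N by lra.
have N0 : 0 < N by lra.
have pw x z : x <= z -> N `^ x <= N `^ z by move=> xz; exact: ler_powR.
have pD x z : N `^ (x + z) = N `^ x * N `^ z by rewrite powRD// (gt_eqF N0) implybT.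
have ie : 0 < eps^-1 by rewrite invr_gt0.
have ye : 0 <= y / eps by rewrite divr_ge0 ?powR_ge0 ?ltW.
have y4 : 4 <= y by lra.
have yy : 4 * y + 12 * (y / eps) <= y ^+ 2.
  have := ler_wpM2r (le_trans (ler0n _ 4) y4) yT.
  by rewrite expr2 (_ : (4 + 12 / eps) * y = 4 * y + 12 * (y / eps)); last ring.
have y3 : N `^ (3 * eps) = y ^+ 3 by rewrite mulrC powRrM powR_mulrn ?powR_ge0.
have lnN : ln N <= y / eps by exact: ln_le_powR.
set M : R := m%:R in NM MN hA *; have M1 : 1 <= M by rewrite ler1n.
have M0 : 0 < M by lra.
set h := Num.sqrt _; have mn1 : 1 <= Num.min M N by rewrite le_min M1.
have hh : h ^+ 2 = Num.min M N by rewrite sqr_sqrtr//; lra.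
have NyM : N <= y * M.
  have [NleM|/ltW MleN] := leP N M; first by apply: le_trans NleM _; rewrite ler_peMl ?(ltW M0)//; lra.
  apply: le_trans NM _; rewrite powRD ?(gt_eqF M0) ?implybT// powRr1 ?(ltW M0)// mulrC.
  by apply: ler_wpM2r; [exact: ltW|apply: ge0_ler_powR; rewrite ?nnegrE ?(ltW e0) ?(ltW M0) ?(ltW N0)].
have MyN : M <= y * N by rewrite mulrC -{1}[N]powRr1 ?(ltW N0)// -pD.
have hlow : N `^ (1 / 2 - eps) <= h.
  rewrite -[leLHS]ger0_norm ?powR_ge0// -sqrtr_sqr ler_sqrt ?(le_trans ler01)//.
  rewrite -powR_mulrn ?powR_ge0// -powRrM.
  have y0 : 0 < y by lra.
  have e1 : N `^ ((1 / 2 - eps) * 2%:R) <= N / y.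
    by rewrite /y -powRN -{2}[N]powRr1 ?(ltW N0)// -pD; apply: pw; lra.
  apply: le_trans e1 _; rewrite ler_pdivrMr// mulrC minr_pMr ?(ltW y0)// le_min NyM ler_peMl//; lra.
split=> //.
have h0 : 0 < h by apply: lt_le_trans hlow; exact: powR_gt0.
have y2 : y * 4 <= y ^+ 2 by rewrite expr2; apply: ler_wpM2l; lra.
have y23 : y ^+ 2 * 4 <= y ^+ 3 by rewrite (exprSr y 2); apply: ler_wpM2l; [exact: sqr_ge0|lra].
have Ch : C * N `^ (1 / 2 + eps) <= N `^ (3 * eps) * h.
  apply: (@le_trans _ _ (y * N `^ (1 / 2 + eps))); first by apply: ler_wpM2r; rewrite ?powR_ge0.
  apply: (@le_trans _ _ (N `^ (3 * eps) * N `^ (1 / 2 - eps))).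
    by rewrite -!pD; apply: pw; lra.
  by apply: ler_wpM2l; rewrite ?powR_ge0.
have hL : N `^ (3 * eps) ^+ 100 <= h.
  (* [L^100] is [n^(300 eps)], to be compared with [n^(1/2 - eps)]; the hypothesis
     [302 * eps <= 1 / 2] covers this. *)
  apply: le_trans hlow; rewrite -powR_mulrn ?powR_ge0// -powRrM; apply: pw.
  by rewrite (_ : 3 * eps * 100%:R = 300 * eps); [lra|ring].
have l01 : 0 < lam R n s < 1.
  rewrite /lam divr_gt0 ?ltr0n//.
  by rewrite ltr_pdivrMr// mul1r ltr_nat.
have [l0 l1] := andP l01.
have ll : 0 < lam R n s * (1 - lam R n s) by apply: mulr_gt0 => //; rewrite subr_gt0.
split=> //.
- by split; [rewrite y3; lra|rewrite -sqrtr1 ler_sqrt ?(le_trans ler01)].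
- rewrite hh ge_min lexx /= minr_pMr ?powR_ge0// le_min; apply/andP; split.
    by rewrite ler_peMl ?(ltW M0)// y3; lra.
  by apply: le_trans MyN _; apply: ler_wpM2r; [exact: ltW|rewrite y3; lra].
- rewrite hh ge_min lexx orbT /= minr_pMr ?powR_ge0// le_min; apply/andP; split; last first.
    by rewrite ler_peMl ?(ltW N0)// y3; lra.
  by apply: le_trans NyM _; apply: ler_wpM2r; [exact: ltW|rewrite y3; lra].
- exact: le_trans Ch.
- exact: le_trans Ch.
- by rewrite t0 (biregular_lt m0 sn' mst).
- rewrite y3 -[leRHS]invrK lef_pV2 ?posrE ?invr_gt0 ?exprn_gt0//; last by lra.
  have hr : 0 <= 5 * M / (6 * N) + 5 * N / (6 * M).
    by apply: addr_ge0; apply: divr_ge0; rewrite mulr_ge0 ?(ltW M0) ?(ltW N0).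
  rewrite -addrA in hA; have := density_lower ll a2 (ln_ge0 N1) hr hA.
  by move=> hx; apply: le_trans hx _; lra.
- by have /andP[] := up_log_bounds (isT : (1 < 2)%N) mn8.
- have MN2 : (m <= n ^ 2)%N.
    rewrite -(ler_nat R) natrX; apply: le_trans MN _; rewrite -powR_mulrn ?(ltW N0)//; apply: pw; lra.
  have n2 : (2 <= n)%N by rewrite -(ler_nat R).
  by apply: le_trans (up_log_le m0 n2 MN2) _; rewrite y3; lra.
Qed.

End Asymptotics.
Theorem theorem2p5 (R : realType) (a b : R) :
  0 < a -> 0 < b -> a + b < 1 / 2 ->
  exists eps0 : R, 0 < eps0 /\
  forall eps : R, 0 < eps -> eps < eps0 ->
  forall (m n s t J K : nat -> nat) (H : forall i, bgraph (m i) (n i)),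
  (* standing assumptions: positive constant degrees, ms = nt, 0 < lambda < 1 *)
  (forall i, (0 < s i)%N /\ (s i < n i)%N /\ (0 < t i)%N) ->
  (forall i, (m i * s i)%N = (n i * t i)%N) ->
  (forall i, (J i <= m i)%N /\ (K i <= n i)%N) ->
  (* H has no edges outside {u_1..u_J} x {v_1..v_K} *)
  (forall i (e : 'I_(m i) * 'I_(n i)), e \in H i ->
      (e.1 < J i)%N /\ (e.2 < K i)%N) ->
  (* m, n -> infinity *)
  (forall M : nat, exists i0, forall i, (i0 <= i)%N -> (M <= m i)%N /\ (M <= n i)%N) ->
  (* uniform O-bounds *)
  (exists C : R, exists i0, forall i, (i0 <= i)%N ->
     (forall j, (degu (H i) j)%:R <= C * (n i)%:R `^ (1 / 2 + eps)) /\
     (forall k, (degv (H i) k)%:R <= C * (n i)%:R `^ (1 / 2 + eps)) /\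
     (#|H i|%:R <= C * (n i)%:R `^ (1 + 2 * eps)) /\
     ((J i)%:R <= C * (n i)%:R `^ (1 / 2 + eps)) /\
     ((K i)%:R <= C * (n i)%:R `^ (1 / 2 + eps))) ->
  (* n = o(m^(1+eps)), m = o(n^(1+eps)) *)
  (forall d : R, 0 < d -> exists i0, forall i, (i0 <= i)%N ->
     (n i)%:R <= d * (m i)%:R `^ (1 + eps) /\
     (m i)%:R <= d * (n i)%:R `^ (1 + eps)) ->
  (exists i0, forall i, (i0 <= i)%N ->
     (1 - 2 * lam R (n i) (s i)) ^+ 2 / (8 * Acoef R (n i) (s i))
       * (1 + 5 * (m i)%:R / (6 * (n i)%:R) + 5 * (n i)%:R / (6 * (m i)%:R))
     <= a * ln ((n i)%:R)) ->
  (* conclusion, with an O(n^-b) error term in the exponent *)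
  exists C : R, exists i0, forall i, (i0 <= i)%N ->
    exists delta : R, `|delta| <= C * (n i)%:R `^ (- b) /\
    prob_induced R (s i) (t i) (J i) (K i) (H i) =
      lam R (n i) (s i) ^+ #|H i|
      * (1 - lam R (n i) (s i)) ^+ (J i * K i - #|H i|)
      * expR (main_exponent R (s i) (J i) (K i) (H i) + delta).
Proof.
(* The final error [L^200 / h] is at most [n^(601 eps - 1/2)], which is below [n^(-b)] once
   [601 eps <= 1/2 - b]; 1000 leaves room. *)
move=> a0 b0 ab; exists ((1 / 2 - b) / 1000); split; first by rewrite divr_gt0//; lra.
move=> eps e0 he m n s t J K H hpos hms hJK hH hinf [C [i1 hO]] hratio [i2 hA].
rewrite ltr_pdivlMr// in he.
have [k hk] := powR_eventually (Num.max (4 + 12 / eps) C) e0.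
have [i3 hi3] := hinf (maxn k 2); have [i4 hi4] := hratio 1 ltr01.
exists 1, (maxn (maxn i1 i2) (maxn i3 i4)) => i; rewrite !geq_max => /andP[/andP[ge1 ge2] /andP[ge3 ge4]].
have [_ [_ [_ [hJ hK]]]] := hO _ ge1; have [NM MN] := hi4 _ ge4; rewrite !mul1r in NM MN.
have [s0 [sn t0]] := hpos i; have [Jm Kn] := hJK i.
have [] := hi3 _ ge3; rewrite !geq_max => /andP[_ m2] /andP[kn n2].
have := hk _ kn; rewrite ge_max => /andP[y1 y2].
have N2 : 2 <= (n i)%:R :> R by rewrite ler_nat.
have m0 : (0 < m i)%N by apply: leq_trans m2.
have sn' : (0 < s i < n i)%N by rewrite s0.
have e302 : 302 * eps <= 1 / 2 by lra.
have a2 : a <= 1 / 2 by lra.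
have [hlow rg] := regimeP e0 e302 a2 N2 m0 y1 y2 sn' t0 (hms i) Jm Kn hJ hK NM MN (hA _ ge2).
have HB : H i \subset block (J i) (K i).
  by apply/subsetP => e /hH[eJ eK]; rewrite inE eJ eK.
have [delta [hd hp]] := finite_estimate rg HB.
exists delta; split=> //; apply: le_trans hd _; rewrite mul1r.
have N1 : 1 <= (n i)%:R :> R by lra.
have N0 : 0 < (n i)%:R :> R by lra.
apply: (@le_trans _ _ ((n i)%:R `^ (600 * eps) * (n i)%:R `^ (- (1 / 2 - eps)))).
  rewrite -powR_mulrn ?powR_ge0// -powRrM (_ : 3 * eps * 200%:R = 600 * eps); last by ring.
  apply: ler_wpM2l; first exact: powR_ge0.
  rewrite powRN exprN1 lef_pV2 ?posrE ?powR_gt0//.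
  by apply: lt_le_trans hlow; exact: powR_gt0.
by rewrite -powRD ?(gt_eqF N0) ?implybT//; apply: ler_powR => //; lra.
Qed.
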